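(* Let $R$ be a reduced crystallographic root system of rank $n$ in an $n$-dimensional Euclidean space $V$ with fixed simple system, $W$ its Weyl group, $a\in C\cap\mathcal{Q}$, and $P=\mathrm{Conv}(W(a))$ the Weyl polytope. Let $K\subset[n]$ and let $W_K$ be the corresponding parabolic subgroup. Let $X_P$ and $X_{P/W_K}$ be the toric varieties of the normal fans, with respect to the coweight lattice $\mathcal{P}^\vee$, of $P$ and of $P\cap\overline{C_K}$ (which is identified with $P/W_K$). Then the map $\Phi_K: X_P/W_K\to X_{P/W_K}$, which sends the $W_K$-orbit of $[t,p]$ with $p\in P\cap\overline{C_K}$ to $[t,p]$, is a homotopy equivalence.
   Context: Root data. $V$ is an $n$-dimensional real Euclidean space with inner product $\langle-,-\rangle$; $R\subset V$ is a reduced crystallographic root system of rank $n$ with simple roots $\alpha_1,\dots,\alpha_n$; $[n]=\{1,\dots,n\}$. For a root $\alpha$ put $\alpha^\vee=2\alpha/\langle\alpha,\alpha\rangle$ and $s_\alpha(x)=x-\langle x,\alpha\rangle\alpha^\vee$; $s_i=s_{\alpha_i}$. $W$ is the (finite) group generated by all $s_\alpha$; for $K\subset[n]$, $W_K$ is the subgroup generated by $s_k$, $k\in K$. Fundamental coweights $\omega_i^\vee$ are defined by $\langle\omega_i^\vee,\alpha_j\rangle=\delta_{ij}$. $\mathcal{Q}$ is the lattice spanned by the $\alpha_i$ (root lattice) and $\mathcal{P}^\vee$ the lattice spanned by the $\omega_i^\vee$ (coweight lattice); they are dual via $\langle-,-\rangle$. $C=\{x\in V:\langle x,\alpha_i\rangle>0\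 \forall i\in[n]\}$, $C_K=\{x\in V:\langle x,\alpha_k\rangle>0\ \forall k\in K\}$, and $\overline{C_K}$ is the closure $\{x\in V:\langle x,\alpha_k\rangle\ge0\ \forall k\in K\}$. $\overline{C_K}$ is a fundamental domain for $W_K$ on $V$ (each $W_K$-orbit meets it in exactly one point), so $P/W_K$ is identified with the polytope $P\cap\overline{C_K}$. Toric varieties. Put $N=\mathcal{P}^\vee$, $M=\mathcal{Q}$, so $N_{\mathbb{R}}=M_{\mathbb{R}}=V$. For an $n$-dimensional polytope $D\subset V$ whose facet normals are rational with respect to $N$, $\Sigma_D$ is its inward normal fan in $N_{\mathbb R}$ (with lattice $N$) and $X_D$ the associated complex toric variety, with its classical topology. For $p\in D$ let $\sigma^D_p\in\Sigma_D$ be the cone corresponding to the face of $D$ whose relative interior contains $p$, i.e. the cone generated by the inward normals of the facets of $D$ containing $p$. Let $S_N=V/N$; for a cone $\sigma$ let $N(\sigma)$ be the sublattice of $N$ generated by $\sigma\cap N$ and $S_{N(\sigma)}=(N(\sigma)\otimes\mathbb{R}+N)/N\subset S_N$. As a topological space $X_D$ is identified with $(S_N\times D)/\!\sim$, where $(t_1,p_1)\sim(t_2,p_2)$ iff $p_1=p_2$ and $t_1,t_2$ are congruent modulo $S_{N(\sigma^D_{p_1})}$; the class of $(t,p)$ is written $[t,p]$. $W$ (hence $W_K$) acts on $X_P$ by toric automorphisms, in this model by $s[t,p]=[s(t),s(p)]$, and $X_P/W_K$ is the orbit space. $X_{P/W_K}$ means $X_D$ for $D=P\cap\overline{C_K}$.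 The map $\Phi_K$ in the claim is well defined, continuous and surjective. *)

(* Defs.v *)
From HB Require Import structures.
From mathcomp Require Import all_boot all_order all_algebra.
From mathcomp Require Import all_classical all_reals all_analysis.
From mathcomp Require Import ring.

Set Implicit Arguments.
Unset Strict Implicit.
Unset Printing Implicit Defensive.

Import Order.TTheory GRing.Theory Num.Theory.
Import numFieldNormedType.Exports.

Local Open Scope classical_set_scope.
Local Open Scope ring_scope.
Local Open Scope quotient_scope.

Section Homotopy.
Variable R : realType.

Definition homotopic (X Y : topologicalType) (f g : X -> Y) : Prop :=
  exists H : X * R -> Y,
    [/\ {within [set: X] `*` [set` `[0, 1]], continuous H},
        forall x, H (x, 0) = f x & forall x, H (x, 1) = g x].

Definition homotopy_equivalence (X Y : topologicalType) (f : X -> Y) : Prop :=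
  continuous f /\
  exists g : Y -> X,
    [/\ continuous g, homotopic (g \o f) id & homotopic (f \o g) id].

End Homotopy.

Section LinearHulls.
Variables (R : realType) (n : nat).
Local Notation V := 'rV[R]_n.

Definition convex_hull (S : set V) : set V :=
  [set x | exists m (u : 'I_m -> V) (c : 'I_m -> R),
     [/\ forall i, S (u i), forall i, 0 <= c i, \sum_i c i = 1 &
         x = \sum_i c i *: u i]].

Definition cone_hull (S : set V) : set V :=
  [set x | exists m (u : 'I_m -> V) (c : 'I_m -> R),
     [/\ forall i, S (u i), forall i, 0 <= c i & x = \sum_i c i *: u i]].

(* the additive subgroup, resp. the real subspace, generated by [S] *)
Definition subgroup_hull (S : set V) : set V :=
  [set x | forall G : set V, G 0 -> (forall y z, G y -> G z -> G (y - z)) ->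
     S `<=` G -> G x].

Definition linear_hull (S : set V) : set V :=
  [set x | forall U : {vspace V}, S `<=` [set` U] -> x \in U].

Definition int_span (e : 'I_n -> V) : set V :=
  [set x | exists c : 'I_n -> int, x = \sum_i e i *~ c i].

(* [A] is nonempty and the direction space of its affine hull has dimension [d] *)
Definition affine_dim (A : set V) (d : nat) : Prop :=
  exists p, A p /\ exists U : {vspace V},
    [/\ \dim U = d, forall x, A x -> x - p \in U &
        forall U' : {vspace V}, (forall x, A x -> x - p \in U') -> (U <= U')%VS].

End LinearHulls.

Section RootSystems.
Variables (R : realType) (n : nat).
Local Notation V := 'rV[R]_n.

Section InnerProduct.
Variable ip : {dot V for idfun}.

Definition coroot (b : V) : V := (2 / ip b b) *: b.

Definition reflection (b x : V) : V := x - ip x b *: coroot b.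

Record is_root_system (Phi : set V) : Prop := IsRootSystem {
  roots_finite : finite_set Phi;
  roots_span : forall U : {vspace V}, Phi `<=` [set` U] -> U = fullv;
  roots_neq0 : forall b, Phi b -> b != 0;
  roots_reflection : forall b c, Phi b -> Phi c -> Phi (reflection b c);
  roots_crystallographic : forall b c, Phi b -> Phi c ->
    exists z : int, ip c (coroot b) = z%:~R;
  roots_reduced : forall b (r : R), Phi b -> Phi (r *: b) -> r = 1 \/ r = -1 }.

Record is_simple_system (Phi : set V) (alpha : 'I_n -> V) : Prop :=
  IsSimpleSystem {
  simple_root : forall i, Phi (alpha i);
  simple_basis : basis_of fullv [seq alpha i | i <- enum 'I_n];
  simple_sign : forall b, Phi b -> exists c : 'I_n -> nat,
    b = \sum_i alpha i *+ c i \/ b = - \sum_i alpha i *+ c i }.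

(* Reflections are involutions, so the submonoid they generate is the subgroup
   they generate. *)
Inductive reflection_group (S : set V) : (V -> V) -> Prop :=
| reflection_group_id : reflection_group S id
| reflection_group_comp b w : S b -> reflection_group S w ->
    reflection_group S (reflection b \o w).

End InnerProduct.

(* Every [n]-dimensional Euclidean space is isometric to R^n with a suitable
   inner product, so [ip] is arbitrary. *)
Record rootDatum := RootDatum {
  ip : {dot V for idfun};
  roots_of : set V;
  alpha : 'I_n -> V;
  omega : 'I_n -> V;
  roots_ofP : is_root_system ip roots_of;
  alphaP : is_simple_system roots_of alpha;
  omegaP : forall i j, ip (omega i) (alpha j) = (i == j)%:R }.

Variable A : rootDatum.

Definition weyl : set (V -> V) := reflection_group (ip A) (roots_of A).

Definition parabolic (K : {set 'I_n}) : set (V -> V) :=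
  reflection_group (ip A) [set alpha A k | k in [set` K]].

Definition root_lattice : set V := int_span (alpha A).

Definition coweight_lattice : {pred V} := fun x => `[< int_span (omega A) x >].

Definition chamber : set V :=
  [set x | forall i, 0 < ip A x (alpha A i)].

Definition closed_chamber (K : {set 'I_n}) : set V :=
  [set x | forall k, k \in K -> 0 <= ip A x (alpha A k)].

Definition weyl_polytope (a : V) : set V :=
  convex_hull [set w a | w in weyl].

Definition cut_polytope (a : V) (K : {set 'I_n}) : set V :=
  weyl_polytope a `&` closed_chamber K.

Lemma coweight_lattice_zmod : zmod_closed coweight_lattice.
Proof.
split=> [|x y /asboolP[c ->] /asboolP[d ->]]; apply/asboolP.
  by exists (fun=> 0); rewrite big1 // => i _; rewrite mulr0z.
exists (fun i => c i - d i); rewrite -sumrB; apply: eq_bigr => i _.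
by rewrite mulrzBr.
Qed.

HB.instance Definition _ :=
  GRing.isZmodClosed.Build V coweight_lattice coweight_lattice_zmod.

Definition torus : Type :=
  quotient_topology (Quotient.quot coweight_lattice).
HB.instance Definition _ := Topological.on torus.
HB.instance Definition _ := GRing.isZmodule.Build torus
  (@Quotient.addqA V coweight_lattice) (@Quotient.addqC V coweight_lattice)
  (@Quotient.add0q V coweight_lattice) (@Quotient.addNq V coweight_lattice).

Definition torus_pi (v : V) : torus := \pi_(torus) v.

Section Toric.
Variable D : set V.

Definition face (u : V) : set V :=
  [set x | D x /\ forall y, D y -> ip A x u <= ip A y u].

(* [u] is an inward normal of a facet of the [n]-dimensional polytope [D] that
   contains [p]. *)
Definition facet_normal_at (p u : V) : Prop :=
  [/\ u != 0, affine_dim (face u) n.-1 & face u p].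

Definition normal_cone (p : V) : set V := cone_hull (facet_normal_at p).

Definition cone_lattice (sigma : set V) : set V :=
  subgroup_hull (sigma `&` [set` coweight_lattice]).

Definition subtorus (sigma : set V) : set torus :=
  [set torus_pi v | v in linear_hull (cone_lattice sigma)].

Lemma subtorus0 sigma : subtorus sigma 0.
Proof.
exists 0; first by move=> U _; exact: mem0v.
by apply: (@raddf0 _ _ (\pi_(Quotient.quot coweight_lattice))).
Qed.

Lemma subtorusB sigma s t :
  subtorus sigma s -> subtorus sigma t -> subtorus sigma (s - t).
Proof.
move=> [v hv <-] [w hw <-]; exists (v - w).
  by move=> U sU; apply: memvB; [exact: hv|exact: hw].
by apply: (@raddfB _ _ (\pi_(Quotient.quot coweight_lattice))).
Qed.

(* The compact-torus model (V/N x D)/~ of the complex toric variety of the inward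
   normal fan of [D], with lattice N the coweight lattice: its points are the
   classes [t, p]. *)
Definition toric_rel (x y : torus * D) : bool :=
  `[< x.2 = y.2 /\ subtorus (normal_cone (set_val x.2)) (x.1 - y.1) >].

Lemma toric_rel_equiv : equiv_class_of toric_rel.
Proof.
have sym x y : toric_rel x y -> toric_rel y x.
  move=> /asboolP[e s]; apply/asboolP; split; first by rewrite e.
  rewrite -opprB -sub0r; apply: subtorusB; first exact: subtorus0.
  by rewrite -e.
split=> [x|x y|y x z]; first 1 last.
- by apply/idP/idP => /sym.
- move=> /asboolP[e s] /asboolP[e' s']; apply/asboolP.
  split; first by rewrite e.
  have -> : x.1 - z.1 = (x.1 - y.1) - (0 - (y.1 - z.1)).
    by rewrite sub0r opprK addrA subrK.
  apply: subtorusB => //; apply: subtorusB; first exact: subtorus0.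
  by rewrite e.
- by apply/asboolP; split=> //; rewrite subrr; exact: subtorus0.
Qed.

Canonical toric_equiv := EquivRelPack toric_rel_equiv.
Canonical toric_encModRel := defaultEncModRel toric_rel.

Definition toric : Type := quotient_topology {eq_quot toric_rel}.
HB.instance Definition _ := Topological.on toric.

Definition toric_class (t : torus) (p : D) : toric := \pi_(toric) (t, p).

End Toric.

Lemma ipDl z x y : ip A (x + y) z = ip A x z + ip A y z.
Proof. exact: linearDl. Qed.

Lemma ipBl z x y : ip A (x - y) z = ip A x z - ip A y z.
Proof. exact: linearBl. Qed.

Lemma ipBr z x y : ip A z (x - y) = ip A z x - ip A z y.
Proof. exact: linearBr. Qed.

Lemma ipZl c x y : ip A (c *: x) y = c * ip A x y.
Proof. exact: linearZl_LR. Qed.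

Lemma ipZr c x y : ip A x (c *: y) = c * ip A x y.
Proof. exact: linearZr_LR. Qed.

Lemma ipC x y : ip A x y = ip A y x.
Proof. by rewrite (hermC (ip A)) expr0 mul1r. Qed.

Lemma ipMz x y (z : int) : ip A (x *~ z) y = z%:~R * ip A x y.
Proof. by rewrite -ipZl scaler_int. Qed.

Lemma ipNr x y : ip A x (- y) = - ip A x y.
Proof. exact: linearNr. Qed.

Lemma ipMnr x y k : ip A x (y *+ k) = ip A x y *+ k.
Proof. exact: linearMnr. Qed.

Lemma ip_neq0 b : b != 0 -> ip A b b != 0.
Proof. by move=> b0; rewrite gt_eqF // neq0_dnorm_gt0. Qed.

Lemma reflection_linear b : linear (reflection (ip A) b).
Proof.
move=> c x y; rewrite /reflection ipDl ipZl.
by rewrite scalerDl -scalerA scalerBr opprD addrACA.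
Qed.

Lemma ip_corootr b x : b != 0 ->
  ip A b b * ip A x (coroot (ip A) b) = 2 * ip A x b.
Proof.
by move=> b0; rewrite /coroot ipZr mulrCA mulrA divrK // unitfE ip_neq0.
Qed.

Lemma ip_coroot b : b != 0 -> ip A b (coroot (ip A) b) = 2.
Proof.
by move=> b0; apply: (mulfI (ip_neq0 b0)); rewrite ip_corootr // mulrC.
Qed.

Lemma reflectionK b : b != 0 -> involutive (reflection (ip A) b).
Proof.
move=> b0 x; rewrite /reflection ipBl ipZl [ip A (coroot _ _) _]ipC ip_coroot //.
by rewrite mulr_natr mulr2n opprD addrA subrr sub0r scaleNr opprK subrK.
Qed.

Lemma reflection_isometry b x y : b != 0 ->
  ip A (reflection (ip A) b x) (reflection (ip A) b y) = ip A x y.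
Proof.
move=> b0; rewrite /reflection /coroot !(ipBl, ipBr, ipZl, ipZr) [ip A b y]ipC.
by field; exact: ip_neq0.
Qed.

Lemma root_neq0 b : roots_of A b -> b != 0.
Proof. exact: (roots_neq0 (roots_ofP A)). Qed.

Lemma parabolic_sub K : parabolic K `<=` weyl.
Proof.
move=> w; elim=> [|b {}w [k kK <-] _ IH]; first exact: reflection_group_id.
apply: reflection_group_comp => //; exact: (simple_root (alphaP A)).
Qed.

Lemma reflection_group_mul S w w' : reflection_group (ip A) S w ->
  reflection_group (ip A) S w' -> reflection_group (ip A) S (w \o w').
Proof.
elim=> [//|b {}w Sb _ IH] hw'.
exact: (reflection_group_comp Sb (IH hw')).
Qed.

Lemma reflection_group_inv S w : S `<=` roots_of A ->
  reflection_group (ip A) S w ->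
  exists w', [/\ reflection_group (ip A) S w', cancel w w' & cancel w' w].
Proof.
move=> SR; elim=> [|b {}w Sb _ [w' [gw' wK w'K]]].
  by exists id; split=> //; exact: reflection_group_id.
have rK := reflectionK (root_neq0 (SR _ Sb)).
exists (w' \o reflection (ip A) b); split.
- apply: reflection_group_mul => //.
  exact: (reflection_group_comp Sb (reflection_group_id _ _)).
- by move=> x /=; rewrite rK wK.
- by move=> x /=; rewrite w'K rK.
Qed.

Lemma parabolic_inv K w : parabolic K w ->
  exists w', [/\ parabolic K w', cancel w w' & cancel w' w].
Proof.
apply: reflection_group_inv => _ [k _ <-].
exact: (simple_root (alphaP A)).
Qed.

Lemma weyl_isometry w x y : weyl w -> ip A (w x) (w y) = ip A x y.
Proof.
elim=> [//|b {}w Rb _ IH] /=.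
by rewrite reflection_isometry //; exact: root_neq0.
Qed.

Lemma weyl_linear w : weyl w -> exists f : 'End(V), w =1 f.
Proof.
elim=> [|b {}w Rb _ [f wf]]; first by exists \1%VF => x; rewrite lfunE.
pose r := GRing.isLinear.Build R V V *:%R _ (reflection_linear b).
pose rl : {linear V -> V} := HB.pack (reflection (ip A) b) r.
exists (linfun rl \o f)%VF => x; rewrite comp_lfunE.
by rewrite (lfunE rl) /= wf.
Qed.

Lemma simple_ip_inj x y : (forall i, ip A x (alpha A i) = ip A y (alpha A i)) ->
  x = y.
Proof.
move=> xy; apply/eqP; rewrite -subr_eq0; apply: contraT => /ip_neq0/eqP[].
have : x - y \in <<[seq alpha A i | i <- enum 'I_n]>>%VS.
  by rewrite (span_basis (simple_basis (alphaP A))) memvf.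
set s := [seq _ | _ <- _]; move: {1 3}(x - y) => z hz.
rewrite (@coord_span _ _ _ (in_tuple s) z hz) linear_sumr big1 // => i _.
have /mapP[j _ /= ->] : (in_tuple s)`_i \in s by exact: mem_nth.
by rewrite ipZr ipBl xy subrr mulr0.
Qed.

Lemma coweight_latticeP x :
  reflect (forall j, exists z : int, ip A x (alpha A j) = z%:~R)
          (x \in coweight_lattice).
Proof.
apply: (iffP (asboolP _)) => [[c ->] j|].
  exists (c j); rewrite linear_sumlz (bigD1 j) //= big1 ?addr0.
    by rewrite ipMz omegaP eqxx mulr1.
  by move=> i /negPf ij; rewrite ipMz omegaP ij mulr0.
move=> /choice[c hc]; exists c; apply: simple_ip_inj => j.
rewrite hc linear_sumlz (bigD1 j) //= big1 ?addr0.
  by rewrite ipMz omegaP eqxx mulr1.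
by move=> i /negPf ij; rewrite ipMz omegaP ij mulr0.
Qed.

Lemma coweight_lattice_root x b : x \in coweight_lattice -> roots_of A b ->
  exists z : int, ip A x b = z%:~R.
Proof.
move=> /coweight_latticeP/choice[z hz] /(simple_sign (alphaP A))[c].
have h : ip A x (\sum_i alpha A i *+ c i) = (\sum_i z i *+ c i)%:~R.
  rewrite linear_sumr /= rmorph_sum; apply: eq_bigr => i _.
  by rewrite ipMnr hz rmorphMn.
case=> ->; first by eexists; exact: h.
by exists (- \sum_i z i *+ c i); rewrite ipNr h rmorphN.
Qed.

Lemma weyl_coweight w x : weyl w -> x \in coweight_lattice ->
  w x \in coweight_lattice.
Proof.
move=> gw; elim: gw x => [//|b {}w Rb _ IH] x /IH /= {IH}.
move: (w x) => {w}x Nx; apply: rpredB => //.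
have [z ->] := coweight_lattice_root Nx Rb.
rewrite scaler_int rpredMz //; apply/coweight_latticeP => j; rewrite ipC.
exact: (roots_crystallographic (roots_ofP A) Rb (simple_root (alphaP A) j)).
Qed.

Lemma weyl_polytope_stable a w x : weyl w -> weyl_polytope a x ->
  weyl_polytope a (w x).
Proof.
move=> gw [m [u [c [hu c0 c1 ->]]]].
have [f wf] := weyl_linear gw.
exists m, (w \o u), c; split=> //.
  move=> i /=; have [w' gw' <-] := hu i; exists (w \o w') => //.
  exact: reflection_group_mul.
rewrite wf linear_sum; apply: eq_bigr => i _.
by rewrite linearZ /= wf.
Qed.

Lemma torus_piB v v' : torus_pi (v - v') = torus_pi v - torus_pi v'.
Proof. exact: (raddfB (\pi_(Quotient.quot coweight_lattice))). Qed.

Lemma torus_pi_eq v v' : torus_pi v = torus_pi v' <-> v - v' \in coweight_lattice.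
Proof.
split=> [h|h].
  rewrite Quotient.idealrBE; apply/eqP; exact: h.
by have := h; rewrite Quotient.idealrBE => /eqP.
Qed.

Lemma toric_class_eq (D : set V) (t t' : torus) (p p' : D) :
  toric_class t p = toric_class t' p' <->
  p = p' /\ subtorus (normal_cone D (set_val p)) (t - t').
Proof.
split=> [h|h].
  have : (t, p) = (t', p') %[mod {eq_quot @toric_rel D}] by exact: h.
  by move/eqmodP/asboolP.
have : (t, p) = (t', p') %[mod {eq_quot @toric_rel D}].
  by apply/eqmodP/asboolP.
by [].
Qed.

Lemma affine_dim_lfun (f : 'End(V)) (B : set V) d : lker f == 0%VS ->
  affine_dim B d -> affine_dim [set f x | x in B] d.
Proof.
move=> kf [p [Bp [U [dU BU minU]]]]; exists (f p); split; first by exists p.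
exists (f @: U)%VS; split.
- by rewrite limg_dim_eq // (eqP kf) capv0.
- by move=> _ [x Bx <-]; rewrite -linearB memv_img ?BU.
- move=> U' hU'; apply/subvP => _ /memv_imgP[x /(subvP (minU _ _)) + ->].
  move=> /(_ (f @^-1: U')%VS); rewrite -memv_preim; apply=> y By.
  by rewrite -memv_preim linearB; apply: hU'; exists y.
Qed.

Section Equivariance.
Variables (a : V) (w : V -> V).
Hypothesis gw : weyl w.
Let P := weyl_polytope a.

Lemma weyl_inv : exists w', [/\ weyl w', cancel w w' & cancel w' w].
Proof. exact: reflection_group_inv. Qed.

Lemma face_weyl u : face P (w u) = [set w x | x in face P u].
Proof.
have [w' [gw' wK w'K]] := weyl_inv.
apply/seteqP; split=> [x [Px hx]|_ [x [Px hx] <-]].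
  exists (w' x) => //; split; first exact: weyl_polytope_stable.
  move=> y Py; rewrite -(weyl_isometry (w' x) u gw) -(weyl_isometry y u gw) w'K.
  by apply: hx; exact: weyl_polytope_stable.
split=> [|y Py]; first exact: weyl_polytope_stable.
rewrite -(w'K y) !weyl_isometry //; apply: hx; exact: weyl_polytope_stable.
Qed.

Lemma facet_normal_weyl p u : facet_normal_at P p u ->
  facet_normal_at P (w p) (w u).
Proof.
have [f wf] := weyl_linear gw.
have [w' [gw' wK w'K]] := weyl_inv.
have kf : lker f == 0%VS.
  by apply/lker0P => x y; rewrite -!wf => /(can_inj wK).
move=> [u0 dimF Fp]; split.
- by apply: contra u0 => /eqP wu0; apply/eqP/(can_inj wK); rewrite wu0 wf linear0.
- rewrite face_weyl (_ : [set w x | x in _] = [set f x | x in face P u]).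
    exact: affine_dim_lfun.
  by apply: eq_imagel => x _; exact: wf.
- by rewrite face_weyl; exists p.
Qed.

Lemma normal_cone_weyl p x : normal_cone P p x -> normal_cone P (w p) (w x).
Proof.
have [f wf] := weyl_linear gw.
move=> [m [u [c [hu c0 ->]]]]; exists m, (w \o u), c; split=> // [i|].
  exact: facet_normal_weyl.
by rewrite wf linear_sum; apply: eq_bigr => i _; rewrite linearZ /= wf.
Qed.

Lemma cone_lattice_weyl p x : cone_lattice (normal_cone P p) x ->
  cone_lattice (normal_cone P (w p)) (w x).
Proof.
have [f wf] := weyl_linear gw.
move=> hx G G0 GB sG; apply: (hx [set y | G (w y)]).
- by rewrite /= wf linear0.
- move=> y z /= Gy Gz; have -> : w (y - z) = w y - w z by rewrite !wf linearB.
  exact: GB.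
- move=> y [ny Ny] /=; apply: sG; split; first exact: normal_cone_weyl.
  exact: weyl_coweight.
Qed.

Lemma subtorus_weyl p v v' :
  subtorus (normal_cone P p) (torus_pi v - torus_pi v') ->
  subtorus (normal_cone P (w p)) (torus_pi (w v) - torus_pi (w v')).
Proof.
have [f wf] := weyl_linear gw.
move=> [z hz]; rewrite -!torus_piB => /torus_pi_eq e; exists (w z).
  move=> U sU; rewrite wf memv_preim; apply: hz => y hy /=.
  by rewrite -memv_preim -wf; apply: sU; exact: cone_lattice_weyl.
apply/torus_pi_eq; have <- : w (z - (v - v')) = w z - (w v - w v').
  by rewrite !wf !linearB.
exact: weyl_coweight.
Qed.

End Equivariance.

Section OrbitSpace.
Variables (a : V) (K : {set 'I_n}).
Let P := weyl_polytope a.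

(* [w] acts by w.[t, p] = [w t, w p], where w t is the class of [w v] when [t] is
   the class of [v] in V/N. *)
Definition orbit_rel (x y : toric P) : bool :=
  `[< exists w v (p q : P), [/\ parabolic K w, set_val q = w (set_val p),
        x = toric_class (torus_pi v) p & y = toric_class (torus_pi (w v)) q] >].

Lemma toric_classP (D : set V) (x : toric D) :
  exists v p, x = toric_class (torus_pi v) p.
Proof.
have -> : x = \pi_(toric D) (repr x) by rewrite reprK.
case: (repr x) => t p; exists (repr (t : Quotient.quot coweight_lattice)), p.
rewrite -/(toric_class t p); congr toric_class.
exact/esym/(@reprK _ (Quotient.quot coweight_lattice)).
Qed.

Lemma orbit_rel_equiv : equiv_class_of orbit_rel.
Proof.
have sym x y : orbit_rel x y -> orbit_rel y x.
  move=> /asboolP[w [v [p [q [gw qE -> ->]]]]]; apply/asboolP.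
  have [w' [gw' wK w'K]] := parabolic_inv gw.
  by exists w', (w v), q, p; rewrite qE !wK.
split=> [x|x y|y x z]; first 1 last.
- by apply/idP/idP => /sym.
- move=> /asboolP[w [v [p [q [gw qE -> ->]]]]].
  move=> /asboolP[w' [v' [p' [q' [gw' q'E /toric_class_eq[e s] ->]]]]].
  apply/asboolP; exists (w' \o w), v, p, q'; split=> //.
  + exact: reflection_group_mul.
  + by rewrite q'E -e qE.
  + apply/esym/toric_class_eq; split=> //=.
    by rewrite q'E -e; apply: subtorus_weyl => //; exact: parabolic_sub gw'.
- have [v [p ->]] := toric_classP x; apply/asboolP.
  by exists id, v, p, p; split=> //; exact: reflection_group_id.
Qed.

Canonical orbit_equiv := EquivRelPack orbit_rel_equiv.
Canonical orbit_encModRel := defaultEncModRel orbit_rel.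

Definition orbit_space : Type := quotient_topology {eq_quot orbit_rel}.
HB.instance Definition _ := Topological.on orbit_space.

Definition orbit_class (x : toric P) : orbit_space := \pi_(orbit_space) x.

(* These equations determine [f], since every [parabolic K]-orbit in V meets
   [closed_chamber K]. *)
Definition is_orbit_map (f : orbit_space -> toric (cut_polytope a K)) : Prop :=
  forall (t : torus) (p : P) (q : cut_polytope a K), set_val p = set_val q ->
    f (orbit_class (toric_class t p)) = toric_class t q.

End OrbitSpace.

End RootSystems.

(* Main.v *)
Require Import Defs.
From HB Require Import structures.
From mathcomp Require Import all_boot all_order all_algebra.
From mathcomp Require Import all_classical all_reals all_analysis.
From mathcomp Require Import ring lra.

(* Both spaces are quotients of V x D, where D = P \cap \overline{C_K}: over p the
   first is cut out by N, the span of the facet normals of P at p and the stabiliser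
   W_J of p in W_K, J = {k in K : <p, alpha_k> = 0}; the second by N and the span of
   the facet normals of D at p, which is the span of those of P plus the span of the
   alpha_j, j in J.  So Phi_K only collapses span(alpha_J) / (W_J and N), a quotient of
   an alcove, to a point.
   A homotopy inverse is explicit.  For J in K the map [pull J s] moves v a fraction s
   of the way to the centre of its Phi_J-alcove; modulo N and W_J it is well defined and
   continuous, and at s = 1 it forgets the span of alpha_J because all alcoves are
   conjugate.  Parametrise a collar of each wall by lambda_k in [0, 1], and apply the
   pulls along the flag of sublevel sets of lambda, with strengths given by the gaps of
   lambda, while p is pushed across the collars onto the walls.  Near p the walls that
   matter are orthogonal to the facet normals of P at p (since a is regular), so that
   everything respects the identifications over the boundary of P. *)

Set Implicit Arguments.
Unset Strict Implicit.
Unset Printing Implicit Defensive.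

Import Order.TTheory GRing.Theory Num.Theory.
Import numFieldNormedType.Exports.

Local Open Scope classical_set_scope.
Local Open Scope ring_scope.
Local Open Scope quotient_scope.

(** * Roots and parabolic subgroups *)

Section Roots.
Variables (R : realType) (n : nat) (A : rootDatum R n).
Local Notation V := 'rV[R]_n.
Local Notation ip := (ip A).
Local Notation alpha := (alpha A).
Local Notation omega := (omega A).
Local Notation "'s_" := (reflection ip) (at level 0).

(** The obstacle is that an alcove centre jumps when [v] crosses a wall of the integral arrangement.
    The jump is undone by an element of [W_J] and a lattice vector, but the source identifies such
    points only over the common wall of [J]. Hence [p] must move together with [v]: every wall
    taking part in a pull has to contain the pushed point. Nestedness has the same origin: the
    ambiguity in [W_J] left by one pull is absorbed by the next one only if its set contains [J].
    The scale [n.+1] comes from the pigeonhole principle: at most [n] levels leave a gap of length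
    at least [1 / n.+1] below [1], so at time [0] some pull has full strength as soon as [p] lies on
    a wall. The collar width is half of [d], a lower bound for the absolute pairings of vertices
    with roots; a root whose pairing with a point of a face is smaller than [d] in absolute value is
    orthogonal to the normals of that face. One family of maps serves twice: at time [0] it factors
    through the target and gives the inverse, and over the unit interval it is the homotopy on the
    source. *)

Lemma ipDr z x y : ip z (x + y) = ip z x + ip z y.
Proof. exact: linearDr. Qed.

Lemma ipNl x y : ip (- x) y = - ip x y.
Proof. exact: linearNl. Qed.

Lemma ip0l x : ip 0 x = 0.
Proof. exact: linear0l. Qed.

Lemma ip0r x : ip x 0 = 0.
Proof. exact: linear0r. Qed.

Lemma ip_suml I (s : seq I) P (F : I -> V) x :
  ip (\sum_(i <- s | P i) F i) x = \sum_(i <- s | P i) ip (F i) x.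
Proof. exact: linear_sumlz. Qed.

Lemma ip_sumr I (s : seq I) P (F : I -> V) x :
  ip x (\sum_(i <- s | P i) F i) = \sum_(i <- s | P i) ip x (F i).
Proof. exact: linear_sumr. Qed.

Lemma ip_ge0 x : 0 <= ip x x.
Proof.
have [->|x0] := eqVneq x 0; first by rewrite ip0l.
by rewrite ltW // neq0_dnorm_gt0.
Qed.

Lemma ip_eq0 x : ip x x = 0 -> x = 0.
Proof. by move=> /eqP; apply: contraTeq => /ip_neq0. Qed.

Lemma alpha_root i : roots_of A (alpha i).
Proof. exact: (simple_root (alphaP A)). Qed.

Lemma root_ratio_gt0 b : roots_of A b -> 0 < 2 / ip b b.
Proof. by move=> Rb; rewrite divr_gt0 // neq0_dnorm_gt0 // (root_neq0 Rb). Qed.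

Lemma alpha_neq0 i : alpha i != 0.
Proof. exact/root_neq0/alpha_root. Qed.

Lemma alpha_gt0 i : 0 < ip (alpha i) (alpha i).
Proof. by rewrite neq0_dnorm_gt0 // alpha_neq0. Qed.

Lemma ip_omega i j : ip (alpha i) (omega j) = (i == j)%:R.
Proof. by rewrite ipC omegaP eq_sym. Qed.

Lemma omega_expand x : x = \sum_i ip x (alpha i) *: omega i.
Proof.
apply: (@simple_ip_inj _ _ A) => j; rewrite ip_suml (bigD1 j) //= ipZl omegaP.
rewrite eqxx mulr1 big1 ?addr0 // => i ij.
by rewrite ipZl omegaP (negPf ij) mulr0.
Qed.

Lemma alpha_expand x : x = \sum_i ip x (omega i) *: alpha i.
Proof.
have := simple_basis (alphaP A); set bs := [seq _ | _ <- _] => /span_basis sE.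
have : x \in <<bs>>%VS by rewrite sE memvf.
rewrite (_ : bs = image_tuple alpha 'I_n) // => /coord_span xE.
rewrite {1}xE; have szE : #|'I_n| = n by rewrite card_ord.
have [c xc] : exists c : 'I_n -> R, x = \sum_i c i *: alpha i.
  exists (fun i => coord (image_tuple alpha 'I_n) (enum_rank i) x).
  rewrite [LHS]xE (reindex enum_rank) /=.
    apply: eq_bigr => i _; rewrite (nth_map i) ?nth_enum_rank //.
    by rewrite -cardE ltn_ord.
  by exists enum_val => i _; rewrite ?enum_rankK ?enum_valK.
rewrite -xE {1}xc; apply: eq_bigr => i _; congr (_ *: _).
rewrite xc ip_suml (bigD1 i) //= ipZl ip_omega eqxx mulr1 big1 ?addr0 //.
by move=> j ji; rewrite ipZl ip_omega (negPf ji) mulr0.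
Qed.

Lemma omega_ip_inj x y : (forall i, ip x (omega i) = ip y (omega i)) -> x = y.
Proof.
move=> h; rewrite (alpha_expand x) (alpha_expand y).
by apply: eq_bigr => i _; rewrite h.
Qed.

Lemma ip_expand x y : ip x y = \sum_i ip x (omega i) * ip (alpha i) y.
Proof.
by rewrite {1}(alpha_expand x) ip_suml; apply: eq_bigr => i _; rewrite ipZl.
Qed.

(** The real span of the simple roots in [J] (see [alpha_expand]), encoded by vanishing coefficients
    so that no [{vspace V}] has to be carried along. *)
Definition spanJ (J : {set 'I_n}) (x : V) :=
  forall i, i \notin J -> ip x (omega i) = 0.

Lemma spanJ0 J : spanJ J 0.
Proof. by move=> i _; rewrite ip0l. Qed.

Lemma spanJD J x y : spanJ J x -> spanJ J y -> spanJ J (x + y).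
Proof. by move=> hx hy i iJ; rewrite ipDl hx // hy // addr0. Qed.

Lemma spanJN J x : spanJ J x -> spanJ J (- x).
Proof. by move=> hx i iJ; rewrite ipNl hx // oppr0. Qed.

Lemma spanJB J x y : spanJ J x -> spanJ J y -> spanJ J (x - y).
Proof. by move=> hx hy; apply: spanJD => //; exact: spanJN. Qed.

Lemma spanJZ J c x : spanJ J x -> spanJ J (c *: x).
Proof. by move=> hx i iJ; rewrite ipZl hx // mulr0. Qed.

Lemma spanJ_alpha (J : {set 'I_n}) j : j \in J -> spanJ J (alpha j).
Proof. by move=> jJ i; rewrite ip_omega; case: eqVneq => // <-; rewrite jJ. Qed.

Lemma spanJ_sub (J J' : {set 'I_n}) x : J \subset J' -> spanJ J x -> spanJ J' x.
Proof. by move=> /fintype.subsetP JJ' hx i iJ; apply/hx/(contra _ iJ)/JJ'. Qed.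

Lemma spanJ_sum J I (s : seq I) (P : pred I) (F : I -> V) :
  (forall i, P i -> spanJ J (F i)) -> spanJ J (\sum_(i <- s | P i) F i).
Proof.
move=> h; apply: big_ind => //; first exact: spanJ0.
by move=> x y; exact: spanJD.
Qed.

Lemma spanJ_perp (J : {set 'I_n}) x u :
  spanJ J x -> (forall j, j \in J -> ip (alpha j) u = 0) -> ip x u = 0.
Proof.
move=> hx hu; rewrite ip_expand big1 // => i _.
case: (boolP (i \in J)) => iJ; first by rewrite hu ?mulr0.
by rewrite hx ?mul0r.
Qed.

Section WeylElement.
Variable w : V -> V.
Hypothesis gw : weyl A w.

Lemma weylD x y : w (x + y) = w x + w y.
Proof. by have [f wf] := weyl_linear gw; rewrite !wf linearD. Qed.

Lemma weylN x : w (- x) = - w x.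
Proof. by have [f wf] := weyl_linear gw; rewrite !wf linearN. Qed.

Lemma weylB x y : w (x - y) = w x - w y.
Proof. by have [f wf] := weyl_linear gw; rewrite !wf linearB. Qed.

Lemma weylZ c x : w (c *: x) = c *: w x.
Proof. by have [f wf] := weyl_linear gw; rewrite !wf linearZ. Qed.

Lemma weyl_sum I (s : seq I) P (F : I -> V) :
  w (\sum_(i <- s | P i) F i) = \sum_(i <- s | P i) w (F i).
Proof.
have [f wf] := weyl_linear gw; rewrite wf linear_sum.
by apply: eq_bigr => i _; rewrite wf.
Qed.

Lemma weyl_root b : roots_of A b -> roots_of A (w b).
Proof.
elim: gw => [//|c v Rc _ IH] Rb /=.
exact: (roots_reflection (roots_ofP A) Rc (IH Rb)).
Qed.

Lemma reflection_conj b x : 's_ (w b) (w x) = w ('s_ b x).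
Proof.
rewrite /reflection /coroot weyl_isometry // weylB weylZ weylZ.
by rewrite weyl_isometry.
Qed.

Lemma weyl_inj : injective w.
Proof. by have [w' [_ wK _]] := weyl_inv gw; exact: can_inj wK. Qed.

End WeylElement.

Lemma weyl_perm_roots w w' : weyl A w -> weyl A w' ->
  (forall i, w (alpha i) = w' (alpha i)) -> w = w'.
Proof.
move=> gw gw' h; apply/funext => x; rewrite (alpha_expand x) !weyl_sum //.
by apply: eq_bigr => i _; rewrite !weylZ // h.
Qed.

Lemma weyl_finite : finite_set (weyl A).
Proof.
have [X XE] := (finite_seqP _).1 (roots_finite (roots_ofP A)).
pose F (w : V -> V) : {ffun 'I_n -> option (seq_sub X)} := [ffun i => insub (w (alpha i))].
have Finj : {in weyl A &, injective F}.
  move=> w w' /set_mem gw /set_mem gw' /ffunP FE.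
  apply: weyl_perm_roots => // i; have := FE i; rewrite !ffunE.
  have inX u : weyl A u -> u (alpha i) \in X.
    move=> gu; have : roots_of A (u (alpha i)) by apply: weyl_root (alpha_root i).
    by rewrite XE.
  by rewrite !insubT ?inX // => ? ? [].
by rewrite -(eq_finite_set (inj_card_eq Finj)); exact: finite_finset.
Qed.

Lemma parabolicS (J J' : {set 'I_n}) w : J \subset J' -> parabolic A J w ->
  parabolic A J' w.
Proof.
move=> /fintype.subsetP JJ'; elim=> [|b {}w [k /= kJ <-] _ IH].
  exact: reflection_group_id.
by apply: reflection_group_comp => //; exists k => //=; exact: JJ'.
Qed.

Lemma parabolic_weyl J w : parabolic A J w -> weyl A w.
Proof. exact: parabolic_sub. Qed.

Lemma parabolic_spanJ J w x : parabolic A J w -> spanJ J (w x - x).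
Proof.
elim=> [|b {}w [k /= kJ <-] _ IH] /=; first by rewrite subrr; exact: spanJ0.
rewrite /reflection addrAC; apply: spanJB => //.
by do 2 apply: spanJZ; exact: spanJ_alpha.
Qed.

Lemma parabolic_fix (J : {set 'I_n}) w x : parabolic A J w ->
  (forall j, j \in J -> ip (alpha j) x = 0) -> w x = x.
Proof.
move=> + hx; elim=> [//|b {}w [k /= kJ <-] _ IH] /=.
by rewrite IH /reflection ipC hx // scale0r subr0.
Qed.

Lemma parabolic_refl (J : {set 'I_n}) j : j \in J -> parabolic A J ('s_ (alpha j)).
Proof.
move=> jJ.
by apply: (@reflection_group_comp _ _ _ _ _ id); [exists j|exact: reflection_group_id].
Qed.

Lemma parabolic_finite J : finite_set (parabolic A J).
Proof. exact: (sub_finite_set (@parabolic_sub _ _ A J) weyl_finite). Qed.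

(* The coordinate [ip b (omega i)] is the coefficient of [alpha i] in [b]. *)
Definition pos_root b := roots_of A b /\ forall i, 0 <= ip b (omega i).

Lemma root_sign b : roots_of A b -> pos_root b \/ pos_root (- b).
Proof.
move=> Rb; have [c [bE|bE]] := simple_sign (alphaP A) Rb; [left|right].
  split=> // i; rewrite bE ip_suml sumr_ge0 // => j _.
  by rewrite ipC ipMnr ipC ip_omega mulrn_wge0.
have RNb : roots_of A (- b).
  have := roots_reflection (roots_ofP A) Rb Rb.
  rewrite /reflection /coroot scalerA mulrCA mulfV.
    by rewrite mulr1 scaler_nat mulr2n opprD addrA subrr sub0r.
  exact: (ip_neq0 A (root_neq0 Rb)).
split=> // i; rewrite bE opprK ip_suml sumr_ge0 // => j _.
by rewrite ipC ipMnr ipC ip_omega mulrn_wge0.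
Qed.

Lemma pos_rootN b : pos_root b -> pos_root (- b) -> False.
Proof.
move=> [Rb b0] [_ Nb0]; have /eqP := root_neq0 Rb; apply.
apply: omega_ip_inj => i; rewrite ip0l; apply/eqP; rewrite eq_le b0 andbT.
by rewrite -oppr_ge0 -ipNl.
Qed.

Lemma pos_alpha i : pos_root (alpha i).
Proof. by split=> [|j]; [exact: alpha_root|rewrite ip_omega ler0n]. Qed.

(** The reflection changes only the coefficient of [alpha i], so all others vanish, and reducedness
    decides the multiple. *)
Lemma pos_root_refl i b : pos_root b -> pos_root (- 's_ (alpha i) b) ->
  b = alpha i.
Proof.
move=> [Rb b0] [_ sb0].
have cf j : j != i -> ip b (omega j) = 0.
  move=> ji; apply/eqP; rewrite eq_le b0 andbT.
  have := sb0 j; rewrite ipNl /reflection ipBl !ipZl ip_omega [i == j]eq_sym.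
  by rewrite (negPf ji) !mulr0 subr0 oppr_ge0.
have bE : b = ip b (omega i) *: alpha i.
  rewrite {1}(alpha_expand b) (bigD1 i) //= big1 ?addr0 // => j ji.
  by rewrite cf ?scale0r.
have := roots_reduced (roots_ofP A) (alpha_root i).
move=> /(_ (ip b (omega i))); rewrite -bE => /(_ Rb)[] ce.
  by rewrite bE ce scale1r.
by have := b0 i; rewrite ce lerNr oppr0 ler10.
Qed.

(** * Words in simple reflections: exchange and dominance *)

Definition act (l : seq 'I_n) : V -> V := foldr (fun i w => 's_ (alpha i) \o w) id l.

Lemma act_cat l l' : act (l ++ l') = act l \o act l'.
Proof. by elim: l => //= i l ->. Qed.

Lemma act_rcons l i : act (rcons l i) = act l \o 's_ (alpha i).
Proof. by rewrite -cats1 act_cat. Qed.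

Lemma act_parabolic (J : {set 'I_n}) l : {subset l <= J} -> parabolic A J (act l).
Proof.
elim: l => [|i l IH] lJ /=; first exact: reflection_group_id.
apply: reflection_group_comp; first by exists i => //=; apply: lJ; rewrite inE eqxx.
by apply: IH => j jl; apply: lJ; rewrite inE jl orbT.
Qed.

Lemma parabolic_act J w : parabolic A J w -> exists2 l, {subset l <= J} & w = act l.
Proof.
elim=> [|b {}w [k /= kJ <-] _ [l lJ ->]]; first by exists [::].
by exists (k :: l) => // j; rewrite inE => /predU1P[->|/lJ].
Qed.

Lemma act_weyl l : weyl A (act l).
Proof.
by apply: (@parabolic_weyl [set: 'I_n]); apply: act_parabolic => i; rewrite !inE.
Qed.

(** Exchange condition. At the letter where the image of [alpha k] turns negative, that image was
    the simple root of the letter, and [reflection_conj] lets the letter be deleted. *)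
Lemma act_exchange (l : seq 'I_n) k : pos_root (- act l (alpha k)) ->
  exists l' : seq 'I_n, [/\ {subset l' <= l}, (size l').+1 = size l &
                 act l' = act l \o 's_ (alpha k)].
Proof.
elim: l => [|i l IH] /= nk; first by have := pos_rootN (pos_alpha k) nk.
have [pk|/IH[l' [l'l sl' al']]] := root_sign (weyl_root (act_weyl l) (alpha_root k)).
  have e := pos_root_refl pk nk.
  exists l; split=> // [j jl|]; first by rewrite inE jl orbT.
  apply/funext => x /=; rewrite -(reflection_conj (act_weyl l)) e.
  by rewrite (reflectionK A (alpha_neq0 i)).
exists (i :: l'); split=> /=; rewrite ?sl' // ?al' //.
by move=> j; rewrite !inE => /predU1P[->|/l'l ->]; rewrite ?eqxx ?orbT.
Qed.

Definition dominant (J : {set 'I_n}) x := forall k, k \in J -> 0 <= ip x (alpha k).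

(** Induction on length: the last letter either adds a nonnegative multiple of a positive root to
    the difference, or is absorbed by an exchange that shortens the word. *)
Lemma dominant_act (J : {set 'I_n}) x l : dominant J x -> {subset l <= J} ->
  forall i, 0 <= ip (x - act l x) (omega i).
Proof.
move=> dx; have [m] := ubnP (size l); elim: m l => // m IH l.
case/lastP: l => [|l k] sl lJ i; first by rewrite subrr ip0l.
rewrite act_rcons /=.
have kJ : k \in J by apply: lJ; rewrite mem_rcons inE eqxx.
have lJ' : {subset l <= J} by move=> j jl; apply: lJ; rewrite mem_rcons inE jl orbT.
move: sl; rewrite size_rcons ltnS => sl.
have [pk|/act_exchange[l' [l'l sl' al']]] :=
    root_sign (weyl_root (act_weyl l) (alpha_root k)).
  have gl := act_weyl l; rewrite /reflection /coroot (weylB gl) !(weylZ gl).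
  rewrite ipBl ipBl !ipZl opprB addrCA -ipBl; apply: addr_ge0; last exact: IH.
  have [_ /(_ i) p0] := pk.
  rewrite mulr_ge0 //; first exact: dx.
  by rewrite mulr_ge0 // divr_ge0 // ltW // alpha_gt0.
have := IH l'; rewrite al' /=; apply; last by move=> j /l'l/lJ'.
by rewrite sl' ltnW.
Qed.

Lemma parabolic_dominant (J : {set 'I_n}) x w : dominant J x -> parabolic A J w ->
  forall i, 0 <= ip (x - w x) (omega i).
Proof. by move=> dx /parabolic_act[l lJ ->]; exact: dominant_act dx lJ. Qed.

Lemma dominant_uniq (J : {set 'I_n}) x w : dominant J x -> dominant J (w x) ->
  parabolic A J w -> w x = x.
Proof.
move=> dx dwx gw; apply: omega_ip_inj => i; apply/eqP; rewrite -subr_eq0 -ipBl.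
have [w' [gw' wK _]] := parabolic_inv gw.
have := parabolic_dominant dwx gw' i; rewrite wK => h.
rewrite eq_le h andbT -oppr_ge0 -ipNl opprB.
exact: (parabolic_dominant dx gw i).
Qed.

(** As in [dominant_act], but now the difference is zero, so its nonnegative summands vanish: a last
    letter that cannot be exchanged away is orthogonal to [x]. *)
Lemma dominant_stab (J : {set 'I_n}) x w : dominant J x -> parabolic A J w ->
  w x = x -> parabolic A [set j in J | ip x (alpha j) == 0] w.
Proof.
move=> dx /parabolic_act[l lJ ->].
have [m] := ubnP (size l); elim: m l lJ => // m IH l.
case/lastP: l => [|l k] lJ sl; first by move=> _; exact: reflection_group_id.
rewrite act_rcons /=.
have kJ : k \in J by apply: lJ; rewrite mem_rcons inE eqxx.
have lJ' : {subset l <= J} by move=> j jl; apply: lJ; rewrite mem_rcons inE jl orbT.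
move: sl; rewrite size_rcons ltnS => sl.
have [pk|/act_exchange[l' [l'l sl' al']]] :=
    root_sign (weyl_root (act_weyl l) (alpha_root k)); last first.
  move=> e; have := IH l'; rewrite al' /=; apply=> //; first by move=> j /l'l/lJ'.
  by rewrite sl' ltnW.
have gl := act_weyl l; move=> e.
have xk0 : ip x (alpha k) = 0.
  have [Rk pk0] := pk; apply/eqP; apply: contraT => xk.
  case/eqP: (root_neq0 Rk); apply: omega_ip_inj => i; rewrite ip0l.
  move: e; rewrite /reflection /coroot (weylB gl) !(weylZ gl).
  have : 0 < 2 / ip (alpha k) (alpha k).
    exact/root_ratio_gt0/alpha_root.
  move: (2 / _) => c c0 e.
  have /eqP : ip (x - act l x) (omega i) +
       ip x (alpha k) * (c * ip (act l (alpha k)) (omega i)) = 0.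
    rewrite -{1}e ipBl ipBl !ipZl; ring.
  rewrite paddr_eq0 ?(dominant_act dx) ?mulr_ge0 ?dx ?pk0 ?(ltW c0) //.
  by rewrite !mulf_eq0 (negPf xk) (gt_eqF c0) /= => /andP[_ /eqP].
have sx : 's_ (alpha k) x = x by rewrite /reflection xk0 scale0r subr0.
rewrite sx in e; apply: reflection_group_mul; first exact: IH.
by apply: parabolic_refl; rewrite inE kJ xk0 eqxx.
Qed.

Lemma finite_argmax T (S : set T) (f : T -> R) : finite_set S -> S !=set0 ->
  exists2 x, S x & forall y, S y -> f y <= f x.
Proof.
move=> Sfin [x0 Sx0]; have /finite_seqP[l lE] := finite_image f Sfin.
have inl y : S y -> f y \in l.
  by move=> Sy; have : (f @` S) (f y) by [exists y]; rewrite lE.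
have [m ml mmax] : exists2 m, m \in l & forall y, y \in l -> y <= m.
  have l0 : l != [::] by apply: contraTneq (inl _ Sx0) => ->.
  elim: {lE inl} l l0 => // y l IH _; have [->|/IH[m ml mmax]] := eqVneq l [::].
    by exists y => [|z]; rewrite !inE // => /eqP->.
  have [my|/ltW ym] := leP m y.
    exists y => [|z]; rewrite !inE ?eqxx // => /predU1P[->//|/mmax zm].
    exact: le_trans my.
  exists m => [|z]; rewrite !inE ?ml ?orbT // => /predU1P[->//|/mmax//].
have [x Sx xm] : (f @` S) m by rewrite lE.
by exists x => // y Sy; rewrite xm; apply/mmax/inl.
Qed.

(** The element maximising the pairing with the regular vector [a] works: reflecting in a wall on
    whose negative side the image lies would increase that pairing. *)
Lemma parabolic_dominant_exists (K : {set 'I_n}) a x : chamber A a ->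
  exists2 w, parabolic A K w & dominant K (w x).
Proof.
move=> aC; have [|w gw wmax] :=
    @finite_argmax _ (parabolic A K) (fun w => ip (w x) a) (parabolic_finite K).
  by exists id; exact: reflection_group_id.
exists w => // k kK.
have gsw : parabolic A K ('s_ (alpha k) \o w).
  by apply: reflection_group_comp => //; exists k.
have := wmax _ gsw; rewrite /= /reflection /coroot ipBl !ipZl gerBl.
rewrite pmulr_lge0 // mulr_gt0 ?divr_gt0 ?alpha_gt0 //.
by rewrite ipC; exact: aC.
Qed.


Lemma reflectionN b x : 's_ (- b) x = 's_ b x.
Proof. by rewrite /reflection /coroot !ipNr ipNl opprK scalerN scaleNr scalerN opprK. Qed.

Lemma parabolic_reflection J w b : parabolic A J w -> parabolic A J ('s_ b) ->
  parabolic A J ('s_ (w b)).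
Proof.
move=> gw gb; have [w' [gw' wK w'K]] := parabolic_inv gw.
have -> : 's_ (w b) = w \o ('s_ b \o w').
  by apply/funext => x /=; rewrite -(reflection_conj (parabolic_weyl gw)) w'K.
by do 2 apply: reflection_group_mul => //.
Qed.

(** Take a positive conjugate of least height. Some simple root pairs positively with it, and the
    reflection in that root lowers the height; so the reflected root is negative and the conjugate
    is simple. *)
Lemma root_conj_simple b : roots_of A b ->
  exists w i, parabolic A [set: 'I_n] w /\ (b = w (alpha i) \/ b = - w (alpha i)).
Proof.
wlog pb : b / pos_root b => [hwlog Rb|_].
  have [pb|pNb] := root_sign Rb; first exact: hwlog.
  have [w [i [gw [wE|wE]]]] := hwlog _ pNb pNb.1; exists w, i; split=> //.
    by right; rewrite -wE opprK.
  by left; apply: oppr_inj.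
pose ht x := \sum_i ip x (omega i).
pose S := [set w | parabolic A [set: 'I_n] w /\ pos_root (w b)].
have [||w [gw pw] wmin] := @finite_argmax _ S (fun w => - ht (w b)).
- by apply: sub_finite_set (parabolic_finite [set: 'I_n]) => w [].
- by exists id; split=> //; exact: reflection_group_id.
have [w' [gw' wK w'K]] := parabolic_inv gw.
suff [i wE] : exists i, w b = alpha i by exists w', i; split=> //; left; rewrite -wE wK.
have [i bi] : exists i, 0 < ip (w b) (alpha i).
  apply: contrapT => /forallNP h; have := root_neq0 pw.1.
  move=> /(ip_neq0 A); rewrite ip_expand; apply/negP; rewrite negbK.
  rewrite eq_le; apply/andP; split; last first.
    by rewrite -ip_expand ip_ge0.
  rewrite sumr_le0 // => i _; rewrite mulr_ge0_le0 ?pw.2 // ipC leNgt.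
  exact/negP/h.
exists i; have Rs : roots_of A ('s_ (alpha i) (w b)).
  exact: (roots_reflection (roots_ofP A) (alpha_root i) pw.1).
have [ps|] := root_sign Rs; last exact: pos_root_refl.
have /wmin : S ('s_ (alpha i) \o w).
  by split=> //; apply: reflection_group_comp => //; exists i => //=; rewrite inE.
rewrite /ht /= lerN2 -subr_le0 -sumrB (bigD1 i) //= big1 => [|j ji].
  rewrite addr0 /reflection /coroot ipBl !ipZl ip_omega eqxx mulr1 opprB addrCA.
  rewrite subrr addr0 leNgt mulr_gt0 //; exact/root_ratio_gt0/alpha_root.
rewrite /reflection /coroot ipBl !ipZl ip_omega eq_sym (negPf ji).
by rewrite !mulr0 subr0 subrr.
Qed.

Lemma weyl_parabolic w : weyl A w -> parabolic A [set: 'I_n] w.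
Proof.
elim=> [|b {}w Rb _ IH]; first exact: reflection_group_id.
apply: (@reflection_group_mul _ _ A _ ('s_ b)) => //.
have [v [i [gv vE]]] := root_conj_simple Rb.
have -> : 's_ b = 's_ (v (alpha i)).
  by case: vE => -> //; apply/funext => x; exact: reflectionN.
by apply: parabolic_reflection => //; apply: parabolic_refl; rewrite inE.
Qed.

Lemma weyl_chamber_le a w : chamber A a -> weyl A w ->
  forall i, 0 <= ip (a - w a) (omega i).
Proof.
move=> aC /weyl_parabolic; apply: parabolic_dominant => i _.
exact: ltW (aC i).
Qed.

End Roots.

(** * The Weyl polytope *)

Section Hulls.
Variables (R : realType) (n : nat) (S : set 'rV[R]_n).
Local Notation V := 'rV[R]_n.

(** With the total weight [t] free, combinations can be added and rescaled; this makes
    [convex_hull_sum] an induction on the sum. *)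
Definition weighted_hull (t : R) : set V :=
  [set x | exists m (u : 'I_m -> V) (c : 'I_m -> R),
     [/\ forall i, S (u i), forall i, 0 <= c i, \sum_i c i = t &
         x = \sum_i c i *: u i]].

Lemma weighted_hull0 : weighted_hull 0 0.
Proof.
exists 0%N, (fun=> 0), (fun=> 0); split=> //; try by case.
  by rewrite big_ord0.
by rewrite big_ord0.
Qed.

Lemma weighted_hullD t t' x x' : weighted_hull t x -> weighted_hull t' x' ->
  weighted_hull (t + t') (x + x').
Proof.
move=> [m [u [c [Su c0 ct ->]]]] [m' [u' [c' [Su' c0' ct' ->]]]].
exists (m + m')%N, (fun i => match fintype.split i with inl j => u j | inr j => u' j end),
  (fun i => match fintype.split i with inl j => c j | inr j => c' j end); split.
- by move=> i; case: fintype.split.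
- by move=> i; case: fintype.split.
- rewrite big_split_ord /= -ct -ct'; congr (_ + _); apply: eq_bigr => i _.
    by rewrite (unsplitK (inl i)).
  by rewrite (unsplitK (inr i)).
- rewrite big_split_ord /=; congr (_ + _); apply: eq_bigr => i _.
    by rewrite (unsplitK (inl i)).
  by rewrite (unsplitK (inr i)).
Qed.

Lemma weighted_hullZ r t x : 0 <= r -> weighted_hull t x ->
  weighted_hull (r * t) (r *: x).
Proof.
move=> r0 [m [u [c [Su c0 ct ->]]]]; exists m, u, (fun i => r * c i); split=> //.
- by move=> i; rewrite mulr_ge0.
- by rewrite -mulr_sumr ct.
- by rewrite scaler_sumr; apply: eq_bigr => i _; rewrite scalerA.
Qed.

Lemma convex_hull_sum I (s : seq I) (P : pred I) (c : I -> R) (F : I -> V) :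
  (forall i, P i -> 0 <= c i) ->
  (forall i, P i -> c i != 0 -> convex_hull S (F i)) ->
  \sum_(i <- s | P i) c i = 1 -> convex_hull S (\sum_(i <- s | P i) c i *: F i).
Proof.
move=> c0 SF c1; suff : weighted_hull (\sum_(i <- s | P i) c i)
    (\sum_(i <- s | P i) c i *: F i) by rewrite c1.
apply: (big_ind2 weighted_hull); first exact: weighted_hull0.
  by move=> *; exact: weighted_hullD.
move=> i Pi; have [->|ci] := eqVneq (c i) 0.
  by rewrite scale0r; exact: weighted_hull0.
by have := weighted_hullZ (c0 i Pi) (SF i Pi ci); rewrite mulr1.
Qed.

Lemma convex_hull_conv t x y : 0 <= t <= 1 -> convex_hull S x -> convex_hull S y ->
  convex_hull S ((1 - t) *: x + t *: y).
Proof.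
move=> /andP[t0 t1] Sx Sy.
have -> : (1 - t) *: x + t *: y =
    \sum_(b : bool) (if b then t else 1 - t) *: (if b then y else x).
  by rewrite big_bool /= addrC.
apply: convex_hull_sum => [[] _|[]|]; rewrite ?subr_ge0 // big_bool /=; ring.
Qed.

Lemma sub_convex_hull x : S x -> convex_hull S x.
Proof.
move=> Sx; exists 1%N, (fun=> x), (fun=> 1); split=> //.
  by rewrite big_ord1.
by rewrite big_ord1 scale1r.
Qed.

End Hulls.

Section Polytope.
Variables (R : realType) (n : nat) (A : rootDatum R n).
Local Notation V := 'rV[R]_n.
Local Notation ip := (ip A).
Local Notation alpha := (alpha A).
Local Notation omega := (omega A).
Local Notation "'s_" := (reflection ip) (at level 0).
Variables (a : V) (aC : chamber A a).
Local Notation P := (weyl_polytope A a).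
Local Notation face := (face A P).

Lemma weyl_refl b : roots_of A b -> weyl A ('s_ b).
Proof.
move=> Rb; apply: (@reflection_group_comp _ _ _ _ _ id) => //.
exact: reflection_group_id.
Qed.

Lemma polytope_orbit w : weyl A w -> P (w a).
Proof. by move=> gw; apply: sub_convex_hull; exists w. Qed.

Lemma face_vertices u x : face u x ->
  exists m (v : 'I_m -> V) (c : 'I_m -> R),
  [/\ forall i, exists2 w, weyl A w & v i = w a, forall i, 0 <= c i,
      \sum_i c i = 1, x = \sum_i c i *: v i & forall i, c i != 0 -> face u (v i)].
Proof.
move=> [[m [v [c [hv c0 c1 xE]]]] xmin]; exists m, v, c; split=> //.
  by move=> i; have [w gw <-] := hv i; exists w.
have Pv i : P (v i) by have [w gw <-] := hv i; exact: polytope_orbit.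
have e : \sum_i c i * (ip (v i) u - ip x u) = 0.
  under eq_bigr => i _ do rewrite mulrBr.
  rewrite sumrB -mulr_suml c1 mul1r {1}xE ip_suml -sumrB big1 // => i _.
  by rewrite ipZl subrr.
move=> i ci; split=> // y Py; apply: le_trans (xmin y Py).
have /eqP := e; rewrite psumr_eq0 => [|j _]; last first.
  by rewrite mulr_ge0 // subr_ge0; exact: xmin.
move=> /allP/(_ i (mem_index_enum i)) /=; rewrite mulf_eq0 (negPf ci) subr_eq0.
by move=> /eqP->.
Qed.

Lemma chamber_gap : exists2 d : R, 0 < d & forall i, d <= ip a (alpha i).
Proof.
exists (\big[Num.min/1]_i ip a (alpha i)).
  by apply: lt_bigmin => [|i _]; [exact: ltr01|exact: aC].
by move=> i; exact: bigmin_le.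
Qed.

Variables (d : R) (d0 : 0 < d) (dP : forall i, d <= ip a (alpha i)).

(** Moving [w] to the other side leaves a pairing of [a] with a root, which up to sign is a nonempty
    natural combination of simple roots. *)
Lemma root_gap w b : weyl A w -> roots_of A b -> d <= `|ip (w a) b|.
Proof.
move=> gw; have [w' [gw' wK w'K]] := weyl_inv gw.
move=> Rb; rewrite -(weyl_isometry _ _ gw') wK.
move: (weyl_root gw' Rb) => {Rb gw w wK gw' w'K}; move: (w' b) => {w'}b Rb.
have [c bE] := simple_sign (alphaP A) Rb.
have [i ci] : exists i, (0 < c i)%N.
  apply: contrapT => /forallNP c0; have /eqP := root_neq0 Rb; apply.
  have {}c0 : \sum_i alpha i *+ c i = 0.
    rewrite big1 // => i _; have /negP := c0 i.
    by rewrite -eqn0Ngt => /eqP->; rewrite mulr0n.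
  by case: bE => ->; rewrite c0 ?oppr0.
have : d <= ip a (\sum_i alpha i *+ c i).
  rewrite ip_sumr (bigD1 i) //= ipMnr (le_trans (dP i)) // ler_wpDr //.
    rewrite sumr_ge0 // => j _; rewrite ipMnr mulrn_wge0 //.
    exact: ltW (aC j).
  by rewrite -(prednK ci) mulrS ler_wpDr // mulrn_wge0 // ltW.
by case: bE => ->; rewrite ?ipNr ?normrN => h; exact: le_trans (ler_norm _).
Qed.

(* A vertex [v] of a face with normal [u] satisfies [ip v b * ip b u <= 0],
   because reflecting it in [b] cannot decrease [ip _ u]; so if [ip b u != 0], all
   vertices of the face lie on one side of the wall of [b], at distance [>= d]. *)
Lemma face_root_perp u x b : face u x -> roots_of A b -> `|ip x b| < d ->
  ip b u = 0.
Proof.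
move=> Fx Rb xb; apply/eqP; apply: contraLR xb => bu; rewrite -leNgt.
have [m [v [c [hv c0 c1 -> Fv]]]] := face_vertices Fx.
have sgb i : c i != 0 -> ip (v i) b * Num.sg (ip b u) <= - d.
  move=> ci; have [Pv vmin] := Fv i ci; have [w gw vE] := hv i.
  have : ip (v i) b * ip b u <= 0.
    have := vmin _ (weyl_polytope_stable (weyl_refl Rb) Pv).
    rewrite /reflection /coroot ipBl !ipZl lerBrDl gerDr mulrCA.
    by rewrite (pmulr_rle0 _ (root_ratio_gt0 Rb)).
  rewrite {1}[ip b u]numEsg mulrA pmulr_lle0 ?normr_gt0 // => le0.
  rewrite lerNr -(ger0_norm (_ : 0 <= - (_ * _))) ?oppr_ge0 //.
  by rewrite normrN normrM normr_sg bu mulr1 vE root_gap.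
have : ip (\sum_i c i *: v i) b * Num.sg (ip b u) <= - d.
  rewrite ip_suml mulr_suml -[- d]mul1r -c1 mulr_suml ler_sum // => i _.
  rewrite ipZl -mulrA; have [->|ci] := eqVneq (c i) 0; first by rewrite !mul0r.
  by rewrite ler_wpM2l // sgb.
rewrite lerNr => /le_trans; apply; apply: le_trans (ler_norm _) _.
by rewrite normrN normrM normr_sg bu mulr1.
Qed.

(** Otherwise the reflection of [alpha i] in [alpha k] would be a root with coefficients of both
    signs. *)
Lemma alpha_obtuse i k : i != k -> ip (alpha i) (alpha k) <= 0.
Proof.
move=> ik; have Rs := weyl_root (weyl_refl (alpha_root A k)) (alpha_root A i).
have [[_ /(_ k)]|[_ /(_ i)]] := root_sign Rs; rewrite ?ipNl /reflection /coroot.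
  rewrite ipBl !ipZl !ip_omega (negPf ik) eqxx sub0r mulr1 oppr_ge0.
  by rewrite (pmulr_lle0 _ (root_ratio_gt0 (alpha_root A k))).
rewrite ipBl !ipZl !ip_omega eqxx eq_sym (negPf ik) !mulr0 subr0.
by rewrite oppr_ge0 ler10.
Qed.

(** * Averaging over a parabolic subgroup *)

Definition parabolic_seq (J : {set 'I_n}) : seq (V -> V) :=
  finmap.enum_fset (fset_set (parabolic A J)).

Lemma mem_parabolic_seq J w : (w \in parabolic_seq J) = `[< parabolic A J w >].
Proof.
exact: in_fset_set (parabolic_finite A J) w.
Qed.

(** The orthogonal projection onto the intersection of the walls of [J] ([average_perp],
    [average_spanJ]); as a mean of Weyl images it preserves [P]. *)
Definition average (J : {set 'I_n}) (x : V) : V :=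
  \sum_(w <- parabolic_seq J) (size (parabolic_seq J))%:R^-1 *: w x.

Lemma parabolic_seq_neq0 J : (size (parabolic_seq J))%:R != 0 :> R.
Proof.
rewrite pnatr_eq0 size_eq0; apply: contraTneq isT => e.
have : id \in parabolic_seq J.
  by rewrite mem_parabolic_seq; apply/asboolP; exact: reflection_group_id.
by rewrite e.
Qed.

Lemma average_weights J :
  \sum_(w <- parabolic_seq J) (size (parabolic_seq J))%:R^-1 = 1 :> R.
Proof.
rewrite big_const_seq count_predT iter_addr_0 -[LHS]mulr_natl divff //.
exact: parabolic_seq_neq0.
Qed.

Lemma averageB J x : x - average J x =
  \sum_(w <- parabolic_seq J) (size (parabolic_seq J))%:R^-1 *: (x - w x).
Proof.
under [RHS]eq_bigr => w _ do rewrite scalerBr.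
by rewrite sumrB -scaler_suml average_weights scale1r.
Qed.

Lemma average_polytope J x : P x -> P (average J x).
Proof.
move=> Px; rewrite /average big_seq; apply: convex_hull_sum.
- by move=> w _; rewrite invr_ge0.
- move=> w; rewrite mem_parabolic_seq => /asboolP/parabolic_weyl gw _.
  exact: weyl_polytope_stable.
- by rewrite -big_seq average_weights.
Qed.

Lemma average_perp (J : {set 'I_n}) x j : j \in J -> ip (average J x) (alpha j) = 0.
Proof.
move=> jJ; have gj := weyl_refl (alpha_root A j).
pose sj (w : V -> V) := 's_ (alpha j) \o w.
have sjK : involutive sj.
  by move=> w; apply/funext => y; rewrite /sj /= (reflectionK A (alpha_neq0 A j)).
have sjL : perm_eq (map sj (parabolic_seq J)) (parabolic_seq J).
  have sjJ w : parabolic A J w -> parabolic A J (sj w).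
    by move=> gw; apply: reflection_group_comp => //; exists j.
  apply: uniq_perm; rewrite ?(map_inj_uniq (inv_inj sjK)) ?finmap.fset_uniq // => w.
  apply/mapP/idP => [[w' + ->]|]; rewrite !mem_parabolic_seq.
    by move=> /asboolP/sjJ gw; apply/asboolP.
  move=> /asboolP/sjJ gw; exists (sj w); rewrite ?sjK // mem_parabolic_seq.
  exact/asboolP.
have : 's_ (alpha j) (average J x) = average J x.
  rewrite /average (weyl_sum gj) -[in RHS](perm_big _ sjL) /= big_map.
  by apply: eq_bigr => w _; rewrite (weylZ gj).
rewrite /reflection => /eqP; rewrite -subr_eq0 addrAC subrr sub0r oppr_eq0.
rewrite /coroot scalerA scaler_eq0 (negPf (alpha_neq0 A j)) orbF.
by rewrite mulf_eq0 (gt_eqF (root_ratio_gt0 (alpha_root A j))) orbF => /eqP.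
Qed.

Lemma average_spanJ J x : spanJ A J (x - average J x).
Proof.
rewrite averageB big_seq; apply: spanJ_sum => w.
rewrite mem_parabolic_seq => /asboolP gw; apply: spanJZ; rewrite -opprB.
exact/spanJN/parabolic_spanJ.
Qed.

Lemma average_le J x : dominant A J x ->
  forall i, 0 <= ip (x - average J x) (omega i).
Proof.
move=> dx i; rewrite averageB big_seq ip_suml sumr_ge0 // => w.
rewrite mem_parabolic_seq => /asboolP gw; rewrite ipZl mulr_ge0 ?invr_ge0 //.
exact: (parabolic_dominant dx gw).
Qed.

(** The difference [x - average J x] is a nonnegative combination of simple roots in [J], all obtuse
    to [alpha k]. *)
Lemma average_ip_ge (J : {set 'I_n}) x k : dominant A J x -> k \notin J ->
  ip x (alpha k) <= ip (average J x) (alpha k).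
Proof.
move=> dx kJ; rewrite -subr_le0 -ipBl ip_expand sumr_le0 // => i _.
have [iJ|iJ] := boolP (i \in J); last by rewrite (average_spanJ _ iJ) mul0r.
rewrite mulr_ge0_le0 ?average_le // alpha_obtuse //.
by apply: contraNneq kJ => <-.
Qed.

Lemma average_dominant (J K : {set 'I_n}) x : J \subset K -> dominant A K x ->
  dominant A K (average J x).
Proof.
move=> /fintype.subsetP JK dx k kK; have [kJ|kJ] := boolP (k \in J).
  by rewrite average_perp.
by rewrite (le_trans (dx k kK)) // average_ip_ge // => j /JK/dx.
Qed.

Lemma average_face (J : {set 'I_n}) u x :
  (forall j, j \in J -> ip (alpha j) u = 0) -> face u x -> face u (average J x).
Proof.
move=> uJ [Px xmin]; split=> [|y Py]; first exact: average_polytope.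
suff -> : ip (average J x) u = ip x u by exact: xmin.
apply/esym/eqP; rewrite -subr_eq0 -ipBl; apply/eqP.
exact: spanJ_perp (@average_spanJ J x) uJ.
Qed.

(** Averaging [a] over the parabolic subgroup omitting [i] leaves only the coordinate along
    [omega i], which does not decrease. *)
Lemma polytope_omega i : exists2 c : R, 0 < c & P (c *: omega i).
Proof.
set J := ~: [set i]; exists (ip (average J a) (alpha i)).
  apply: lt_le_trans (aC i) _; apply: average_ip_ge; last by rewrite !inE eqxx.
  by move=> j _; exact: ltW (aC j).
suff <- : average J a = ip (average J a) (alpha i) *: omega i.
  apply/average_polytope/(@polytope_orbit id); exact: reflection_group_id.
rewrite {1}(omega_expand A (average J a)) (bigD1 i) //= big1 ?addr0 // => j ji.
by rewrite average_perp ?scale0r // !inE.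
Qed.

Lemma polytope0 : P 0.
Proof.
rewrite (_ : 0 = average [set: 'I_n] a).
  apply/average_polytope/(@polytope_orbit id); exact: reflection_group_id.
by apply: (@simple_ip_inj _ _ A) => i; rewrite ip0l average_perp.
Qed.

End Polytope.

(** * Facets of the polytope and of its intersection with the chamber *)

Section LinearAlgebra.
Variables (R : realType) (n : nat) (A : rootDatum R n).
Local Notation V := 'rV[R]_n.
Local Notation ip := (ip A).

(** A subspace of maximal dimension inside [G] is all of [G], since a missing vector would enlarge
    it. This converts linear predicates into [{vspace V}]. *)
Lemma vspace_exists (G : set V) : G 0 ->
  (forall c x y, G x -> G y -> G (c *: x + y)) ->
  exists U : {vspace V}, forall x, x \in U <-> G x.
Proof.
move=> G0 GZ.
pose Q m := `[< exists U : {vspace V}, \dim U = m /\ [set` U] `<=` G >].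
have Q0 : exists m, Q m.
  exists 0%N; apply/asboolP; exists 0%VS; split; first exact: dimv0.
  by move=> x /=; rewrite memv0 => /eqP->.
have Qn m : Q m -> (m <= \dim {:V})%N.
  by move=> /asboolP[U [<- _]]; apply/dimvS/subvf.
case: (ex_maxnP Q0 Qn) => m /asboolP[U [dU UG]] mmax; exists U => x.
split=> [/UG//|Gx].
have UxG : [set` (U + <[x]>)%VS] `<=` G.
  move=> _ /= /memv_addP[y yU [_ /vlineP[c ->] ->]].
  by rewrite addrC; apply: GZ => //; exact: UG.
have : Q (\dim (U + <[x]>)) by apply/asboolP; exists (U + <[x]>)%VS.
move=> /mmax; rewrite -dU => dle.
have /eqP -> : U == (U + <[x]>)%VS by rewrite eqEdim addvSl dle.
exact/(subvP (addvSr _ _))/memv_line.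
Qed.

Lemma linear_hull_vspace (S : set V) :
  exists U : {vspace V}, forall x, x \in U <-> linear_hull S x.
Proof.
apply: vspace_exists => [U _|c x y hx hy U SU]; first exact: mem0v.
by rewrite memvD ?memvZ //; [exact: hx|exact: hy].
Qed.

Lemma linear_hull_sub (S : set V) : S `<=` linear_hull S.
Proof. by move=> x Sx U; apply. Qed.

Lemma linear_hullZD (S : set V) c x y :
  linear_hull S x -> linear_hull S y -> linear_hull S (c *: x + y).
Proof.
by have [U UE] := linear_hull_vspace S; rewrite -!UE => xU yU; rewrite memvD ?memvZ.
Qed.

Lemma linear_hull0 (S : set V) : linear_hull S 0.
Proof. by move=> U _; exact: mem0v. Qed.

Lemma linear_hullZ (S : set V) c x : linear_hull S x -> linear_hull S (c *: x).
Proof.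
by move=> hx; rewrite -[_ *: _]addr0; apply: linear_hullZD => //; exact: linear_hull0.
Qed.

Lemma linear_hullD (S : set V) x y :
  linear_hull S x -> linear_hull S y -> linear_hull S (x + y).
Proof. by move=> hx hy; rewrite -[x]scale1r; exact: linear_hullZD. Qed.

Lemma linear_hullB (S : set V) x y :
  linear_hull S x -> linear_hull S y -> linear_hull S (x - y).
Proof. by move=> hx hy; rewrite addrC -scaleN1r; exact: linear_hullZD. Qed.

Lemma linear_hullS (S S' : set V) : S `<=` S' -> linear_hull S `<=` linear_hull S'.
Proof. by move=> SS' x hx U S'U; apply: hx; exact: subset_trans S'U. Qed.

Lemma cone_lattice_hull_sub (S : set V) (U : {vspace V}) : S `<=` [set` U] ->
  linear_hull (cone_lattice A (cone_hull S)) `<=` [set` U].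
Proof.
move=> SU x hx; apply: hx => y hy /=; apply: (hy [set` U]) => /=.
- exact: mem0v.
- by move=> z z'; exact: memvB.
- move=> _ [[m [u [c [Su c0 ->]]]] _] /=.
  by apply: memv_suml => i _; apply/memvZ/SU.
Qed.

(** Subtori see a cone only through its lattice points, so a generator is recovered once its ray
    contains one; [facet_rational] provides it for facets of [P], coroots for the walls. *)
Lemma cone_lattice_hull_mem (S : set V) c u : S u -> 0 < c ->
  c *: u \in coweight_lattice A -> linear_hull (cone_lattice A (cone_hull S)) u.
Proof.
move=> Su c0 cN; rewrite -[u]scale1r -(mulVf (lt0r_neq0 c0)) -scalerA.
apply/linear_hullZ/linear_hull_sub => G _ _; apply; split=> //.
exists 1%N, (fun=> u), (fun=> c); split=> // [i|]; first exact: ltW.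
by rewrite big_ord1.
Qed.

Lemma cone_lattice_hullS (S S' : set V) : S `<=` S' ->
  linear_hull (cone_lattice A (cone_hull S)) `<=`
  linear_hull (cone_lattice A (cone_hull S')).
Proof.
move=> SS'; apply: linear_hullS => x hx G G0 GB sG; apply: hx => // y [Sy Ny].
apply: sG; split=> //; have [m [u [c [Su c0 yE]]]] := Sy.
by exists m, u, c; split=> // i; exact/SS'.
Qed.

Lemma perp_vspace u :
  exists H : {vspace V}, forall x, x \in H <-> ip x u = 0.
Proof.
apply: vspace_exists => [|c x y /= xu yu]; first by rewrite ip0l.
by rewrite ipDl ipZl xu yu mulr0 addr0.
Qed.

Lemma dim_perp u (H : {vspace V}) : u != 0 -> (forall x, x \in H <-> ip x u = 0) ->
  \dim H = n.-1.
Proof.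
move=> u0 HE; have uH : u \notin H.
  by apply/negP => /HE/eqP; apply/negP/ip_neq0.
have Hu : (H + <[u]>)%VS = fullv.
  apply/eqP; rewrite eqEsubv subvf; apply/subvP => x _.
  rewrite -[x](subrK ((ip x u / ip u u) *: u)) memv_add //; last first.
    by rewrite memvZ // memv_line.
  by apply/HE; rewrite ipBl ipZl divfK ?subrr // ip_neq0.
have /eqP HI : (H :&: <[u]>)%VS == 0%VS.
  rewrite -subv0; apply/subvP => x; rewrite memv_cap memv0 => /andP[xH].
  move=> /vlineP[c xE]; move: xH; rewrite xE; have [->|c0] := eqVneq c 0.
    by rewrite scale0r.
  by move=> /(memvZ c^-1); rewrite scalerA mulVf // scale1r (negPf uH).
have := dimv_sum_cap H <[u]>; rewrite Hu HI dimv0 addn0 dim_vline u0 addn1.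
have -> : \dim {:V} = n by rewrite dimvf /dim /= mul1n.
by move/(congr1 predn) => /= <-.
Qed.

Lemma perp_collinear u z : u != 0 -> (forall y, ip y u = 0 -> ip y z = 0) ->
  exists c, z = c *: u.
Proof.
move=> u0 uz; exists (ip z u / ip u u); apply/eqP; rewrite -subr_eq0; apply/eqP.
set y := z - _.
have yu : ip y u = 0 by rewrite /y ipBl ipZl divfK ?subrr // ip_neq0.
by apply: (@ip_eq0 _ _ A); rewrite {2}/y ipBr ipZr uz // yu mulr0 subrr.
Qed.

(** Facets are handled through this criterion and its converse [affine_dim_perp]: the differences
    from a base point span the hyperplane orthogonal to the normal. *)
Lemma affine_dim_hyperplane (B : set V) p u : B p -> u != 0 ->
  (forall x, B x -> ip x u = ip p u) ->
  (forall U : {vspace V}, (forall x, B x -> x - p \in U) ->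
    forall y, ip y u = 0 -> y \in U) ->
  affine_dim B n.-1.
Proof.
move=> Bp u0 Bu Bmin; have [H HE] := perp_vspace u.
exists p; split=> //; exists H; split; first exact: dim_perp HE.
- by move=> x Bx; apply/HE; rewrite ipBl Bu // subrr.
- by move=> U BU; apply/subvP => y /HE; exact: Bmin.
Qed.

Lemma affine_dim_perp (B : set V) p u (U : {vspace V}) : affine_dim B n.-1 ->
  u != 0 -> (forall x y, B x -> B y -> ip x u = ip y u) ->
  B p -> (forall x, B x -> x - p \in U) -> forall y, ip y u = 0 -> y \in U.
Proof.
move=> [q [Bq [W [dW BW Wmin]]]] u0 Bu Bp BU y yu.
have [H HE] := perp_vspace u.
have /eqP WH : W == H.
  rewrite eqEdim dW (dim_perp u0 HE) leqnn andbT; apply: Wmin => x Bx.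
  by apply/HE; rewrite ipBl (Bu _ _ Bx Bq) subrr.
suff /subvP : (W <= U)%VS by apply; rewrite WH; exact/HE.
apply: Wmin => x Bx; rewrite -[x](subrK p) -addrA -[p - q]opprB.
by apply: memvB; exact: BU.
Qed.

End LinearAlgebra.

Section Facets.
Variables (R : realType) (n : nat) (A : rootDatum R n).
Local Notation V := 'rV[R]_n.
Local Notation ip := (ip A).
Local Notation alpha := (alpha A).
Local Notation omega := (omega A).
Local Notation "'s_" := (reflection ip) (at level 0).
Variables (a : V) (aC : chamber A a).
Variables (d : R) (d0 : 0 < d) (dP : forall i, d <= ip a (alpha i)).
Variable K : {set 'I_n}.
Local Notation P := (weyl_polytope A a).
Local Notation D := (cut_polytope A a K).

Lemma face_perp p u b : face A P u p -> roots_of A b -> ip p b = 0 -> ip b u = 0.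
Proof.
by move=> Fp Rb pb; apply: (face_root_perp aC dP Fp Rb); rewrite pb normr0.
Qed.

Lemma face_const (B : set V) u x y : face A B u x -> face A B u y -> ip x u = ip y u.
Proof. by move=> [Bx xm] [By ym]; apply/eqP; rewrite eq_le xm ?ym. Qed.

Lemma face_vertex u x : face A P u x -> exists2 w, weyl A w & face A P u (w a).
Proof.
move=> /face_vertices[m [v [c [hv c0 c1 _ Fv]]]].
have [i ci] : exists i, c i != 0.
  apply: contrapT => /forallNP h; have /eqP := @oner_neq0 R; apply.
  by rewrite -c1 big1 // => i _; apply/eqP; have /negP := h i; rewrite negbK.
by have [w gw vE] := hv i; exists w => //; rewrite -vE; exact: Fv.
Qed.

(* A facet containing the dominant vertex [a] lies in the hyperplane
   [ip (x - a) (omega i) = 0], so its normal is a multiple of [omega i]. *)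
Lemma facet_rational p u : facet_normal_at A P p u ->
  exists2 c, 0 < c & c *: u \in coweight_lattice A.
Proof.
move=> hu; have [w gw] := face_vertex (let: And3 _ _ Fp := hu in Fp).
have [w' [gw' wK w'K]] := weyl_inv gw.
have [u0 dimF _] := facet_normal_weyl gw' hu.
rewrite -{1}[u]w'K face_weyl // => -[v Fa /(weyl_inj gw) vE].
rewrite {}vE in Fa.
suff [c c0 cN] : exists2 c, 0 < c & c *: w' u \in coweight_lattice A.
  by exists c => //; rewrite -[u]w'K -(weylZ gw); exact: weyl_coweight.
move: (w' u) u0 dimF Fa => {p hu w gw w' gw' wK w'K v}{}u u0 dimF Fa.
have [Pa amin] := Fa.
have u_le0 i : ip (alpha i) u <= 0.
  have := amin _ (weyl_polytope_stable (weyl_refl (alpha_root A i)) Pa).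
  rewrite /reflection /coroot ipBl !ipZl lerBrDl gerDr mulrA.
  rewrite pmulr_rle0 //; apply: mulr_gt0; first exact: aC.
  exact/root_ratio_gt0/alpha_root.
have [i ui] : exists i, ip (alpha i) u != 0.
  apply: contrapT => /forallNP h; have /eqP := u0; apply.
  apply: (@simple_ip_inj _ _ A) => i; rewrite ip0l ipC.
  by apply/eqP; have /negP := h i; rewrite negbK.
have Fi x : face A P u x -> ip (x - a) (omega i) = 0.
  move=> /face_vertices[m [v [c [hv c0 c1 -> Fv]]]].
  rewrite -[a]scale1r -c1 scaler_suml -sumrB ip_suml big1 // => k _.
  rewrite -scalerBr ipZl; have [->|ck] := eqVneq (c k) 0; first by rewrite mul0r.
  have [w gw vE] := hv k.
  have := face_const Fa (Fv k ck); rewrite vE => /eqP.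
  rewrite -subr_eq0 -ipBl ip_expand -oppr_eq0 -sumrN psumr_eq0 => [|l _]; last first.
    by rewrite oppr_ge0 mulr_ge0_le0 // weyl_chamber_le.
  move=> /allP/(_ i (mem_index_enum i)) /=; rewrite oppr_eq0 mulf_eq0 (negPf ui) orbF.
  by rewrite -opprB ipNl oppr_eq0 => /eqP->; rewrite mulr0.
have [c wE] : exists c, omega i = c *: u.
  apply: (@perp_collinear _ _ A) => // y yu; have [H HE] := perp_vspace A (omega i).
  apply/HE; apply: (affine_dim_perp (A := A) dimF u0 _ Fa _ yu); last first.
    by move=> x /Fi/HE.
  by move=> x z; exact: face_const.
have c_lt0 : c < 0.
  have := ip_omega A i i; rewrite eqxx wE ipZr => cE.
  rewrite ltNge; apply/negP => c_ge0; have := mulr_ge0_le0 c_ge0 (u_le0 i).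
  by rewrite cE ler10.
exists (- c); first by rewrite oppr_gt0.
rewrite scaleNr -wE rpredN; apply/coweight_latticeP => j.
by exists (i == j)%:R; rewrite omegaP; case: (i == j).
Qed.

Definition walls (p : V) : {set 'I_n} := [set k in K | ip p (alpha k) == 0].

Lemma cut_dominant p : D p -> dominant A K p.
Proof. by case. Qed.

Lemma wallsP p k : k \in walls p -> k \in K /\ ip p (alpha k) = 0.
Proof. by rewrite inE => /andP[kK /eqP]. Qed.

Lemma walls_fix p w : parabolic A (walls p) w -> w p = p.
Proof. by move=> gw; apply: (parabolic_fix gw) => j /wallsP[_]; rewrite ipC. Qed.

Lemma walls_face_fix p u w : face A P u p -> parabolic A (walls p) w -> w u = u.
Proof.
move=> Fp gw; apply: (parabolic_fix gw) => j /wallsP[_].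
exact: face_perp Fp (alpha_root A j).
Qed.

Lemma cut0 : D 0.
Proof. by split=> [|k _]; [exact: polytope0|rewrite ip0l]. Qed.

(** The origin and suitable multiples of the [omega i] with [i != j] lie in the cut polytope on this
    wall and span it. *)
Lemma facet_wall p j : D p -> j \in walls p -> facet_normal_at A D p (alpha j).
Proof.
move=> Dp /wallsP[jK pj]; have F0 : face A D (alpha j) 0.
  by split=> [|y [_ /(_ j jK)]]; [exact: cut0|rewrite ip0l].
have faceE x : face A D (alpha j) x -> ip x (alpha j) = 0.
  by move=> Fx; rewrite (face_const Fx F0) ip0l.
split; first exact: alpha_neq0.
- apply: (affine_dim_hyperplane (A := A) F0 (alpha_neq0 A j)) => [x Fx|U FU y yj].
    by rewrite faceE // ip0l.
  rewrite (omega_expand A y) memv_suml // => i _.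
  have [->|ij] := eqVneq i j; first by rewrite yj scale0r mem0v.
  apply: memvZ; have [c c0 Pc] := polytope_omega aC i.
  have /(memvZ c^-1) : c *: omega i \in U.
    rewrite -[_ *: _]subr0; apply: FU; split=> [|z [_ /(_ j jK)]].
      split=> // k _; rewrite ipZl omegaP mulr_ge0 // ltW //.
    by rewrite ipZl omegaP (negPf ij) mulr0.
  by rewrite scalerA mulVf ?scale1r // gt_eqF.
- by split=> // y [_ /(_ j jK)]; rewrite pj.
Qed.

(** Only walls missing [p] can obstruct a short step, and their roots pair positively with [p]. The
    summand [1] in [F] avoids a zero denominator. *)
Lemma dominant_step (p z : V) : dominant A K p -> dominant A (walls p) z ->
  exists2 t, 0 < t <= 1 & dominant A K (p + t *: z).
Proof.
move=> dp dz.
pose F k := ip p (alpha k) / (1 + `|ip z (alpha k)|).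
have F1 k : 0 < 1 + `|ip z (alpha k)| by rewrite ltr_wpDr.
pose t := \big[Num.min/1]_(k | k \in K :\: walls p) F k.
have t0 : 0 < t.
  apply: lt_bigmin => [|k]; first exact: ltr01.
  rewrite !inE => /andP[+ kK]; rewrite kK /= => pk.
  by rewrite divr_gt0 // lt_neqAle eq_sym pk dp.
exists t; first by rewrite t0 /=; exact: bigmin_le_id.
move=> k kK; rewrite ipDl ipZl; have [kJ|kJ] := boolP (k \in walls p).
  by rewrite addr_ge0 ?dp // mulr_ge0 ?dz // ltW.
have tF : t <= F k by apply: bigmin_le_cond; rewrite inE kJ.
have h : t * `|ip z (alpha k)| <= ip p (alpha k).
  rewrite (le_trans (ler_wpM2r _ tF)) // /F mulrAC ler_pdivrMr //.
  by rewrite ler_wpM2l ?dp // lerDr.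
have : - (t * `|ip z (alpha k)|) <= t * ip z (alpha k).
  by rewrite -mulrN ler_pM2l // lerNl; rewrite -normrN ler_norm.
lra.
Qed.

Lemma face_conv (B : set V) u x y t :
  B ((1 - t) *: x + t *: y) -> face A B u x -> face A B u y ->
  face A B u ((1 - t) *: x + t *: y).
Proof.
move=> Bxy Fx Fy; split=> // z Bz; rewrite ipDl !ipZl (face_const Fy Fx).
by rewrite -mulrDl subrK mul1r; apply: Fx.2.
Qed.

Lemma step_conv (p x : V) t : p + t *: (x - p) = (1 - t) *: p + t *: x.
Proof. by rewrite scalerBr scalerBl scale1r addrA addrAC. Qed.

(* The facet of [P] with normal [u] is stable under the stabiliser of [p], so near
   [p] it is the union of the translates of its part inside the chamber. *)
Lemma facet_cut p u : D p -> facet_normal_at A P p u -> facet_normal_at A D p u.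
Proof.
move=> Dp [u0 dimF Fp]; have [Pp pmin] := Fp.
have DF x : D x -> face A P u x -> face A D u x.
  by move=> Dx [_ xmin]; split=> // y [Py _]; exact: xmin.
split=> //; last exact: DF.
have fixu := walls_face_fix Fp.
(* Folding [x - p] by the stabiliser of [p] and then shortening it yields a point of the cut
   facet. *)
have stepF x : face A P u x -> exists t w,
    [/\ 0 < t, parabolic A (walls p) w & face A D u (p + t *: w (x - p))].
  move=> Fx; have [w gw dw] := parabolic_dominant_exists (walls p) (x - p) aC.
  have [t /andP[t0 t1] dt] := dominant_step (cut_dominant Dp) dw.
  have ww := parabolic_weyl gw.
  exists t, w; split=> //; move: dt; rewrite (weylB ww) (walls_fix gw) step_conv => dt.
  have Fwx : face A P u (w x) by rewrite -(fixu _ gw) face_weyl //; exists x.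
  have Pt : P ((1 - t) *: p + t *: w x).
    by apply: convex_hull_conv; [rewrite t1 ltW|exact: Fp.1|exact: Fwx.1].
  by apply: DF; [split|exact: face_conv].
apply: (affine_dim_hyperplane (A := A) (DF _ Dp Fp) u0) => [x Fx|U FU].
  exact: face_const Fx (DF _ Dp Fp).
(* A vertex of the facet lies off the wall of [j], so folding it gives a point [x] of the cut facet
   off that wall; [x] minus its projection to the wall is a nonzero multiple of [alpha j]. *)
have Ualpha j : j \in walls p -> alpha j \in U.
  move=> jp; have [w ww Fw] := face_vertex Fp.
  have [t [w' [t0 gw' Fx]]] := stepF _ Fw; move: Fx; set x := p + _ => Fx.
  have ww' := parabolic_weyl gw'; have [jK pj] := wallsP jp.
  have xj : ip x (alpha j) != 0.
    rewrite /x ipDl pj add0r ipZl mulf_eq0 (gt_eqF t0) /=.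
    rewrite (weylB ww') (walls_fix gw') ipBl pj subr0.
    have := root_gap aC dP (reflection_group_mul ww' ww) (alpha_root A j).
    by rewrite -normr_gt0; exact: lt_le_trans.
  pose y := average A [set j] x; have Dx := Fx.1.
  have Dy : D y.
    split; first exact/average_polytope/Dx.1.
    by apply: average_dominant; [rewrite finset.sub1set|exact: cut_dominant].
  have FPx : face A P u x.
    split=> [|z Pz]; first exact: Dx.1.
    by rewrite (face_const Fx (DF _ Dp Fp)); exact: pmin.
  have Fy : face A D u y.
    apply: DF => //; apply: average_face => // i /set1P->.
    exact: face_perp Fp (alpha_root A j) pj.
  have yE : x - y = ip (x - y) (omega j) *: alpha j.
    rewrite {1}(alpha_expand A (x - y)) (bigD1 j) //= big1 ?addr0 // => i ij.
    by rewrite (@average_spanJ _ _ A [set j] x i) ?scale0r // inE.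
  have : x - y \in U.
    by rewrite -[x](subrK p) -addrA -[p - y]opprB memvB // FU.
  rewrite yE => /(memvZ (ip (x - y) (omega j))^-1); rewrite scalerA mulVf ?scale1r //.
  apply: contraNneq xj => c0; have : ip (x - y) (alpha j) = 0.
    by rewrite yE c0 scale0r ip0l.
  by rewrite ipBl (average_perp A _ (set11 j)) subr0 => ->.
move=> y yu; apply: (affine_dim_perp (A := A) dimF u0 _ Fp _ yu) => [x z|x Fx].
  exact: face_const.
have [t [w [t0 gw Fx']]] := stepF _ Fx.
have : w (x - p) \in U.
  have := FU _ Fx'; rewrite addrAC subrr add0r => /(memvZ t^-1).
  by rewrite scalerA mulVf ?scale1r // gt_eqF.
have : w (x - p) - (x - p) \in U.
  rewrite (alpha_expand A (_ - _)) memv_suml // => i _.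
  have [ip0|ip0] := boolP (i \in walls p); first by rewrite memvZ ?Ualpha.
  by rewrite (@parabolic_spanJ _ _ A _ _ (x - p) gw) ?scale0r ?mem0v.
by move=> h1 h2; have := memvB h2 h1; rewrite opprB addrC subrK.
Qed.

(** If the facet lies in no wall of the chamber, averaging its points gives one strictly inside all
    walls in [K]; near that point the two polytopes agree, so the minimum over the cut is the
    minimum over [P]. *)
Lemma facet_cut_inv p u : D p -> facet_normal_at A D p u ->
  (exists j c, j \in walls p /\ u = c *: alpha j) \/ facet_normal_at A P p u.
Proof.
move=> Dp [u0 dimF Fp]; have [_ pmin] := Fp.
have Fconst := @face_const D u.
have [[k kK hk]|/forall2NP h] := pselect (exists2 k, k \in K &
    forall x, face A D u x -> ip x (alpha k) = 0).
  left; have [c kE] : exists c, alpha k = c *: u.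
    apply: (@perp_collinear _ _ A) => // y yu.
    have [H HE] := perp_vspace A (alpha k).
    apply/HE; apply: (affine_dim_perp (A := A) dimF u0 Fconst Fp _ yu) => x Fx.
    by apply/HE; rewrite ipBl !hk // subrr.
  exists k, c^-1; split; first by rewrite inE kK hk ?eqxx.
  rewrite kE scalerA mulVf ?scale1r //; apply: contraNneq (alpha_neq0 A k) => c0.
  by rewrite kE c0 scale0r.
right.
have n0 : (0 < n)%N.
  rewrite lt0n; apply: contraNneq u0 => n0; apply/eqP.
  by apply: (@simple_ip_inj _ _ A) => i; move: (ltn_ord i); rewrite {2}n0.
have /choice[x xP] i : exists x, face A D u x /\ (i \in K -> 0 < ip x (alpha i)).
  have [iK|iK] := boolP (i \in K); last by exists p.
  case: (h i) => // /existsNP[x /not_implyP[Fx xi]]; exists x; split=> // _.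
  by rewrite lt_neqAle eq_sym; apply/andP; split; [exact/eqP|exact: Fx.1.2].
pose y := \sum_i n%:R^-1 *: x i.
have nV0 : 0 < n%:R^-1 :> R by rewrite invr_gt0 ltr0n.
have c1 : \sum_(i < n) n%:R^-1 = 1 :> R.
  by rewrite sumr_const card_ord -[LHS]mulr_natl divff // pnatr_eq0 -lt0n.
have Py : P y.
  apply: convex_hull_sum => [i _|i _ _|//]; first exact: ltW.
  by have [[[]]] := xP i.
have y_gt0 k : k \in K -> 0 < ip y (alpha k).
  move=> kK; rewrite ip_suml (bigD1 k) //= ltr_wpDr //.
    rewrite sumr_ge0 // => i _; rewrite ipZl mulr_ge0 ?(ltW nV0) //.
    by have [[[_ Cx] _] _] := xP i; exact: Cx.
  by rewrite ipZl mulr_gt0 //; exact: (xP k).2.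
have yu : ip y u = ip p u.
  rewrite ip_suml -[RHS]mul1r -[1 in RHS]c1 mulr_suml; apply: eq_bigr => i _.
  by rewrite ipZl (Fconst _ _ (xP i).1 Fp).
have Dy : dominant A K y by move=> k /y_gt0/ltW.
have FPp : face A P u p.
  split=> [|z Pz]; first exact: Dp.1.
  have [|t /andP[t0 t1]] := dominant_step (z := z - y) Dy.
    by move=> k /wallsP[/y_gt0 + yk]; rewrite yk ltxx.
  rewrite step_conv => dt; have Dt : D ((1 - t) *: y + t *: z).
    by split=> //; apply: convex_hull_conv; rewrite // t1 ltW.
  have := pmin _ Dt; rewrite ipDl !ipZl yu mulrBl mul1r -addrA lerDl addrC.
  by rewrite -mulrBr pmulr_rge0 // subr_ge0.
have FDP x' : face A D u x' -> face A P u x'.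
  move=> Fx; split=> [|z Pz]; first exact: Fx.1.1.
  by rewrite (Fconst _ _ Fx Fp); exact: FPp.2.
split=> //; apply: (affine_dim_hyperplane (A := A) FPp u0) => [z Fz|U FU].
  exact: face_const Fz FPp.
by apply: (affine_dim_perp (A := A) dimF u0 Fconst Fp) => z /FDP; exact: FU.
Qed.

(** * Linear spans of the normal cones *)

Definition normal_span (B : set V) (p : V) : set V :=
  linear_hull (cone_lattice A (normal_cone A B p)).

Lemma normal_span_perp p b u : roots_of A b -> `|ip p b| < d ->
  normal_span P p u -> ip b u = 0.
Proof.
move=> Rb pb; have [H HE] := perp_vspace A b.
rewrite ipC -HE; apply: (@cone_lattice_hull_sub _ _ A _ H) => v [_ _ Fp] /=.
by apply/HE; rewrite ipC; exact: (face_root_perp aC dP Fp Rb pb).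
Qed.

Lemma normal_span_face p q : (forall u, face A P u p -> face A P u q) ->
  normal_span P p `<=` normal_span P q.
Proof.
by move=> pq; apply: cone_lattice_hullS => u [u0 dF Fp]; split=> //; exact: pq.
Qed.

Lemma normal_span_cut p : D p -> normal_span P p `<=` normal_span D p.
Proof. by move=> Dp; apply: cone_lattice_hullS => u; exact: facet_cut. Qed.

Lemma coroot_coweight b : roots_of A b -> coroot ip b \in coweight_lattice A.
Proof.
move=> Rb; apply/coweight_latticeP => j; rewrite ipC.
exact: (roots_crystallographic (roots_ofP A) Rb (alpha_root A j)).
Qed.

Lemma normal_span_wall p x : D p -> spanJ A (walls p) x -> normal_span D p x.
Proof.
move=> Dp hx; rewrite (alpha_expand A x) /normal_span.
have [U UE] := linear_hull_vspace (cone_lattice A (normal_cone A D p)).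
apply/UE; rewrite memv_suml // => i _.
have [ip0|ip0] := boolP (i \in walls p); last by rewrite hx ?scale0r ?mem0v.
apply/memvZ/UE; apply: (@cone_lattice_hull_mem _ _ A _ (2 / ip (alpha i) (alpha i))).
- exact: facet_wall.
- exact/root_ratio_gt0/alpha_root.
- exact/coroot_coweight/alpha_root.
Qed.

Lemma normal_span_cut_decomp p x : D p -> normal_span D p x ->
  exists u y, [/\ normal_span P p u, spanJ A (walls p) y & x = u + y].
Proof.
move=> Dp; have [U UE] := linear_hull_vspace (cone_lattice A (normal_cone A P p)).
have [J JE] : exists J : {vspace V}, forall x, x \in J <-> spanJ A (walls p) x.
  apply: vspace_exists => [|c y z hy hz]; first exact: spanJ0.
  by apply: spanJD => //; exact: spanJZ.
move=> hx; have /memv_addP[u uU [y yJ ->]] : x \in (U + J)%VS.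
  apply: (cone_lattice_hull_sub _ hx) => v hv /=.
  have [[j [c [jp ->]]]|hu] := facet_cut_inv Dp hv.
    by apply: memvZ; apply/(subvP (addvSr _ _))/JE/spanJ_alpha.
  apply/(subvP (addvSl _ _))/UE; have [c c0 cN] := facet_rational hu.
  exact: cone_lattice_hull_mem c0 cN.
by exists u, y; split; [exact/UE|exact/JE|].
Qed.

End Facets.

(** * Alcove centres *)

Section Rounding.
Variable R : realType.

(** The floor of [x + t * y] for all small [t > 0] when [y != 0]; the value at [y = 0] is that of a
    negative direction. *)
Definition round_down (x y : R) : int :=
  if 0 < y then Num.floor x else Num.ceil x - 1.

Lemma round_downD x y (z : int) : round_down (x + z%:~R) y = round_down x y + z.
Proof.
have zi : (z%:~R : R) \is a Num.int by exact: intr_int.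
rewrite /round_down floorDrz // ceilDrz // intrKfloor intrKceil.
by case: ifP => // _; rewrite addrAC.
Qed.

Lemma round_down_nonint x y y' : x \isn't a Num.int ->
  round_down x y = round_down x y'.
Proof.
move=> xn; rewrite /round_down ceil_floor xn /= addrK.
by case: ifP; case: ifP.
Qed.

(** A nearby [x] has the one-sided floor of [x0] on its own side, so the displacement takes over the
    role of the direction. *)
Lemma round_down_near x0 : exists2 r : R, 0 < r &
  forall x y, `|x - x0| < r ->
    round_down x y = round_down x0 (if x == x0 then y else x - x0).
Proof.
have /andP[f1 f2] := floor_itv x0; have /andP[c1 c2] := ceil_itv x0.
exists (Num.min ((Num.floor x0 + 1)%:~R - x0) (x0 - (Num.ceil x0 - 1)%:~R)).
  by rewrite lt_min !subr_gt0 f2 c1.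
move=> x y; rewrite lt_min => /andP[h1 h2].
have [->//|xx0] := eqVneq x x0.
have [x_lt|x_gt] := ltP 0 (x - x0).
  rewrite /round_down x_lt; rewrite gtr0_norm // in h1.
  have fx : Num.floor x = Num.floor x0 by apply: floor_def; lra.
  have cx : Num.ceil x = Num.floor x0 + 1.
    by apply: ceil_def; rewrite addrK; lra.
  by rewrite fx cx addrK; case: ifP.
have {}x_gt : x - x0 < 0 by rewrite lt_neqAle x_gt subr_eq0 xx0.
rewrite /round_down (ltNge 0 (x - x0)) (ltW x_gt) /=; rewrite ltr0_norm // in h2.
have cx : Num.ceil x = Num.ceil x0.
  by apply: ceil_def; lra.
have fx : Num.floor x = Num.ceil x0 - 1.
  apply: floor_def; rewrite subrK; lra.
by rewrite fx cx; case: ifP.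
Qed.

End Rounding.

Section Alcoves.
Variables (R : realType) (n : nat) (A : rootDatum R n).
Local Notation V := 'rV[R]_n.
Local Notation ip := (ip A).
Local Notation alpha := (alpha A).
Local Notation omega := (omega A).
Local Notation N := (coweight_lattice A).
Local Notation "'s_" := (reflection ip) (at level 0).

Lemma ip_cauchy x y : ip x y ^+ 2 <= ip x x * ip y y.
Proof.
have [->|y0] := eqVneq y 0; first by rewrite !ip0r mulr0 expr0n.
have y_gt0 : 0 < ip y y by rewrite neq0_dnorm_gt0.
have := ip_ge0 A (x - (ip x y / ip y y) *: y).
rewrite !(ipBl, ipBr, ipZl, ipZr) [ip y x]ipC divfK ?gt_eqF // subrr subr0.
by rewrite subr_ge0 mulrAC ler_pdivrMr // expr2.
Qed.

Lemma ip_sqrD3 x y z :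
  ip (x + y + z) (x + y + z) <= 3 * (ip x x + ip y y + ip z z).
Proof.
have := ip_ge0 A (x - y); have := ip_ge0 A (y - z); have := ip_ge0 A (x - z).
rewrite !(ipDl, ipDr, ipNl, ipNr) (ipC A y x) (ipC A z x) (ipC A z y); lra.
Qed.

Definition parabolic_root (J : {set 'I_n}) : set V :=
  [set b | exists w j, [/\ parabolic A J w, j \in J & b = w (alpha j)]].

Lemma parabolic_root_alpha (J : {set 'I_n}) j : j \in J -> parabolic_root J (alpha j).
Proof. by move=> jJ; exists id, j; split=> //; exact: reflection_group_id. Qed.

Lemma parabolic_root_root J b : parabolic_root J b -> roots_of A b.
Proof.
by move=> [w [j [/parabolic_weyl gw _ ->]]]; apply/(weyl_root gw)/alpha_root.
Qed.

Lemma parabolic_root_spanJ J b : parabolic_root J b -> spanJ A J b.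
Proof.
move=> [w [j [gw jJ ->]]]; rewrite -[w _](subrK (alpha j)).
by apply: spanJD; [exact: parabolic_spanJ|exact: spanJ_alpha].
Qed.

Lemma parabolic_root_stable J w b : parabolic A J w -> parabolic_root J b ->
  parabolic_root J (w b).
Proof.
move=> gw [w' [j [gw' jJ ->]]]; exists (w \o w'), j; split=> //.
exact: reflection_group_mul.
Qed.

Lemma parabolic_root_refl J b : parabolic_root J b -> parabolic A J ('s_ b).
Proof.
by move=> [w [j [gw jJ ->]]]; apply: parabolic_reflection => //; exact: parabolic_refl.
Qed.

Lemma parabolic_root_perp (J : {set 'I_n}) b u :
  (forall j, j \in J -> ip (alpha j) u = 0) -> parabolic_root J b -> ip b u = 0.
Proof. by move=> uJ /parabolic_root_spanJ bJ; exact: spanJ_perp bJ uJ. Qed.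

Definition parabolic_roots (J : {set 'I_n}) : seq V :=
  finmap.enum_fset (fset_set (parabolic_root J)).

Lemma mem_parabolic_roots J b : (b \in parabolic_roots J) = `[< parabolic_root J b >].
Proof.
apply: in_fset_set; apply: sub_finite_set (roots_finite (roots_ofP A)).
exact: parabolic_root_root.
Qed.

Lemma parabolic_rootsP J b : reflect (parabolic_root J b) (b \in parabolic_roots J).
Proof. by rewrite mem_parabolic_roots; exact: asboolP. Qed.

Lemma parabolic_roots_perm J w : parabolic A J w ->
  perm_eq (map w (parabolic_roots J)) (parabolic_roots J).
Proof.
move=> gw; have [w' [gw' wK w'K]] := parabolic_inv gw.
apply: uniq_perm; rewrite ?(map_inj_uniq (can_inj wK)) ?finmap.fset_uniq // => b.
apply/mapP/parabolic_rootsP => [[b' /parabolic_rootsP hb ->]|hb].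
  exact: parabolic_root_stable.
by exists (w' b); rewrite ?w'K //; apply/parabolic_rootsP/parabolic_root_stable.
Qed.

(** The Gram operator of the subsystem: it commutes with [W_J], vanishes on the orthogonal
    complement of the span of [J] and is invertible on that span. *)
Definition root_form J x := \sum_(b <- parabolic_roots J) ip x b *: b.

Lemma root_form_linear J : linear (root_form J).
Proof.
move=> c x y; rewrite /root_form scaler_sumr -big_split; apply: eq_bigr => b _ /=.
by rewrite ipDl ipZl scalerDl scalerA.
Qed.

Lemma root_formD J x y : root_form J (x + y) = root_form J x + root_form J y.
Proof. by rewrite -[x]scale1r root_form_linear !scale1r. Qed.

Lemma root_formB J x y : root_form J (x - y) = root_form J x - root_form J y.
Proof. by rewrite addrC -scaleN1r root_form_linear scaleN1r addrC. Qed.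

Lemma root_form_spanJ J x : spanJ A J (root_form J x).
Proof.
rewrite /root_form big_seq; apply: spanJ_sum => b /parabolic_rootsP hb.
exact/spanJZ/parabolic_root_spanJ.
Qed.

Lemma root_form_eq0 (J : {set 'I_n}) x : root_form J x = 0 ->
  forall b, parabolic_root J b -> ip b x = 0.
Proof.
move=> x0 b hb; have /eqP : \sum_(b <- parabolic_roots J) ip x b * ip b x = 0.
  rewrite -[RHS](ip0l A x) -x0 ip_suml; apply: eq_bigr => c _.
  by rewrite ipZl.
rewrite psumr_eq0 => [|c _]; last by rewrite [ip c x]ipC -expr2 sqr_ge0.
move=> /allP/(_ b); rewrite (introT (parabolic_rootsP _ _)) // => /(_ isT)/=.
by rewrite [ip x b]ipC -expr2 sqrf_eq0 => /eqP.
Qed.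

Lemma root_form_inj J x : spanJ A J x -> root_form J x = 0 -> x = 0.
Proof.
move=> hx x0; apply/(@ip_eq0 _ _ A)/(spanJ_perp hx) => j jJ.
exact/(root_form_eq0 x0)/parabolic_root_alpha.
Qed.

Lemma root_form_surj J y : spanJ A J y -> exists2 x, spanJ A J x & root_form J x = y.
Proof.
move=> hy; have [U UE] : exists U : {vspace V}, forall x, x \in U <-> spanJ A J x.
  apply: vspace_exists => [|c x z hx hz]; first exact: spanJ0.
  by apply: spanJD => //; exact: spanJZ.
pose r := GRing.isLinear.Build R V V *:%R _ (root_form_linear J).
pose rl : {linear V -> V} := HB.pack (root_form J) r.
pose f : 'End(V) := linfun rl.
have fE x : f x = root_form J x by rewrite lfunE.
have /eqP fU : (f @: U)%VS == U.
  rewrite eqEdim; apply/andP; split.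
    by apply/subvP => _ /memv_imgP[x _ ->]; rewrite fE; apply/UE/root_form_spanJ.
  rewrite limg_dim_eq //; apply/eqP; rewrite -subv0; apply/subvP => x.
  rewrite memv_cap memv_ker fE memv0 => /andP[/UE xU /eqP x0].
  by apply/eqP/(root_form_inj xU).
have /memv_imgP[x /UE xU ->] : y \in (f @: U)%VS by rewrite fU; exact/UE.
by exists x.
Qed.

Lemma root_form_equiv J w x : parabolic A J w -> root_form J (w x) = w (root_form J x).
Proof.
move=> gw; have ww := parabolic_weyl gw.
rewrite /root_form (weyl_sum ww) -(perm_big _ (parabolic_roots_perm gw)) /= big_map.
by apply: eq_bigr => b _; rewrite (weylZ ww) weyl_isometry.
Qed.

Lemma root_form_perp (J : {set 'I_n}) u :
  (forall j, j \in J -> ip (alpha j) u = 0) -> root_form J u = 0.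
Proof.
move=> uJ; rewrite /root_form big_seq big1 // => b /parabolic_rootsP hb.
by rewrite ipC (parabolic_root_perp uJ) ?scale0r.
Qed.

(** The equation [root_form J x = label_sum J b v] is the normal equation for fitting the pairings
    [ip x c] to the labels in the least squares sense. For a generic direction [b] the labels of [c]
    and [- c] combine to the midpoint of the unit interval in which the alcove confines the pairing
    with [c]. *)
Definition label_sum J b v :=
  \sum_(c <- parabolic_roots J) (round_down (ip v c) (ip b c))%:~R *: c.

(* The centre of the alcove of the arrangement [ip _ c \in Z], c in Phi_J, that
   contains [v] and meets every neighbourhood of [v] in direction [b]. *)
Lemma center_exists J b v :
  exists x, spanJ A J (x - v) /\ root_form J x = label_sum J b v.
Proof.
have [|x hx xE] := @root_form_surj J (label_sum J b v - root_form J v).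
  apply: spanJB; last exact: root_form_spanJ.
  rewrite /label_sum big_seq; apply: spanJ_sum => c /parabolic_rootsP hc.
  exact/spanJZ/parabolic_root_spanJ.
exists (x + v); rewrite addrK; split=> //.
by rewrite root_formD xE subrK.
Qed.

Definition center J b v := projT1 (cid (center_exists J b v)).

Lemma center_spanJ J b v : spanJ A J (center J b v - v).
Proof. by rewrite /center; case: cid => x []. Qed.

Lemma center_form J b v : root_form J (center J b v) = label_sum J b v.
Proof. by rewrite /center; case: cid => x []. Qed.

Lemma center_uniq J b v x : spanJ A J (x - v) -> root_form J x = label_sum J b v ->
  x = center J b v.
Proof.
move=> hx xE; apply/eqP; rewrite -subr_eq0; apply/eqP/(@root_form_inj J).
  have := spanJB hx (@center_spanJ J b v).
  by rewrite opprB addrA subrK.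
by rewrite root_formB xE center_form subrr.
Qed.

Lemma label_sum_eq J b b' v v' :
  (forall c, parabolic_root J c ->
     round_down (ip v c) (ip b c) = round_down (ip v' c) (ip b' c)) ->
  label_sum J b v = label_sum J b' v'.
Proof.
move=> e; rewrite /label_sum !big_seq; apply: eq_bigr => c /parabolic_rootsP hc.
by rewrite e.
Qed.

Lemma center_equiv J w b v nu : parabolic A J w -> nu \in N ->
  center J (w b) (w v + nu) = w (center J b v) + nu.
Proof.
move=> gw Nnu; have ww := parabolic_weyl gw.
apply/esym/center_uniq.
  rewrite opprD addrACA subrr addr0 -(weylB ww).
  rewrite -[w _](subrK (center J b v - v)); apply: spanJD; last exact: center_spanJ.
  exact: parabolic_spanJ.
rewrite root_formD root_form_equiv // center_form /label_sum (weyl_sum ww).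
rewrite -[in RHS](perm_big _ (parabolic_roots_perm gw)) /= big_map.
rewrite /root_form -[X in _ + X = _](perm_big _ (parabolic_roots_perm gw)) /=.
rewrite big_map -big_split /=.
rewrite !big_seq; apply: eq_bigr => c /parabolic_rootsP hc.
rewrite ipDl !weyl_isometry //.
have [|z ->] := @coweight_lattice_root _ _ A nu (w c) Nnu.
  exact/(weyl_root ww)/parabolic_root_root/hc.
by rewrite round_downD (weylZ ww) rmorphD scalerDl.
Qed.

Lemma center_perp (J : {set 'I_n}) b v u : (forall j, j \in J -> ip (alpha j) u = 0) ->
  center J b (v + u) = center J b v + u.
Proof.
move=> uJ; apply/esym/center_uniq.
  by rewrite opprD addrACA subrr addr0; exact: center_spanJ.
rewrite root_formD (root_form_perp uJ) addr0 center_form; apply: label_sum_eq => c hc.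
by rewrite ipDl [ip u c]ipC (parabolic_root_perp uJ hc) addr0.
Qed.

(** * Alcoves around a point *)

Section Stabilizer.
Variables (J : {set 'I_n}) (v : V).

Definition wall_root : set V :=
  [set b | parabolic_root J b /\ ip v b \is a Num.int].

(** These reflections are the linear parts of affine reflections fixing [v], so each moves [v] by an
    integral multiple of a coroot. *)
Lemma wall_group w : reflection_group ip wall_root w ->
  parabolic A J w /\ v - w v \in N.
Proof.
elim=> [|b {}w [hb vb] _ [gw Nw]].
  by rewrite subrr rpred0; split=> //; exact: reflection_group_id.
have gb := parabolic_root_refl hb; split; first exact: reflection_group_mul gb gw.
rewrite /= -[v - _](subrKA ('s_ b v)) rpredD //.
  rewrite /reflection opprB addrC subrK; have /intrP[z ->] := vb.
  rewrite scaler_int rpredMz //; exact/coroot_coweight/(parabolic_root_root hb).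
by rewrite -(weylB (parabolic_weyl gb)) weyl_coweight //; exact: parabolic_weyl gb.
Qed.

Lemma wall_group_finite : finite_set (reflection_group ip wall_root).
Proof. by apply: sub_finite_set (parabolic_finite A J) => w /wall_group[]. Qed.

(** Generic directions at [v] select the alcoves around it. Maximising the pairing with [b'] over
    the finite group of the walls through [v] puts [w b] on the same side of each of them as
    [b']. *)
Lemma center_conj b b' :
  (forall c, wall_root c -> ip b c != 0) -> (forall c, wall_root c -> ip b' c != 0) ->
  exists w, [/\ parabolic A J w, v - w v \in N &
    center J b' v = w (center J b v) + (v - w v)].
Proof.
move=> hb hb'; have [|w gw wmax] :=
    @finite_argmax R _ _ (fun w => ip (w b) b') wall_group_finite.
  by exists id; exact: reflection_group_id.
have [gJ Nw] := wall_group gw; have ww := parabolic_weyl gJ.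
have [w' [gw' wK w'K]] := parabolic_inv gJ.
exists w; split=> //; rewrite -center_equiv // addrC subrK.
apply: center_uniq; first exact: center_spanJ.
rewrite center_form; apply: label_sum_eq => c hc.
have [vc|vc] := boolP (ip v c \is a Num.int); last exact: round_down_nonint.
have wc : wall_root c by [].
have h : 0 <= ip (w b) c * ip b' c.
  have := wmax _ (reflection_group_comp wc gw).
  rewrite /= /reflection /coroot ipBl !ipZl gerBl mulrCA [ip c b']ipC.
  by rewrite (pmulr_rge0 _ (root_ratio_gt0 (parabolic_root_root hc))).
have bc : ip (w b) c != 0.
  rewrite -(weyl_isometry _ _ (parabolic_weyl gw')) wK; apply: hb; split.
    exact: parabolic_root_stable.
  rewrite -(weyl_isometry _ _ ww) w'K -[w v](subKr v) ipBl rpredB //.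
  have [|z ->] := @coweight_lattice_root _ _ A (v - w v) c Nw.
    exact: parabolic_root_root hc.
  exact: intr_int.
rewrite /round_down; suff -> : (0 < ip b' c) = (0 < ip (w b) c) by [].
have b'c := hb' c wc.
have [wb_gt|wb_lt|/eqP] := ltrgt0P (ip (w b) c); last by rewrite (negPf bc).
  by rewrite lt_neqAle eq_sym b'c; rewrite pmulr_rge0 in h.
by apply/negbTE; rewrite -leNgt; rewrite nmulr_rge0 in h.
Qed.

End Stabilizer.

(** The identification of first components that the orbit space makes over a point whose walls are
    [J], apart from the normal directions of [P]. *)
Definition lattice_eqv (J : {set 'I_n}) v v' :=
  exists2 w, parabolic A J w & v' - w v \in N.

Lemma lattice_eqvS (J J' : {set 'I_n}) v v' : J \subset J' -> lattice_eqv J v v' ->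
  lattice_eqv J' v v'.
Proof. by move=> JJ' [w gw h]; exists w => //; exact: parabolicS gw. Qed.

Lemma lattice_eqv_refl J v : lattice_eqv J v v.
Proof. by exists id; [exact: reflection_group_id|rewrite subrr rpred0]. Qed.

Lemma lattice_eqv_trans J x y z : lattice_eqv J x y -> lattice_eqv J y z ->
  lattice_eqv J x z.
Proof.
move=> [w gw h] [w' gw' h']; have ww' := parabolic_weyl gw'.
exists (w' \o w); first exact: reflection_group_mul.
by rewrite /= -(subrKA (w' y)) rpredD // -(weylB ww') weyl_coweight.
Qed.

Lemma lattice_eqv_sym J x y : lattice_eqv J x y -> lattice_eqv J y x.
Proof.
move=> [w gw h]; have [w' [gw' wK w'K]] := parabolic_inv gw.
have ww' := parabolic_weyl gw'; exists w' => //.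
by rewrite -[x]wK -(weylB ww') weyl_coweight // -opprB rpredN.
Qed.

(** * Pulling towards alcove centres *)

Variables (a : V) (aC : chamber A a).

Lemma chamber_root_neq0 b : roots_of A b -> ip a b != 0.
Proof.
have [d d0 dP] := chamber_gap aC; move=> Rb.
have := @root_gap _ _ A a aC d dP id b (reflection_group_id _ _) Rb.
by rewrite -normr_gt0; exact: lt_le_trans.
Qed.

Lemma wall_root_chamber J v c : wall_root J v c -> ip a c != 0.
Proof. by move=> [/parabolic_root_root/chamber_root_neq0]. Qed.

(** The regular vector [a] breaks ties when [v] lies on a wall; any other generic direction gives an
    equivalent centre ([center_conj]). *)
Definition pull J (s : R) v := v + s *: (center J a v - v).

Lemma pull0 J v : pull J 0 v = v.
Proof. by rewrite /pull scale0r addr0. Qed.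

Lemma pull1 J v : pull J 1 v = center J a v.
Proof. by rewrite /pull scale1r addrC subrK. Qed.

Lemma pull_spanJ J s v : spanJ A J (pull J s v - v).
Proof. by rewrite /pull addrAC subrr add0r; exact/spanJZ/center_spanJ. Qed.

Lemma pull_perp (J : {set 'I_n}) s v u : (forall j, j \in J -> ip (alpha j) u = 0) ->
  pull J s (v + u) = pull J s v + u.
Proof.
by move=> uJ; rewrite /pull center_perp // opprD addrACA subrr addr0 addrAC.
Qed.

(** Equivariance replaces the direction [a] by [w' a]. Returning to [a] costs an element [w1] that
    fixes [v] modulo the lattice, and [w \o w1] then relates the pulled points. *)
Lemma pull_eqv J s v v' : lattice_eqv J v v' -> lattice_eqv J (pull J s v) (pull J s v').
Proof.
move=> [w gw]; set nu := v' - w v => Nnu.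
have ww := parabolic_weyl gw; have [w' [gw' wK w'K]] := parabolic_inv gw.
have vE : v' = w v + nu by rewrite addrC subrK.
have ww' := parabolic_weyl gw'.
have [|c|w1 [gw1 Nw1 cE]] := @center_conj J v a (w' a).
- exact: wall_root_chamber.
- move=> [hc _]; rewrite -(weyl_isometry _ _ ww) w'K.
  exact/chamber_root_neq0/(weyl_root ww)/parabolic_root_root/hc.
have ww1 := parabolic_weyl gw1.
exists (w \o w1); first exact: reflection_group_mul.
rewrite vE /pull -{1}[a]w'K center_equiv // cE /=.
rewrite !(weylD ww1, weylD ww, weylZ ww1, weylZ ww, weylN ww1, weylN ww).
set p := w (w1 _); set q := w (w1 v).
have -> : w v + nu + s *: (p + (w v - q) + nu - (w v + nu)) - (q + s *: (p - q)) =
  nu + (w v - q).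
  by apply/rowP => i; rewrite !mxE; ring.
by rewrite rpredD // -(weylB ww) weyl_coweight.
Qed.

Lemma seq_small (T : eqType) (s : seq T) (Q : T -> R -> Prop) :
  (forall x r r', 0 < r' <= r -> Q x r -> Q x r') ->
  (forall x, x \in s -> exists2 r, 0 < r & Q x r) ->
  exists2 r, 0 < r & forall x, x \in s -> Q x r.
Proof.
move=> Qmon; elim: s => [|x s IH] h; first by exists 1.
have [|r r0 hr] := IH; first by move=> y ys; apply: h; rewrite inE ys orbT.
have [|r' r0' hr'] := h x; first by rewrite inE eqxx.
exists (Num.min r r'); first by rewrite lt_min r0 r0'.
move=> y; rewrite inE => /predU1P[->|ys].
  by apply: Qmon hr'; rewrite lt_min r0 r0' ge_min lexx orbT.
by apply: Qmon (hr y ys); rewrite lt_min r0 r0' ge_min lexx.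
Qed.

(** The displacement [v - v0], perturbed by a small multiple of [a], is a direction [b] selecting at
    [v0] the alcove to which [v] belongs. The two centres share their labels, so they differ by the
    component [z] of [v - v0] orthogonal to the roots of [J]; [center_conj] then changes [b] to
    [a]. *)
Lemma center_near J v0 : exists2 r, 0 < r & forall v, ip (v - v0) (v - v0) < r ->
  exists w z, [/\ parabolic A J w, v0 - w v0 \in N,
    center J a v0 = w (center J a v - z) + (v0 - w v0),
    forall j, j \in J -> ip (alpha j) z = 0 & spanJ A J (z - (v - v0))].
Proof.
pose Q c r := forall v, ip (v - v0) (v - v0) < r -> forall y,
  round_down (ip v c) y =
  round_down (ip v0 c) (if ip v c == ip v0 c then y else ip v c - ip v0 c).
have [c r r' /andP[_ rr'] hr v hv|c _|r r0 hr] := @seq_small _ (parabolic_roots J) Q.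
- exact/hr/(lt_le_trans hv).
- have [e e0 he] := round_down_near (ip v0 c).
  exists (e ^+ 2 / (1 + ip c c)).
    by rewrite divr_gt0 ?exprn_gt0 // ltr_wpDr ?ip_ge0.
  move=> v hv y; apply: he; rewrite -ipBl -(ltr_pXn2r (n := 2)) ?nnegrE ?(ltW e0) //.
  rewrite real_normK ?num_real //; apply: le_lt_trans (ip_cauchy _ _) _.
  rewrite ltr_pdivlMr ?ltr_wpDr ?ip_ge0 // in hv; apply: le_lt_trans hv.
  by rewrite ler_wpM2l ?ip_ge0 // lerDr.
exists r => // v hv.
pose S c t := ip (v - v0) c != 0 -> t * `|ip a c| < `|ip (v - v0) c|.
have [c t t' /andP[t0 tt'] ht vc|c _|t t0 ht] := @seq_small _ (parabolic_roots J) S.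
- by apply: le_lt_trans (ht vc); rewrite ler_wpM2r.
- rewrite /S; have [->|vc] := eqVneq (ip (v - v0) c) 0; first by exists 1 => // /eqP.
  exists (`|ip (v - v0) c| / (1 + `|ip a c|)) => [|_].
    by rewrite divr_gt0 ?normr_gt0 // ltr_wpDr.
  rewrite mulrAC ltr_pdivrMr ?ltr_wpDr // ltr_pM2l ?normr_gt0 //.
  by rewrite ltrDr.
(* The vector [a] decides only at roots orthogonal to the displacement; [t] is too small to reverse
   any other sign. *)
pose b := v - v0 + t *: a.
have b_sign c : parabolic_root J c ->
    ip b c != 0 /\ ((0 < ip b c) =
      (0 < if ip v c == ip v0 c then ip a c else ip v c - ip v0 c)).
  move=> hc; have ac := chamber_root_neq0 (parabolic_root_root hc).
  rewrite -(subr_eq0 (ip v c)) -!ipBl /b ipDl ipZl.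
  have := ht c (introT (parabolic_rootsP _ _) hc); rewrite /S.
  have [->|vc /(_ isT)] := eqVneq (ip (v - v0) c) 0.
    by move=> _; rewrite add0r (pmulr_rgt0 _ t0) mulf_neq0 ?(gt_eqF t0).
  have := ler_norm (t * ip a c); have := ler_norm (- (t * ip a c)).
  rewrite normrN normrM (gtr0_norm t0).
  have [p|p|p] := ltrgt0P (ip (v - v0) c); last by rewrite p eqxx in vc.
    move=> h1 h2 h3.
    have q : 0 < ip (v - v0) c + t * ip a c by lra.
    by rewrite q gt_eqF.
  move=> h1 h2 h3; have q : ip (v - v0) c + t * ip a c < 0 by lra.
  by rewrite lt_eqF // ltNge (ltW q).
have [|c|w [gw Nw cE]] := @center_conj J v0 b a.
- by move=> c [/b_sign[]].
- exact: wall_root_chamber.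
exists w, (center J a v - center J b v0); split=> //.
- by rewrite subKr.
- move=> j jJ; apply: (@root_form_eq0 J); last exact: parabolic_root_alpha.
  apply/eqP; rewrite root_formB !center_form subr_eq0; apply/eqP.
  apply: label_sum_eq => c hc; rewrite (hr c (introT (parabolic_rootsP _ _) hc) v hv).
  by rewrite /round_down (b_sign c hc).2.
- have := spanJB (@center_spanJ J a v) (@center_spanJ J b v0).
  set p := center J a v; set q := center J b v0.
  have -> // : p - v - (q - v0) = p - q - (v - v0).
  by apply/rowP => i; rewrite !mxE; ring.
Qed.

(** After the correction by the [w] of [center_near], the error is a sum of three vectors governed
    by [v - v0], its orthogonal component [z] and [s - s0]. *)
Lemma pull_near J v0 s0 e : 0 < e -> exists2 r, 0 < r &
  forall v s, 0 <= s <= 1 -> ip (v - v0) (v - v0) < r -> `|s - s0| < r ->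
  exists2 y, lattice_eqv J (pull J s v) y &
    ip (y - pull J s0 v0) (y - pull J s0 v0) < e.
Proof.
move=> e0; have [r r0 hr] := center_near J v0.
set C := ip (center J a v0 - v0) (center J a v0 - v0).
have C0 : 0 <= C by exact: ip_ge0.
(* The squared lengths of the three error terms are at most [k], [k] and [k * C]; the factor [3]
   comes from [ip_sqrD3]. *)
pose k := e / (3 * (2 + C)).
have k0 : 0 < k by rewrite divr_gt0 // mulr_gt0 // ltr_wpDr.
exists (Num.min r (Num.min 1 k)); first by rewrite !lt_min r0 ltr01.
move=> v s s01; rewrite !lt_min => /and3P[vr v1 vk] /and3P[_ s1 sk].
have [w [z [gw Nw cE zJ zspan]]] := hr v vr; have ww := parabolic_weyl gw.
exists (w (pull J s v) + (v0 - w v0)).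
  by exists w => //; rewrite addrAC subrr add0r.
set c := center J a v in cE *.
have -> : w (pull J s v) + (v0 - w v0) - pull J s0 v0 =
    (1 - s) *: w (v - v0) + s *: w z + (s - s0) *: (center J a v0 - v0).
  rewrite /pull -/c cE !(weylD ww, weylN ww, weylZ ww).
  move: (w v) (w v0) (w z) (w c) => wv wv0 wz wc.
  rewrite !(scalerBl, scalerBr, scalerDr, scale1r).
  apply/rowP => i; rewrite !mxE; ring.
apply: le_lt_trans (ip_sqrD3 _ _ _) _.
rewrite !(ipZl, ipZr) !(weyl_isometry _ _ ww) -/C.
have zle : ip z z <= ip (v - v0) (v - v0).
  pose m := z - (v - v0); have mz : ip m z = 0 by exact: spanJ_perp zspan zJ.
  have vE : v - v0 = z - m by rewrite /m subKr.
  clearbody m; rewrite vE !(ipDl, ipDr, ipNl, ipNr) (ipC A z m) mz; have := ip_ge0 A m; lra.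
have s2 : (s - s0) * (s - s0) <= k.
  rewrite -expr2 -real_normK ?num_real // expr2 ltW //.
  by apply: le_lt_trans sk; rewrite ler_piMl // ltW.
have ke : k * (3 * (2 + C)) = e by rewrite divfK // gt_eqF // mulr_gt0 // ltr_wpDr.
move: (ip_ge0 A z) zle vk; move: (ip z z) (ip (v - v0) (v - v0)) => Z X Z0 ZX Xk.
have /andP[s0' s1'] := s01.
have h1 : (1 - s) * ((1 - s) * X) <= X.
  have : (1 - s) * X <= X by rewrite ler_piMl //; lra.
  by move=> h; apply: le_trans h; rewrite ler_piMl ?mulr_ge0 //; lra.
have h2 : s * (s * Z) <= X.
  have : s * Z <= Z by rewrite ler_piMl.
  move=> h; apply: le_trans ZX; apply: le_trans h; rewrite ler_piMl ?mulr_ge0 //.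
have h3 : (s - s0) * ((s - s0) * C) <= k * C by rewrite mulrA ler_wpM2r.
rewrite -ke; lra.
Qed.

(** All alcoves are conjugate. Along the segment the displacement lies in the span of the roots, so
    the vector [z] of [center_near] vanishes and the class of the centre is locally constant; the
    line is connected. *)
Lemma center_path J v y : spanJ A J y -> lattice_eqv J (center J a v) (center J a (v + y)).
Proof.
move=> hy; pose c t := center J a (v + t *: y).
have loc t0 : exists2 r, 0 < r & forall t, `|t - t0| < r -> lattice_eqv J (c t0) (c t).
  have [r r0 hr] := center_near J (v + t0 *: y).
  exists (Num.min 1 (r / (1 + ip y y))).
    by rewrite lt_min ltr01 divr_gt0 // ltr_wpDr ?ip_ge0.
  move=> t; rewrite lt_min => /andP[t1 tr]; apply: lattice_eqv_sym.
  have dE : v + t *: y - (v + t0 *: y) = (t - t0) *: y.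
    by rewrite opprD addrACA subrr add0r scalerBl.
  have [|w [z [gw Nw cE zJ]]] := hr (v + t *: y).
    rewrite dE ipZl ipZr mulrA; rewrite ltr_pdivlMr ?ltr_wpDr ?ip_ge0 // in tr.
    apply: le_lt_trans tr; rewrite -expr2 -(real_normK (num_real _)).
    apply: ler_pM; rewrite ?exprn_ge0 ?ip_ge0 ?lerDr //.
    by rewrite expr2 ler_piMl // ltW.
  rewrite dE => zspan; have z0 : z = 0.
    apply/(@ip_eq0 _ _ A)/(spanJ_perp _ zJ).
    by rewrite -[z](subrK ((t - t0) *: y)); apply: spanJD => //; exact: spanJZ.
  by exists w => //; rewrite /c cE z0 subr0 addrAC subrr add0r.
have conn : connected [set: R] by apply/connected_intervalP.
pose S := [set t | lattice_eqv J (c 0) (c t)].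
suff /seteqP[_ /(_ 1 I)] : S = [set: R] by rewrite /S /= /c scale0r addr0 scale1r.
have oS : open S.
  rewrite openE => t0 /= ht0; have [r r0 hr] := loc t0.
  apply/nbhs_ballP; exists r => //= t; rewrite /ball /= distrC => /hr.
  exact: lattice_eqv_trans.
have cS : closed S.
  rewrite -openC openE => t0 /= ht0; have [r r0 hr] := loc t0.
  apply/nbhs_ballP; exists r => //= t; rewrite /ball /= distrC => /hr h ht.
  exact/ht0/(lattice_eqv_trans ht)/lattice_eqv_sym.
apply: conn.
- by exists 0; exact: lattice_eqv_refl.
- by exists S => //; rewrite setTI.
- by exists S => //; rewrite setTI.
Qed.

End Alcoves.

(** * Iterated contractions *)

Section Clamp.
Variable R : realType.

Definition clamp (x : R) : R := Num.max 0 (Num.min 1 x).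

Lemma clamp_ge0 x : 0 <= clamp x.
Proof. by rewrite le_max lexx. Qed.

Lemma clamp_le1 x : clamp x <= 1.
Proof. by rewrite ge_max ler01 ge_min lexx. Qed.

Lemma clamp_eq0 x : x <= 0 -> clamp x = 0.
Proof. by move=> x0; rewrite /clamp max_l // ge_min x0 orbT. Qed.

Lemma clamp_eq1 x : 1 <= x -> clamp x = 1.
Proof. by move=> x1; rewrite /clamp min_l // max_r. Qed.

Lemma clamp_neq0 x : clamp x != 0 -> 0 < x.
Proof. by rewrite ltNge; apply: contraNN => /clamp_eq0->. Qed.

Lemma clamp_lt1 x : clamp x < 1 -> x < 1.
Proof. by rewrite !ltNge; apply: contraNN => /clamp_eq1->. Qed.

Lemma clamp0 : clamp 0 = 0.
Proof. exact: clamp_eq0. Qed.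

Lemma clamp_continuous : continuous clamp.
Proof.
move=> x; have h : {for x, continuous ((fun=> 1 : R^o) \min (id : R -> R^o))}.
  by apply: continuous_min => //; exact: cvg_cst.
have : {for x, continuous ((fun=> 0 : R^o) \max ((fun=> 1 : R^o) \min (id : R -> R^o)))}.
  by apply: continuous_max => //; exact: cvg_cst.
exact.
Qed.

End Clamp.

Section PullSequences.
Variables (R : realType) (n : nat) (A : rootDatum R n).
Local Notation V := 'rV[R]_n.
Local Notation ip := (ip A).
Local Notation alpha := (alpha A).
Variables (a : V) (aC : chamber A a).
Implicit Types (J K M Z : {set 'I_n}) (s : {set 'I_n} -> R) (l : seq {set 'I_n}).

Definition pull_seq s l v := foldl (fun v J => pull A a J (s J) v) v l.

Definition chained s l :=
  pairwise (fun J J' => (s J != 0) ==> (s J' != 0) ==> (J \subset J')) l.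

Definition supported s l M := forall J, J \in l -> s J != 0 -> J \subset M.

Lemma supported_cons s J l M : supported s (J :: l) M -> supported s l M.
Proof. by move=> h J' J'l; apply: h; rewrite inE J'l orbT. Qed.

Lemma chained_head s J l : chained s (J :: l) -> s J != 0 ->
  forall J', J' \in l -> s J' != 0 -> J \subset J'.
Proof.
rewrite /chained /= => /andP[/allP h _] sJ J' /h /implyP/(_ sJ)/implyP.
exact.
Qed.

Lemma chained_behead s J l : chained s (J :: l) -> chained s l.
Proof. by rewrite /chained /= => /andP[]. Qed.

Lemma pull_seq_spanJ s l M v : supported s l M -> spanJ A M (pull_seq s l v - v).
Proof.
elim: l v => [|J l IH] v sM /=; first by rewrite subrr; exact: spanJ0.
rewrite -[_ - v](subrKA (pull A a J (s J) v)); apply: spanJD.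
  exact/IH/(supported_cons sM).
have [->|sJ] := eqVneq (s J) 0; first by rewrite pull0 subrr; exact: spanJ0.
apply: (@spanJ_sub _ _ A J); last exact: pull_spanJ.
by apply: sM => //; rewrite inE eqxx.
Qed.

Lemma pull_seq_perp s l M v u : supported s l M ->
  (forall j, j \in M -> ip (alpha j) u = 0) ->
  pull_seq s l (v + u) = pull_seq s l v + u.
Proof.
move=> + uM; elim: l v => [//|J l IH] v sM /=.
rewrite -IH; last exact: supported_cons sM.
have [->|sJ] := eqVneq (s J) 0; first by rewrite !pull0.
rewrite pull_perp // => j jJ; apply: uM; apply: (fintype.subsetP _ _ jJ).
by apply: sM => //; rewrite inE eqxx.
Qed.

(** A pull along an active set [J'] containing [J] turns a [W_J]-equivalence into a
    [W_J']-equivalence; nestedness lets this continue up to [M]. *)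
Lemma pull_seq_eqv s l M J v v' : chained s l -> supported s l M -> J \subset M ->
  (forall J', J' \in l -> s J' != 0 -> J \subset J') ->
  lattice_eqv A J v v' -> lattice_eqv A M (pull_seq s l v) (pull_seq s l v').
Proof.
elim: l J v v' => [|J' l IH] J v v' cl sM JM Jl /= vv'; first exact: lattice_eqvS vv'.
have [s0|sJ'] := eqVneq (s J') 0.
  rewrite s0 !pull0; apply: (IH J) => //; first exact: chained_behead cl.
    exact: supported_cons sM.
  by move=> J2 J2l; apply: Jl; rewrite inE J2l orbT.
apply: (IH J'); first exact: chained_behead cl.
- exact: supported_cons sM.
- by apply: sM => //; rewrite inE eqxx.
- exact: chained_head cl sJ'.
apply: pull_eqv => //; apply: lattice_eqvS vv'.
by apply: Jl => //; rewrite inE eqxx.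
Qed.

(** Pulls preceding [J] stay inside its span. At [J] the full pull replaces both vectors by alcove
    centres, which [center_path] identifies up to [W_J] and the lattice; later pulls preserve
    this. *)
Lemma pull_seq_collapse s l M J v v' : chained s l -> supported s l M ->
  J \in l -> s J = 1 -> spanJ A J (v' - v) ->
  lattice_eqv A M (pull_seq s l v) (pull_seq s l v').
Proof.
move=> + + + sJ; have sJ0 : s J != 0 by rewrite sJ oner_neq0.
elim: l v v' => [//|J' l IH] v v' cl sM /= Jl hv.
have [JJ'|JJ'] := eqVneq J' J.
  rewrite JJ' sJ !pull1; apply: (@pull_seq_eqv _ _ _ J).
  - exact: chained_behead cl.
  - exact: supported_cons sM.
  - by apply: sM => //; rewrite -JJ' inE eqxx.
  - by move: cl; rewrite JJ' => /chained_head; apply.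
  - by rewrite -[v'](subrK v) addrC; exact: center_path.
move: Jl; rewrite inE eq_sym (negPf JJ') /= => Jl.
apply: IH => //; [exact: chained_behead cl|exact: supported_cons sM|].
have [->|sJ'] := eqVneq (s J') 0; first by rewrite !pull0.
have JJ : J' \subset J by apply: chained_head cl sJ' _ Jl sJ0.
have h := spanJ_sub JJ (@pull_spanJ _ _ A a J' (s J') v).
have h' := spanJ_sub JJ (@pull_spanJ _ _ A a J' (s J') v').
have := spanJD (spanJB h' h) hv; set p := pull _ _ _ _ v'; set q := pull _ _ _ _ v.
by have -> // : p - v' - (q - v) + (v' - v) = p - q by apply/rowP => i; rewrite !mxE; ring.
Qed.

(** Here [y] is a representative of [v] close to [v0]. A pull yields a close representative only up
    to [W_J'], which later pulls tolerate when [J'] is active for [s]; this is why sets active for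
    [s0] must remain active. *)
Lemma pull_seq_near s0 l v0 e : 0 < e -> exists2 r, 0 < r &
  forall s M J v y, (forall J', 0 <= s J' <= 1) -> chained s l -> supported s l M ->
    J \subset M -> (forall J', J' \in l -> s J' != 0 -> J \subset J') ->
    (forall J', J' \in l -> `|s J' - s0 J'| < r) ->
    (forall J', J' \in l -> s0 J' != 0 -> s J' != 0) ->
    lattice_eqv A J v y -> ip (y - v0) (y - v0) < r ->
  exists2 y', lattice_eqv A M (pull_seq s l v) y' &
    ip (y' - pull_seq s0 l v0) (y' - pull_seq s0 l v0) < e.
Proof.
elim: l v0 e => [|J' l IH] v0 e e0.
  exists e => // s M J v y _ _ _ JM _ _ _ vy ye; exists y => //.
  exact: lattice_eqvS vy.
have [r1 r10 h1] := IH (pull A a J' (s0 J') v0) e e0.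
have [r2 r20 h2] := pull_near aC J' v0 (s0 J') r10.
exists (Num.min r1 r2); first by rewrite lt_min r10.
move=> s M J v y s01 cl sM JM Jl sr s0s vy; rewrite lt_min => /andP[yr1 yr2] /=.
have sr1 J2 : J2 \in l -> `|s J2 - s0 J2| < r1.
  by move=> J2l; have := sr J2; rewrite inE J2l orbT lt_min => /(_ isT)/andP[].
have s0s1 J2 : J2 \in l -> s0 J2 != 0 -> s J2 != 0.
  by move=> J2l; apply: s0s; rewrite inE J2l orbT.
have cl' := chained_behead cl; have sM' := supported_cons sM.
have [sJ'|sJ'] := eqVneq (s J') 0.
  have s0J' : s0 J' = 0.
    by apply/eqP; apply: contraTT isT => /s0s; rewrite inE eqxx sJ' eqxx => /(_ isT).
  rewrite sJ' pull0; apply: (h1 s M J v y) => //.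
    by move=> J2 J2l; apply: Jl; rewrite inE J2l orbT.
  by rewrite s0J' pull0.
have [||y2 yy2 y2r] := h2 y (s J') _ yr2.
- exact: s01.
- by have := sr J'; rewrite inE eqxx lt_min => /(_ isT)/andP[].
apply: (h1 s M J' _ y2) => //.
- by apply: sM => //; rewrite inE eqxx.
- exact: chained_head cl sJ'.
apply: lattice_eqv_trans yy2; apply: pull_eqv => //; apply: lattice_eqvS vy.
by apply: Jl => //; rewrite inE eqxx.
Qed.

(** * Strengths determined by the levels of the walls *)

Variable K : {set 'I_n}.
Implicit Types lam : 'I_n -> R.

(* Nonzero exactly when [J] is a sublevel set of [lam] on [K] with all values below
   [1], and [1] as soon as the gap above its values is at least [1 / n.+1]. *)
Definition level_weight lam J : R :=
  \prod_(j in J) (clamp (n.+1%:R * (1 - lam j)) *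
    \prod_(k in K :\: J) clamp (n.+1%:R * (lam k - lam j))).

Lemma level_weight01 lam J : 0 <= level_weight lam J <= 1.
Proof.
have h j : 0 <= \prod_(k in K :\: J) clamp (n.+1%:R * (lam k - lam j)) <= 1.
  apply/andP; split; first by apply: prodr_ge0 => k _; exact: clamp_ge0.
  by apply: prodr_ile1 => k _; rewrite clamp_ge0 clamp_le1.
apply/andP; split.
  by apply: prodr_ge0 => j _; rewrite mulr_ge0 ?clamp_ge0 //; case/andP: (h j).
apply: prodr_ile1 => j _; case/andP: (h j) => h0 h1.
by rewrite mulr_ge0 ?clamp_ge0 //= mulr_ile1 ?clamp_ge0 ?clamp_le1.
Qed.

Lemma level_weight_neq0 lam J : level_weight lam J != 0 ->
  forall j, j \in J -> lam j < 1 /\ forall k, k \in K -> k \notin J -> lam j < lam k.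
Proof.
move=> /prodf_neq0 h j jJ; have := h j jJ; rewrite mulf_eq0 negb_or.
move=> /andP[/clamp_neq0 + /prodf_neq0 h']; rewrite pmulr_rgt0 ?ltr0Sn // subr_gt0.
move=> ->; split=> // k kK kJ; have := h' k; rewrite inE kJ kK.
by move=> /(_ isT)/clamp_neq0; rewrite pmulr_rgt0 ?ltr0Sn // subr_gt0.
Qed.

Lemma level_weight_eq1 lam J :
  (forall j, j \in J -> 1 <= n.+1%:R * (1 - lam j)) ->
  (forall j k, j \in J -> k \in K -> k \notin J -> 1 <= n.+1%:R * (lam k - lam j)) ->
  level_weight lam J = 1.
Proof.
move=> h1 h2; apply: big1 => j jJ; rewrite clamp_eq1 ?h1 // mul1r.
by apply: big1 => k; rewrite inE => /andP[kJ kK]; rewrite clamp_eq1 ?h2.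
Qed.

(** The sets [S i] increase from a nonempty one. Were all [n.+1] inclusions strict, the last set
    would have more than [n] elements. Where two consecutive sets coincide, the values skip an
    interval of length [1 / n.+1], and the strength of that set is [1]. *)
Lemma level_weight_pigeonhole lam Z : (forall k, k \in K -> 0 <= lam k) ->
  Z \subset K -> Z != finset.set0 -> (forall j, j \in Z -> lam j = 0) ->
  exists J, [/\ J != finset.set0, J \subset K, Z \subset J & level_weight lam J = 1].
Proof.
move=> lam0 /fintype.subsetP ZK Z0 lamZ.
pose S i := [set k in K | n.+1%:R * lam k <= i%:R].
have ZS i : Z \subset S i.
  by apply/fintype.subsetP => j jZ; rewrite inE ZK // lamZ // mulr0 ler0n.
have SS i : S i \subset S i.+1.
  apply/fintype.subsetP => k; rewrite !inE => /andP[-> h]; apply: le_trans h _.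
  by rewrite ler_nat.
have [[i [i_le SiE]]|/forallNP h] :=
    pselect (exists i, (i <= n)%N /\ S i = S i.+1); last first.
  have card_S i : (i <= n.+1)%N -> (i < #|S i|)%N.
    elim: i => [_|i IH i_le].
      by rewrite (leq_trans _ (subset_leq_card (ZS 0%N))) // card_gt0.
    apply: (leq_ltn_trans (IH (ltnW i_le))); apply: proper_card.
    by rewrite finset.properEneq SS andbT; apply/eqP => e; apply: (h i); split.
  have := card_S n.+1 (leqnn _); have := max_card (mem (S n.+1)).
  by rewrite card_ord => h1 h2; have := leq_trans h2 h1; rewrite ltnNge leqnSn.
exists (S i); split=> //.
- by apply: contraNneq Z0 => e; rewrite -finset.subset0 -e.
- by apply/fintype.subsetP => k; rewrite inE => /andP[].
apply: level_weight_eq1 => [j|j k].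
  rewrite inE => /andP[_ jS]; rewrite mulrBr mulr1 lerBrDr.
  by rewrite (le_trans (lerD (lexx 1) jS)) // -natr1 addrC lerD2r ler_nat.
rewrite inE => /andP[_ jS] kK; rewrite {1}SiE inE kK /= -ltNge -natr1 => kS.
rewrite mulrBr; lra.
Qed.

(** Active sets are sublevel sets of one function, hence comparable, so sorting by cardinality
    orders them by inclusion ([level_weight_subset]). *)
Definition levels : seq {set 'I_n} :=
  sort (fun J J' => #|J| <= #|J'|)%N
    [seq J <- enum {set 'I_n} | (J != finset.set0) && (J \subset K)].

Lemma mem_levels J : (J \in levels) = (J != finset.set0) && (J \subset K).
Proof. by rewrite mem_sort mem_filter mem_enum andbT. Qed.

Lemma level_weight_subset lam J J' : J \subset K -> J' \subset K ->
  (#|J| <= #|J'|)%N -> level_weight lam J != 0 -> level_weight lam J' != 0 ->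
  J \subset J'.
Proof.
move=> /fintype.subsetP JK /fintype.subsetP J'K JJ' sJ sJ'.
apply: contraT => /fintype.subsetPn[j jJ jJ'].
have J'J : J' \subset J.
  apply/fintype.subsetP => k kJ'; apply: contraT => kJ.
  have [_ /(_ k (J'K k kJ') kJ) h1] := level_weight_neq0 sJ jJ.
  have [_ /(_ j (JK j jJ) jJ') h2] := level_weight_neq0 sJ' kJ'.
  by have := lt_trans h1 h2; rewrite ltxx.
have : J' \proper J by apply/fintype.properP; split=> //; exists j.
by move=> /proper_card; rewrite ltnNge JJ'.
Qed.

Lemma levels_chained lam : chained (level_weight lam) levels.
Proof.
have : pairwise (fun J J' => #|J| <= #|J'|)%N levels.
  rewrite -sorted_pairwise; first by apply: sort_sorted => J J'; exact: leq_total.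
  by move=> J J' J''; exact: leq_trans.
have : {subset levels <= levels} by [].
move: {1 3 4}levels; elim=> // J l IH sl /= /andP[/allP Jl pl].
rewrite /chained /=; apply/andP; split; last first.
  by apply: IH => // J' J'l; apply: sl; rewrite inE J'l orbT.
apply/allP => J' J'l; apply/implyP => sJ; apply/implyP => sJ'.
have /sl : J \in J :: l by rewrite inE eqxx.
have /sl : J' \in J :: l by rewrite inE J'l orbT.
rewrite !mem_levels => /andP[_ J'K] /andP[_ JK].
exact: level_weight_subset (Jl _ J'l) sJ sJ'.
Qed.

Lemma levels_supported lam M : (forall j, j \in K -> lam j < 1 -> j \in M) ->
  supported (level_weight lam) levels M.
Proof.
move=> lamM J; rewrite mem_levels => /andP[_ /fintype.subsetP JK] sJ.
apply/fintype.subsetP => j jJ; apply: lamM; first exact: JK.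
by have [] := level_weight_neq0 sJ jJ.
Qed.

Definition contract lam v := pull_seq (level_weight lam) levels v.

Lemma contract_spanJ lam M v : (forall j, j \in K -> lam j < 1 -> j \in M) ->
  spanJ A M (contract lam v - v).
Proof. by move=> lamM; apply: pull_seq_spanJ; exact: levels_supported. Qed.

Lemma contract_perp lam M v u : (forall j, j \in K -> lam j < 1 -> j \in M) ->
  (forall j, j \in M -> ip (alpha j) u = 0) -> contract lam (v + u) = contract lam v + u.
Proof. by move=> lamM; apply: pull_seq_perp; exact: levels_supported. Qed.

Lemma contract_id lam v : (forall j, j \in K -> lam j = 1) -> contract lam v = v.
Proof.
move=> lam1; apply/eqP; rewrite -subr_eq0; apply/eqP/(@omega_ip_inj _ _ A) => i.
rewrite ip0l (@contract_spanJ lam finset.set0 v) ?inE // => j jK.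
by rewrite lam1 // ltxx.
Qed.

(** An active set in [levels] is a nonempty sublevel set, so it contains [Z], on which [lam] is
    smallest. *)
Lemma contract_eqv lam M Z v v' : (forall j, j \in K -> lam j < 1 -> j \in M) ->
  Z \subset M -> Z \subset K ->
  (forall j k, j \in Z -> k \in K -> lam j <= lam k) -> lattice_eqv A Z v v' ->
  lattice_eqv A M (contract lam v) (contract lam v').
Proof.
move=> lamM ZM /fintype.subsetP ZK Zmin.
apply: pull_seq_eqv => //; first exact: levels_chained.
  exact: levels_supported.
move=> J; rewrite mem_levels => /andP[/finset.set0Pn[j jJ] /fintype.subsetP JK] sJ.
apply/fintype.subsetP => k kZ; apply: contraT => kJ.
have [_ /(_ k (ZK k kZ) kJ)] := level_weight_neq0 sJ jJ.
by rewrite ltNge Zmin // JK.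
Qed.

(** For nonempty [Z], the pigeonhole set contains [Z] and has full strength, so its pull forgets
    [y]. *)
Lemma contract_collapse lam M Z v y : (forall j, j \in K -> lam j < 1 -> j \in M) ->
  (forall k, k \in K -> 0 <= lam k) -> Z \subset K ->
  (forall j, j \in Z -> lam j = 0) -> spanJ A Z y ->
  lattice_eqv A M (contract lam v) (contract lam (v + y)).
Proof.
move=> lamM lam0 ZK Z0 hy; have [Ze|Zn] := eqVneq Z finset.set0.
  rewrite (_ : y = 0) ?addr0; first exact: lattice_eqv_refl.
  by apply: (@omega_ip_inj _ _ A) => i; rewrite ip0l hy // Ze inE.
have [J [Jn JK ZJ sJ]] := level_weight_pigeonhole lam0 ZK Zn Z0.
apply: (@pull_seq_collapse _ _ _ J) => //; first exact: levels_chained.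
- exact: levels_supported.
- by rewrite mem_levels Jn JK.
by rewrite addrAC subrr add0r; exact: spanJ_sub hy.
Qed.

Lemma contract_near lam0 v0 e : 0 < e -> exists2 r, 0 < r &
  forall lam M v, (forall j, j \in K -> lam j < 1 -> j \in M) ->
    (forall J, J \in levels -> `|level_weight lam J - level_weight lam0 J| < r) ->
    ip (v - v0) (v - v0) < r ->
  exists2 y, lattice_eqv A M (contract lam v) y &
    ip (y - contract lam0 v0) (y - contract lam0 v0) < e.
Proof.
move=> e0; have [r r0 hr] := pull_seq_near (level_weight lam0) levels v0 e0.
(* A perturbation smaller than every positive weight of [lam0] cannot deactivate a set. *)
pose Q J r := level_weight lam0 J != 0 -> r <= level_weight lam0 J.
have [J t t' /andP[_ t't] Qt sJ|J _|t t0 ht] := @seq_small R _ levels Q.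
- exact: le_trans t't (Qt sJ).
- have [s0|s0] := eqVneq (level_weight lam0 J) 0; first by exists 1 => //; rewrite /Q s0 eqxx.
  exists (level_weight lam0 J) => //; rewrite lt_neqAle eq_sym s0.
  by case/andP: (level_weight01 lam0 J).
exists (Num.min r t); first by rewrite lt_min r0.
move=> lam M v lamM slam; rewrite lt_min => /andP[vr _].
apply: (hr _ M finset.set0 v v) => //.
- exact: level_weight01.
- exact: levels_chained.
- exact: levels_supported.
- exact: finset.sub0set.
- by move=> J _ _; exact: finset.sub0set.
- by move=> J /slam; rewrite lt_min => /andP[].
- move=> J Jl s0; have := slam J Jl; rewrite lt_min => /andP[_].
  apply: contraTneq => ->; rewrite sub0r normrN -leNgt.
  by apply: le_trans (ler_norm _); exact: ht.
- exact: lattice_eqv_refl.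
Qed.

End PullSequences.

(** * Quotient maps and the inner product topology *)

Lemma nbhs_all (T : topologicalType) (x : T) (B : set T) : (forall y, B y) -> nbhs x B.
Proof. by move=> h; exact: nearW. Qed.

Lemma nbhs_seq (T : topologicalType) (x : T) (I : eqType) (l : seq I) (B : I -> set T) :
  (forall i, nbhs x (B i)) -> nbhs x [set y | forall i, i \in l -> B i y].
Proof.
move=> h; elim: l => [|i l IH]; first by apply: nbhs_all => y i; rewrite in_nil.
refine (filterS _ (filterI (h i) IH)).
move=> y [hi hl] j.
by rewrite inE => /predU1P[->|/hl].
Qed.

Lemma continuous_dist_nbhs (R : realType) (T : topologicalType) (f : T -> R) x t :
  continuous f -> 0 < t -> nbhs x [set y | `|f y - f x| < t].
Proof.
move=> cf t0; apply: (cf x [set z | `|z - f x| < t]); apply/nbhs_ballP.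
by exists t => // z; rewrite /ball /= distrC.
Qed.

Section QuotientMaps.
Variable R : realType.

Record quotient_map (X Y : topologicalType) (q : X -> Y) : Prop := QuotientMap {
  quotient_map_surj : forall y, exists x, q x = y;
  quotient_map_continuous : continuous q;
  quotient_map_open : forall O : set Y, open (q @^-1` O) -> open O }.

Lemma quotient_map_pi (X : topologicalType) (Q : quotType X) :
  quotient_map (\pi_(quotient_topology Q) : X -> quotient_topology Q).
Proof.
split=> [y||//]; last exact: pi_continuous.
by exists (repr y); rewrite reprK.
Qed.

Lemma quotient_map_comp (X Y Z : topologicalType) (q : X -> Y) (q' : Y -> Z) :
  quotient_map q -> quotient_map q' -> quotient_map (q' \o q).
Proof.
move=> hq hq'; split=> [z||O oO].
- have [y <-] := quotient_map_surj hq' z; have [x <-] := quotient_map_surj hq y.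
  by exists x.
- by move=> x; apply: continuous_comp; apply: quotient_map_continuous.
- exact/(quotient_map_open hq')/(quotient_map_open hq).
Qed.

Lemma quotient_map_comp_continuous (X Y Z : topologicalType) (q : X -> Y) (f : Y -> Z) :
  quotient_map q -> continuous (f \o q) -> continuous f.
Proof.
move=> hq /continuousP cf; apply/continuousP => O oO.
exact/(quotient_map_open hq)/cf.
Qed.

(* Whitehead: a quotient map times the identity of a locally compact space is again
   a quotient map; the tube lemma supplies the open sets. *)
Lemma quotient_map_homotopy (X Y Z : topologicalType) (q : X -> Y) (f : Y * R -> Z) :
  quotient_map q -> continuous (fun xs : X * R => f (q xs.1, xs.2)) -> continuous f.
Proof.
move=> hq cf [y0 s0]; have [x0 x0E] := quotient_map_surj hq y0.
move=> O; rewrite (@nbhsE Z) => -[G [oG Gf] GO].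
have : nbhs (x0, s0) [set xs | G (f (q xs.1, xs.2))].
  by apply: (cf (x0, s0)); apply: open_nbhs_nbhs; split=> //=; rewrite x0E.
move=> [[B C] [/= Bx0 /nbhs_ballP[e /= e0 Ce]] BC].
pose I := `[s0 - e / 2, s0 + e / 2]%classic.
have IC s : I s -> C s.
  rewrite /I /= in_itv /= => /andP[h1 h2]; apply: Ce; rewrite /ball /= ltr_norml.
  by apply/andP; split; lra.
pose U := [set y | forall s, I s -> G (f (y, s))].
have oU : open U.
  apply: (quotient_map_open hq); rewrite openE => x Ux.
  have := @segment_compact R (s0 - e / 2) (s0 + e / 2).
  move=> /compact_near_coveringP/(_ X (nbhs x) (fun x s => G (f (q x, s)))).
  apply.
  move=> s Is; have : nbhs (x, s) [set xs | G (f (q xs.1, xs.2))].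
    by apply: (cf (x, s)); apply: open_nbhs_nbhs; split=> //=; exact: Ux.
  move=> [[B' C'] [/= B'x C's] BC']; exists (C', B') => // -[s' x'] [/= C's' B'x'].
  exact: (BC' (x', s')).
exists (U, ball s0 (e / 2)).
  split=> /=; last by apply: nbhsx_ballx; rewrite divr_gt0.
  apply: open_nbhs_nbhs; split=> // s /IC Cs; rewrite -x0E.
  by apply: (BC (x0, s)); split=> //=; exact: nbhs_singleton.
move=> [y s] [/= Uy]; rewrite /ball /= ltr_norml => /andP[h1 h2].
by apply/GO/Uy; rewrite /I /= in_itv /=; apply/andP; split; lra.
Qed.

Lemma quotient_map_factor (X Y Z : topologicalType) (q : X -> Y) (f : X -> Z) :
  quotient_map q -> continuous f -> (forall x x', q x = q x' -> f x = f x') ->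
  exists2 g : Y -> Z, continuous g & forall x, g (q x) = f x.
Proof.
move=> hq cf qf; have [r rK] := choice (quotient_map_surj hq).
have gE x : (f \o r) (q x) = f x by apply: qf; rewrite rK.
exists (f \o r) => //; apply: (quotient_map_comp_continuous hq).
by rewrite (_ : _ \o q = f) //; apply/funext.
Qed.

Lemma quotient_map_factor_homotopy (X Y Z : topologicalType) (q : X -> Y)
    (f : X * R -> Z) : quotient_map q -> continuous f ->
  (forall x x' s, q x = q x' -> f (x, s) = f (x', s)) ->
  exists2 g : Y * R -> Z, continuous g & forall x s, g (q x, s) = f (x, s).
Proof.
move=> hq cf qf; have [r rK] := choice (quotient_map_surj hq).
have gE x s : f (r (q x), s) = f (x, s) by apply: qf; rewrite rK.
exists (fun ys => f (r ys.1, ys.2)) => //; apply: (quotient_map_homotopy hq).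
by rewrite (_ : (fun _ => _) = f) //; apply/funext => -[x s] /=; exact: gE.
Qed.

Lemma continuous_pair (X Y Z : topologicalType) (f : X -> Y) (g : X -> Z) :
  continuous f -> continuous g -> continuous (fun x => (f x, g x)).
Proof. by move=> cf cg x; exact: cvg_pair (cf x) (cg x). Qed.

Lemma continuous_compose (X Y Z : topologicalType) (f : X -> Y) (g : Y -> Z) :
  continuous f -> continuous g -> continuous (fun x => g (f x)).
Proof. by move=> cf cg x; exact: cvg_comp (cf x) (cg (f x)). Qed.

Lemma continuous_fst (X Y : topologicalType) : continuous (@fst X Y).
Proof. by move=> x; exact: cvg_fst. Qed.

Lemma continuous_snd (X Y : topologicalType) : continuous (@snd X Y).
Proof. by move=> x; exact: cvg_snd. Qed.

End QuotientMaps.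

Section InnerProductTopology.
Variables (R : realType) (n : nat) (A : rootDatum R n).
Local Notation V := 'rV[R]_n.
Local Notation ip := (ip A).
Local Notation alpha := (alpha A).
Local Notation omega := (omega A).

Lemma sum_continuous (T : topologicalType) (U : normedModType R) I (r : seq I)
    (F : I -> T -> U) : (forall i, continuous (F i)) ->
  continuous (fun x => \sum_(i <- r) F i x).
Proof. by move=> cF; apply: continuous_big => // x; exact: add_continuous. Qed.

Lemma prod_continuous (T : topologicalType) I (r : seq I) (P : pred I)
    (F : I -> T -> R) : (forall i, continuous (F i)) ->
  continuous (fun x => \prod_(i <- r | P i) F i x).
Proof. by move=> cF; apply: continuous_big => // x; exact: mul_continuous. Qed.

Lemma continuous_mul (T : topologicalType) (f g : T -> R) :
  continuous f -> continuous g -> continuous (fun x => f x * g x).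
Proof. by move=> cf cg x; exact: cvgM (cf x) (cg x). Qed.

Lemma continuous_scale (T : topologicalType) (U : normedModType R) (f : T -> R)
    (g : T -> U) : continuous f -> continuous g -> continuous (fun x => f x *: g x).
Proof. by move=> cf cg x; exact: cvgZ (cf x) (cg x). Qed.

Lemma continuous_add (T : topologicalType) (U : normedModType R) (f g : T -> U) :
  continuous f -> continuous g -> continuous (fun x => f x + g x).
Proof. by move=> cf cg x; exact: cvgD (cf x) (cg x). Qed.

Lemma continuous_subr (T : topologicalType) (f g : T -> R) :
  continuous f -> continuous g -> continuous (fun x => f x - g x).
Proof. by move=> cf cg x; exact: (@cvgB _ R^o _ _ _ f g _ _ (cf x) (cg x)). Qed.

Lemma ip_continuous y : continuous (fun x : V => ip x y).
Proof.
rewrite (_ : (fun x => _) = fun x : V => \sum_i x 0 i * ip (delta_mx 0 i) y).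
  apply: (@sum_continuous V R^o) => i.
  by apply: continuous_mul; [exact: coord_continuous|exact: cst_continuous].
apply/funext => x; rewrite {1}[x]row_sum_delta ip_suml.
by apply: eq_bigr => i _; rewrite ipZl.
Qed.

Lemma ip_sqr_continuous : continuous (fun x : V => ip x x).
Proof.
rewrite (_ : (fun x => _) = fun x : V => \sum_i ip x (omega i) * ip x (alpha i)).
  by apply: (@sum_continuous V R^o) => i; apply: continuous_mul; exact: ip_continuous.
by apply/funext => x; rewrite {1}ip_expand; apply: eq_bigr => i _; rewrite [ip (alpha i) x]ipC.
Qed.

Lemma weyl_continuous w : weyl A w -> continuous w.
Proof.
move=> gw; have [w' [gw' wK w'K]] := weyl_inv gw.
rewrite (_ : w = fun x => \sum_i ip x (w' (alpha i)) *: omega i).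
  apply: sum_continuous => i.
  by apply: continuous_scale; [exact: ip_continuous|exact: cst_continuous].
apply/funext => x; rewrite {1}(omega_expand A (w x)); apply: eq_bigr => i _.
by rewrite -[ip x _](weyl_isometry _ _ gw) w'K.
Qed.

Lemma ip_ball_nbhs (v : V) e : 0 < e -> \forall x \near v, ip (x - v) (x - v) < e.
Proof.
move=> e0; have cv : continuous (fun x : V => x - v).
  apply: (@continuous_add V V id (fun=> - v)); last exact: cst_continuous.
  by move=> x U hU; exact: hU.
have : (fun x : V => ip (x - v) (x - v)) x @[x --> v] --> ip (v - v) (v - v).
  exact: (cvg_comp _ _ (cv v) (@ip_sqr_continuous (v - v))).
by rewrite subrr ip0l => /cvgr_lt; exact.
Qed.

(** Transfers inner product estimates to the norm topology of row vectors: Cauchy-Schwarz bounds the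
    pairings with the [alpha i], which are the coordinates in the basis [omega]. *)
Lemma nbhs_ip_ball (v : V) (U : set V) : nbhs v U ->
  exists2 e : R, 0 < e & forall x, ip (x - v) (x - v) < e -> U x.
Proof.
move=> /nbhs_ballP[r /= r0 rU].
pose C := \sum_i `|omega i|; pose B := \sum_i ip (alpha i) (alpha i).
have C0 : 0 <= C by rewrite sumr_ge0.
have B0 : 0 <= B by rewrite sumr_ge0 // => i _; exact: ip_ge0.
pose t := r / (1 + C); have t0 : 0 < t by rewrite divr_gt0 // ltr_wpDr.
exists (t ^+ 2 / (1 + B)); first by rewrite divr_gt0 ?exprn_gt0 // ltr_wpDr.
move=> x hx; apply: rU; rewrite -ball_normE /= distrC.
have xi i : `|ip (x - v) (alpha i)| <= t.
  rewrite -(ler_pXn2r (n := 2)) ?nnegrE ?(ltW t0) // real_normK ?num_real //.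
  apply: le_trans (ip_cauchy A _ _) _; rewrite ltr_pdivlMr ?ltr_wpDr // in hx.
  apply: le_trans (ltW hx); rewrite ler_wpM2l ?ip_ge0 //.
  rewrite /B (bigD1 i) //= addrCA lerDl addr_ge0 // sumr_ge0 // => j _.
  exact: ip_ge0.
rewrite (omega_expand A (x - v)).
apply: le_lt_trans (_ : t * C < r); last first.
  by rewrite /t mulrAC ltr_pdivrMr ?ltr_wpDr // ltr_pM2l // ltrDr.
apply: le_trans (ler_norm_sum _ _ _) _; rewrite mulr_sumr ler_sum // => i _.
by rewrite normrZ ler_wpM2r.
Qed.

End InnerProductTopology.

(** * Collapsing collars onto walls *)

Section Collapse.
Variables (R : realType) (n : nat) (A : rootDatum R n).
Local Notation V := 'rV[R]_n.
Local Notation ip := (ip A).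
Local Notation alpha := (alpha A).
Local Notation omega := (omega A).
Variables (a : V) (aC : chamber A a).
Variables (d : R) (d0 : 0 < d) (dP : forall i, d <= ip a (alpha i)).
Variable K : {set 'I_n}.
Local Notation P := (weyl_polytope A a).
Local Notation D := (cut_polytope A a K).
Local Notation e := (d / 2).
Implicit Types (p : V) (J : {set 'I_n}).

Lemma half_gap_gt0 : 0 < e.
Proof. by rewrite divr_gt0. Qed.

(** On dominant points: [1] where the pairing with [alpha i] is at most [d / 2], and [0] from [d]
    on. The inner half is the collar to be flattened; the outer bound keeps [face_root_perp]
    applicable. *)
Definition near_weight p i : R :=
  if i \in K then 1 - clamp (ip p (alpha i) / e - 1) else 0.

Lemma near_weight01 p i : 0 <= near_weight p i <= 1.
Proof.
rewrite /near_weight; case: ifP => _; last by rewrite lexx ler01.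
by rewrite subr_ge0 clamp_le1 gerBl clamp_ge0.
Qed.

Lemma near_weight_eq1 p i : i \in K -> ip p (alpha i) <= e -> near_weight p i = 1.
Proof.
move=> iK pi; rewrite /near_weight iK clamp_eq0 ?subr0 // subr_le0.
by rewrite ler_pdivrMr ?half_gap_gt0 // mul1r.
Qed.

Lemma near_weight_neq0 p i : near_weight p i != 0 -> i \in K /\ ip p (alpha i) < d.
Proof.
rewrite /near_weight; case: ifP => [iK|]; last by rewrite eqxx.
move=> h; split=> //; rewrite ltNge; apply: contraNN h => dp.
rewrite clamp_eq1 ?subrr // lerBrDr ler_pdivlMr ?half_gap_gt0 //.
by apply: le_trans dp; lra.
Qed.

(** A partition of unity over the sets of walls, obtained by expanding the product of the sums
    [near_weight p i + (1 - near_weight p i)]. *)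
Definition collapse_weight p J : R :=
  \prod_i (if i \in J then near_weight p i else 1 - near_weight p i).

Lemma collapse_weight_ge0 p J : 0 <= collapse_weight p J.
Proof.
apply: prodr_ge0 => i _; have /andP[h0 h1] := near_weight01 p i.
by case: ifP; rewrite ?subr_ge0.
Qed.

Lemma collapse_weight_sum p : \sum_J collapse_weight p J = 1.
Proof.
have <- : \prod_i (near_weight p i + (1 - near_weight p i)) = 1.
  by apply: big1 => i _; rewrite addrC subrK.
by rewrite bigA_distr; apply: eq_bigl => J; rewrite inE.
Qed.

Lemma collapse_weight_near p J : collapse_weight p J != 0 ->
  forall j, j \in J -> j \in K /\ ip p (alpha j) < d.
Proof.
move=> /prodf_neq0 h j jJ; apply: near_weight_neq0.
by have := h j isT; rewrite jJ.
Qed.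

Lemma collapse_weight_far p J j : collapse_weight p J != 0 -> j \in K ->
  ip p (alpha j) <= e -> j \in J.
Proof.
move=> /prodf_neq0/(_ j isT); case: ifP => // _ + jK pj.
by rewrite near_weight_eq1 // subrr eqxx.
Qed.

(* A convex combination of the projections of [p] to the faces of the chamber, which
   moves the points near a wall onto that wall within their face of [P]. *)
Definition collapse p : V := \sum_J collapse_weight p J *: average A J p.

Lemma collapse_polytope p : P p -> P (collapse p).
Proof.
move=> Pp; apply: convex_hull_sum => [J _|J _ _|].
- exact: collapse_weight_ge0.
- exact: average_polytope.
- exact: collapse_weight_sum.
Qed.

Lemma collapse_dominant p : dominant A K p -> dominant A K (collapse p).
Proof.
move=> dp k kK; rewrite ip_suml sumr_ge0 // => J _; rewrite ipZl.
have [->|h] := eqVneq (collapse_weight p J) 0; first by rewrite mul0r.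
rewrite mulr_ge0 ?collapse_weight_ge0 //; apply: (@average_dominant _ _ A J K) => //.
by apply/fintype.subsetP => j /(collapse_weight_near h)[].
Qed.

Lemma collapse_wall p j : j \in K -> ip p (alpha j) <= e ->
  ip (collapse p) (alpha j) = 0.
Proof.
move=> jK pj; rewrite ip_suml big1 // => J _; rewrite ipZl.
have [->|h] := eqVneq (collapse_weight p J) 0; first by rewrite mul0r.
by rewrite average_perp ?mulr0 // (collapse_weight_far h).
Qed.

(** Only walls whose pairing with [p] is below [d] are averaged over, and their roots are orthogonal
    to [u]. *)
Lemma collapse_face p u : dominant A K p -> face A P u p -> face A P u (collapse p).
Proof.
move=> dp Fp; split=> [|y Py]; first exact/collapse_polytope/Fp.1.
have -> : ip (collapse p) u = ip p u; last exact: Fp.2.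
rewrite ip_suml -[RHS]mul1r -[1 in RHS](collapse_weight_sum p) mulr_suml.
apply: eq_bigr => J _; rewrite ipZl.
have [->|h] := eqVneq (collapse_weight p J) 0; first by rewrite !mul0r.
congr (_ * _); apply: (face_const _ Fp); apply: average_face => // j jJ.
have [jK pj] := collapse_weight_near h jJ.
by apply: (face_root_perp aC dP Fp (alpha_root A j)); rewrite ger0_norm // dp.
Qed.

Lemma average_continuous J : continuous (average A J).
Proof.
(* The case distinction makes the summand continuous for every function [w], as [sum_continuous]
   demands, and not just for members of the list. *)
pose F (w : V -> V) p :=
  if `[< parabolic A J w >] then (size (parabolic_seq A J))%:R^-1 *: w p else 0.
have h : continuous (fun p => \sum_(w <- parabolic_seq A J) F w p).
  apply: sum_continuous => w; rewrite /F; case: asboolP => gw; last exact: cst_continuous.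
  apply: continuous_scale; first exact: cst_continuous.
  exact/(@weyl_continuous _ _ A)/(parabolic_weyl gw).
suff -> : average A J = fun p => \sum_(w <- parabolic_seq A J) F w p by exact: h.
apply/funext => p; rewrite /average !big_seq; apply: eq_bigr => w.
by rewrite mem_parabolic_seq /F => ->.
Qed.

Lemma clamp_comp_continuous (T : topologicalType) (f : T -> R) :
  continuous f -> continuous (fun x => clamp (f x)).
Proof.
move=> cf x; apply: (@continuous_comp _ _ _ f (@clamp R)); first exact: cf.
exact: clamp_continuous.
Qed.

Lemma near_weight_continuous i : continuous (fun p => near_weight p i).
Proof.
rewrite /near_weight; case: (i \in K); last exact: cst_continuous.
have h : continuous (fun p => clamp (ip p (alpha i) / e - 1)).
  apply: clamp_comp_continuous; apply: continuous_subr; last exact: cst_continuous.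
  by apply: continuous_mul; [exact: ip_continuous|exact: cst_continuous].
by apply: continuous_subr => //; exact: cst_continuous.
Qed.

Lemma collapse_continuous : continuous collapse.
Proof.
apply: sum_continuous => J; apply: continuous_scale; last exact: average_continuous.
apply: prod_continuous => i; case: (i \in J); first exact: near_weight_continuous.
by apply: continuous_subr; [exact: cst_continuous|exact: near_weight_continuous].
Qed.

Definition push (t : R) p : V := (1 - t) *: collapse p + t *: p.

Lemma push1 p : push 1 p = p.
Proof. by rewrite /push subrr scale0r add0r scale1r. Qed.

Lemma push0 p : push 0 p = collapse p.
Proof. by rewrite /push subr0 scale1r scale0r addr0. Qed.

Lemma push_cut t p : 0 <= t <= 1 -> D p -> D (push t p).
Proof.
move=> t01 [Pp dp]; split.
  by apply: convex_hull_conv => //; exact: collapse_polytope.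
have /andP[t0 t1] := t01.
move=> k kK; rewrite ipDl !ipZl addr_ge0 // mulr_ge0 ?subr_ge0 //.
  exact: collapse_dominant.
exact: dp.
Qed.

Lemma push_face t p u : 0 <= t <= 1 -> D p -> face A P u p -> face A P u (push t p).
Proof.
move=> t01 Dp Fp; apply: face_conv => //; first by have [] := push_cut t01 Dp.
by apply: collapse_face => //; exact: cut_dominant Dp.
Qed.

Lemma push_walls t p : D p -> walls A K p \subset walls A K (push t p).
Proof.
move=> Dp; apply/fintype.subsetP => j; rewrite !inE => /andP[jK /eqP pj].
rewrite jK ipDl !ipZl pj mulr0 addr0 collapse_wall ?mulr0 //.
  by rewrite eqxx.
by rewrite pj ltW // half_gap_gt0.
Qed.

Lemma push_continuous (T : topologicalType) (t : T -> R) (f : T -> V) :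
  continuous t -> continuous f -> continuous (fun x => push (t x) (f x)).
Proof.
move=> ct cf; apply: continuous_add; apply: continuous_scale => //.
  by apply: continuous_subr => //; exact: cst_continuous.
by move=> x; exact: cvg_comp (cf x) (@collapse_continuous (f x)).
Qed.

(** The pairing with [alpha j] in units of the collar width, raised to [1] during the first half of
    the time; at level [1] the wall takes no part in the contraction. *)
Definition wall_level (s : R) p (j : 'I_n) : R :=
  Num.max (clamp (ip p (alpha j) / e)) (clamp (2 * s)).

Definition push_time (s : R) : R := clamp (2 * s - 1).

(** Below level [1] the time is less than [1/2], when the push is still a full collapse, and [p]
    lies in the collar. The pushed point is then on the wall, where the identifications that the
    contraction needs are available. *)
Lemma wall_level_push s p j : j \in K -> wall_level s p j < 1 ->
  j \in walls A K (push (push_time s) p).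
Proof.
move=> jK; rewrite gt_max => /andP[/clamp_lt1 pj /clamp_lt1 s2].
rewrite inE jK /push_time clamp_eq0; last by rewrite subr_le0 ltW.
rewrite push0 collapse_wall ?eqxx //; rewrite ltr_pdivrMr ?half_gap_gt0 // mul1r in pj.
exact: ltW.
Qed.

Lemma wall_level_ge0 s p j : 0 <= wall_level s p j.
Proof. by rewrite le_max clamp_ge0. Qed.

Lemma wall_level_walls s p j k : j \in walls A K p ->
  wall_level s p j <= wall_level s p k.
Proof.
move=> /wallsP[_ pj]; rewrite /wall_level pj mul0r clamp0 (max_r (clamp_ge0 _)).
by rewrite le_max lexx orbT.
Qed.

Lemma wall_level0 p j : j \in walls A K p -> wall_level 0 p j = 0.
Proof.
by move=> /wallsP[_ pj]; rewrite /wall_level pj mul0r mulr0 clamp0 maxxx.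
Qed.

Lemma wall_level1 p j : wall_level 1 p j = 1.
Proof.
rewrite /wall_level (clamp_eq1 (x := 2 * 1)) ?max_r ?clamp_le1 //.
by rewrite mulr1 ler1n.
Qed.

Lemma level_weight_continuous (T : topologicalType) (s : T -> R) (f : T -> V) J :
  continuous s -> continuous f ->
  continuous (fun x => level_weight K (wall_level (s x) (f x)) J).
Proof.
move=> cs cf; have cl j : continuous (fun x => wall_level (s x) (f x) j).
  have c1 : continuous (fun x => clamp (ip (f x) (alpha j) / e) : R^o).
    apply: clamp_comp_continuous; apply: continuous_mul; last exact: cst_continuous.
    by move=> y; exact: cvg_comp (cf y) (@ip_continuous _ _ A (alpha j) (f y)).
  have c2 : continuous (fun x => clamp (2 * s x) : R^o).
    by apply: clamp_comp_continuous; apply: continuous_mul => //; exact: cst_continuous.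
  by move=> x; exact: (continuous_max (c1 x) (c2 x)).
apply: prod_continuous => j; apply: continuous_mul.
  apply: clamp_comp_continuous; apply: continuous_mul; first exact: cst_continuous.
  by apply: continuous_subr; [exact: cst_continuous|exact: cl].
apply: prod_continuous => k; apply: clamp_comp_continuous; apply: continuous_mul.
  exact: cst_continuous.
by apply: continuous_subr; exact: cl.
Qed.

End Collapse.

(** * Charts of the toric spaces *)

Section Charts.
Variables (R : realType) (n : nat) (A : rootDatum R n).
Local Notation V := 'rV[R]_n.
Local Notation ip := (ip A).
Local Notation alpha := (alpha A).
Local Notation N := (coweight_lattice A).
Local Notation torus := (torus A).
Local Notation torus_pi := (torus_pi A).

Lemma torus_pi_quotient : quotient_map torus_pi.
Proof. exact: (@quotient_map_pi V (Quotient.quot N)). Qed.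

(** The projection is open, because the preimage of the image of an open set is the union of its
    lattice translates. *)
Lemma torus_pi_nbhs (v : V) (B : set V) : nbhs v B -> nbhs (torus_pi v) (torus_pi @` B).
Proof.
rewrite (@nbhsE V) => -[C [oC Cv] CB].
apply: (@filterS _ _ _ (torus_pi @` C)); first exact: image_subset.
apply: open_nbhs_nbhs; split; last by exists v.
apply: (quotient_map_open torus_pi_quotient); rewrite openE => v' [b Cb /torus_pi_eq bE].
have ct : continuous (fun x : V => x + (b - v')).
  apply: (@continuous_add _ V V id (fun=> b - v')); last exact: cst_continuous.
  by move=> x U hU; exact: hU.
have : nbhs v' [set x | C (x + (b - v'))].
  by apply: (ct v'); apply: open_nbhs_nbhs; split=> //; rewrite addrC subrK.
apply: filterS => x Cx; exists (x + (b - v')) => //.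
by apply/torus_pi_eq; rewrite addrAC subrr add0r.
Qed.

Section Class.
Variable B : set V.

Definition chart (x : V * B) : toric A B := toric_class (torus_pi x.1) x.2.

Lemma chart_quotient : quotient_map chart.
Proof.
pose f (x : V * B) : torus * B := (torus_pi x.1, x.2).
have hf : quotient_map f.
  split=> [[t p]||O oO].
  - by have [v <-] := quotient_map_surj torus_pi_quotient t; exists (v, p).
  - apply: continuous_pair; last exact: continuous_snd.
    apply: continuous_compose; first exact: continuous_fst.
    exact: quotient_map_continuous torus_pi_quotient.
  - rewrite openE => -[t p] Otp; have [v vE] := quotient_map_surj torus_pi_quotient t.
    have : nbhs (v, p) (f @^-1` O).
      by apply: open_nbhs_nbhs; split=> //; rewrite /preimage /= /f /= vE.
    move=> [[C E] [/= Cv Ep] CE]; exists (torus_pi @` C, E).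
      by split=> //=; rewrite -vE; exact: torus_pi_nbhs.
    by move=> [_ q] [/= [x Cx <-] Eq]; apply: (CE (x, q)).
exact: quotient_map_comp hf (@quotient_map_pi (torus * B)%type {eq_quot @toric_rel R n A B}).
Qed.

Lemma chart_eq (v v' : V) (p p' : B) : chart (v, p) = chart (v', p') <->
  p = p' /\ exists2 x, normal_span A B (set_val p) x & v - v' - x \in N.
Proof.
rewrite toric_class_eq /=; split=> -[pp' h]; split=> //; move: h.
  move=> [x hx]; rewrite -torus_piB => /torus_pi_eq xE; exists x => //.
  by rewrite -opprB rpredN.
move=> [x hx xE]; exists x => //; rewrite -torus_piB; apply/torus_pi_eq.
by rewrite -opprB rpredN.
Qed.

End Class.

Variables (a : V) (aC : chamber A a).
Variables (d : R) (d0 : 0 < d) (dP : forall i, d <= ip a (alpha i)).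
Variable K : {set 'I_n}.
Local Notation P := (weyl_polytope A a).
Local Notation D := (cut_polytope A a K).

Lemma orbit_class_eq (x y : toric A P) :
  orbit_class K x = orbit_class K y <-> orbit_rel K x y.
Proof.
split=> h; last by have : x = y %[mod {eq_quot @orbit_rel R n A a K}] by exact/eqmodP.
by have : x = y %[mod {eq_quot @orbit_rel R n A a K}] by [] => /eqmodP.
Qed.

Lemma cutP (p : D) : D (set_val p).
Proof. exact: set_valP. Qed.

Definition cut_mk (p : V) (Dp : D p) : D := exist _ p (mem_set Dp).

Definition cut_incl (p : D) : P := exist _ (set_val p) (mem_set (cutP p).1).

Definition orbit_chart (x : V * D) : orbit_space A a K :=
  orbit_class K (chart (x.1, cut_incl x.2)).

Lemma orbit_chart_eqv (v v' : V) (p : D) :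
  lattice_eqv A (walls A K (set_val p)) v v' -> orbit_chart (v, p) = orbit_chart (v', p).
Proof.
move=> [w gw Nw]; apply/orbit_class_eq/asboolP.
exists w, v, (cut_incl p), (cut_incl p); split=> //.
- by apply: parabolicS gw; apply/fintype.subsetP => j; rewrite inE => /andP[].
- exact/esym/(walls_fix gw).
- apply/chart_eq; split=> //; exists 0; first exact: linear_hull0.
  by rewrite subr0.
Qed.

Lemma orbit_chart_span (v u : V) (p : D) : normal_span A P (set_val p) u ->
  orbit_chart (v + u, p) = orbit_chart (v, p).
Proof.
move=> hu; congr orbit_class; apply/chart_eq; split=> //; exists u => //.
by rewrite addrAC addrK subrr rpred0.
Qed.

Lemma normal_span_walls p u j : normal_span A P p u -> j \in walls A K p ->
  ip (alpha j) u = 0.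
Proof.
move=> hu /wallsP[_ pj]; apply: (normal_span_perp aC dP _ _ hu).
  exact: alpha_root.
by rewrite pj normr0.
Qed.

(** Two dominant points of one orbit coincide, so [w] fixes [p] and lies in the group of its walls.
    That group fixes the normals of [P] at [p], so the two normal corrections merge into one. *)
Lemma orbit_chart_inj (v v' : V) (p p' : D) :
  orbit_chart (v, p) = orbit_chart (v', p') ->
  p = p' /\ exists2 u, normal_span A P (set_val p) u &
    lattice_eqv A (walls A K (set_val p)) v (v' - u).
Proof.
move=> /orbit_class_eq/asboolP[w [v1 [p1 [q1 [gw q1E]]]]].
move=> /chart_eq[p1E [x1 hx1 Nx1]] /chart_eq[q1E' [x2 hx2 Nx2]].
have p1E' : set_val p1 = set_val p by rewrite -p1E.
have q1E2 : set_val p' = w (set_val p) by rewrite -p1E' -q1E -q1E'.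
have dp := cut_dominant (cutP p).
have wp : w (set_val p) = set_val p.
  by apply: dominant_uniq gw => //; rewrite -q1E2; exact: cut_dominant (cutP p').
have pp' : p = p' by apply: val_inj; rewrite -!set_valE q1E2 wp.
split=> //; have gw' := dominant_stab dp gw wp.
have ww := parabolic_weyl gw.
rewrite /= in hx1 hx2; rewrite -pp' in hx2.
exists (x2 - x1); first exact: linear_hullB.
exists w => //.
have wx1 : w x1 = x1.
  by apply: (parabolic_fix gw') => j; exact: normal_span_walls hx1.
have -> : v' - (x2 - x1) - w v = v' - w v1 - x2 - w (v - v1 - x1).
  by rewrite !(weylB ww) wx1; apply/rowP => i; rewrite !mxE; ring.
by rewrite rpredB // weyl_coweight.
Qed.

Lemma orbit_chart_rep (v : V) (p : P) w (q : D) : parabolic A K w ->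
  set_val q = w (set_val p) ->
  orbit_class K (chart (v, p)) = orbit_chart (w v, q).
Proof.
move=> gw qE; apply/orbit_class_eq/asboolP.
by exists w, v, p, (cut_incl q); split.
Qed.

Lemma nbhs_set_type (B : set V) (p : B) (U : set B) : nbhs p U ->
  exists2 U', nbhs (set_val p) U' & forall q : B, U' (set_val q) -> U q.
Proof.
move=> [_ /= [[W oW <-] /= Wp WU]]; exists W; first exact: open_nbhs_nbhs.
by move=> q Wq; exact: WU.
Qed.

Lemma set_val_continuous (B : set V) : continuous (set_val : B -> V).
Proof. exact: initial_continuous. Qed.

(* [V * P] is covered by finitely many closed pieces, one for each [w] in [W_K] that
   moves [p] into the chamber. *)
Lemma orbit_chart_quotient : quotient_map orbit_chart.
Proof.
have hP : quotient_map (fun x : V * P => orbit_class K (chart x)).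
  exact: quotient_map_comp (@chart_quotient P)
    (@quotient_map_pi (toric A P) {eq_quot @orbit_rel R n A a K}).
have repP (p : P) : exists w (q : D), parabolic A K w /\ set_val q = w (set_val p).
  have [w gw dw] := parabolic_dominant_exists K (set_val p) aC.
  have Dw : D (w (set_val p)).
    split=> //; apply: weyl_polytope_stable (parabolic_weyl gw) _; exact: set_valP.
  by exists w, (cut_mk Dw); split.
split.
- move=> y; have [[v p] <-] := quotient_map_surj hP y.
  have [w [q [gw qE]]] := repP p; exists (w v, q).
  exact/esym/orbit_chart_rep.
- apply: (@continuous_compose _ _ _ (fun x : V * D => (x.1, cut_incl x.2))
    (fun x : V * P => orbit_class K (chart x))); last exact: quotient_map_continuous hP.
  apply: continuous_pair; first exact: continuous_fst.
  apply: (@continuous_comp_initial P _ V set_val).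
  apply: (@continuous_compose _ _ _ snd (set_val : D -> V)); first exact: continuous_snd.
  exact: set_val_continuous.
move=> O oO; apply: (quotient_map_open hP); rewrite openE => -[v p] Ovp.
pose Q (w : V -> V) := [set x : V * P | forall q : D,
  parabolic A K w -> set_val q = w (set_val x.2) -> O (orbit_chart (w x.1, q))].
have Qnear w : nbhs (v, p) (Q w).
  have [gw|ngw] := pselect (parabolic A K w); last by apply: nbhs_all => x q.
  have cw := weyl_continuous (parabolic_weyl gw).
  have cw2 : continuous (fun x : V * P => w (set_val x.2)).
    apply: (@continuous_compose _ _ _ (fun x : V * P => set_val x.2) w) => //.
    apply: (@continuous_compose _ _ _ snd (set_val : P -> V)); first exact: continuous_snd.
    exact: set_val_continuous.
  (* If [w] takes [p] outside the chamber, it does so nearby, where the condition becomes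
     vacuous. *)
  have [dw|/existsNP[k /not_implyP[kK /negP]]] :=
      pselect (dominant A K (w (set_val p))); last first.
    rewrite -ltNge => wk.
    have ck : continuous (fun x : V * P => ip (w (set_val x.2)) (alpha k)).
      exact: (continuous_compose cw2 (@ip_continuous _ _ A (alpha k))).
    have := ck (v, p); move/cvgr_lt => /(_ 0 wk).
    apply: (@filterS _ (nbhs (v, p))) => x /= xk q _ qE; have := (cutP q).2 k kK.
    by rewrite qE leNgt xk.
  have Dw : D (w (set_val p)).
    split=> //; apply: weyl_polytope_stable (parabolic_weyl gw) _; exact: set_valP.
  have : nbhs (w v, cut_mk Dw) (orbit_chart @^-1` O).
    apply: open_nbhs_nbhs; split=> //; rewrite /preimage /=.
    by rewrite -(@orbit_chart_rep v p w (cut_mk Dw)).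
  move=> [[C E] [/= Cwv /nbhs_set_type[E' E'p EE'] CE]].
  have : nbhs (v, p) [set x : V * P | C (w x.1) /\ E' (w (set_val x.2))].
    have c1 : continuous (fun x : V * P => w x.1).
      exact: (continuous_compose (@continuous_fst V P) cw).
    have h1 : nbhs (v, p) [set x | C (w x.1)] by exact: c1.
    have h2 : nbhs (v, p) [set x | E' (w (set_val x.2))] by exact: cw2.
    exact: (filterI h1 h2).
  apply: (@filterS _ (nbhs (v, p))) => x [/= Cx Ex] q _ qE; apply: (CE (w x.1, q)); split=> //=.
  by apply: EE'; rewrite qE.
have Qall := nbhs_seq (parabolic_seq A K) Qnear.
suff : [set x | forall w, w \in parabolic_seq A K -> Q w x] `<=`
    (fun x : V * P => orbit_class K (chart x)) @^-1` O.
  by move/filterS; apply; exact: Qall.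
move=> -[v' p'] h.
have [w [q [gw qE]]] := repP p'; rewrite /preimage /= (orbit_chart_rep _ gw qE).
apply: h => //; rewrite mem_parabolic_seq; exact/asboolP.
Qed.

End Charts.

(** * The homotopy equivalence *)

Section HomotopyEquivalence.
Variables (R : realType) (n : nat) (A : rootDatum R n).
Local Notation V := 'rV[R]_n.
Local Notation ip := (ip A).
Local Notation alpha := (alpha A).
Local Notation N := (coweight_lattice A).
Variables (a : V) (aC : chamber A a).
Variables (d : R) (d0 : 0 < d) (dP : forall i, d <= ip a (alpha i)).
Variable K : {set 'I_n}.
Local Notation P := (weyl_polytope A a).
Local Notation D := (cut_polytope A a K).
Local Notation orbit_chart := (@orbit_chart R n A a K).
Local Notation cut_chart := (@chart R n A D).

Lemma clamp01 (t : R) : 0 <= clamp t <= 1.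
Proof. by rewrite clamp_ge0 clamp_le1. Qed.

(** The clamp extends the push to all real times, since [quotient_map_factor_homotopy] works with
    maps on the product with the whole line. *)
Definition cut_push (t : R) (p : D) : D :=
  cut_mk (push_cut d0 (clamp01 t) (cutP p)).

Lemma cut_pushE t p : set_val (cut_push t p) = push A d K (clamp t) (set_val p).
Proof. by []. Qed.

Lemma cut_push_eq1 t p : 1 <= t -> cut_push t p = p.
Proof. by move=> t1; apply: val_inj; rewrite -!set_valE cut_pushE clamp_eq1 // push1. Qed.

Lemma cut_push_le0 t p : t <= 0 -> cut_push t p = cut_push 0 p.
Proof. by move=> t0; apply: val_inj; rewrite -!set_valE !cut_pushE clamp0 clamp_eq0. Qed.

Lemma cut_push_span t p u : normal_span A P (set_val p) u ->
  normal_span A P (set_val (cut_push t p)) u.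
Proof.
apply: normal_span_face => w; rewrite cut_pushE.
by apply: push_face => //; [exact: clamp01|exact: cutP].
Qed.

Lemma cut_push_walls t (p : D) :
  walls A K (set_val p) \subset walls A K (set_val (cut_push t p)).
Proof. by rewrite cut_pushE; apply: push_walls => //; exact: cutP. Qed.

Lemma cut_push_continuous : continuous (fun x : D * R => cut_push x.2 x.1).
Proof.
apply: (@continuous_comp_initial D _ V set_val).
apply: push_continuous; first exact/clamp_comp_continuous/continuous_snd.
by apply: continuous_compose; [exact: continuous_fst|exact: set_val_continuous].
Qed.

Definition level (s : R) (p : D) := wall_level A d s (set_val p).

Lemma level_cut_push s (p : D) j : j \in K -> level s p j < 1 ->
  j \in walls A K (set_val (cut_push (2 * s - 1) p)).
Proof. exact: wall_level_push. Qed.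

(* At time 1 this is [orbit_chart]; at time 0 it collapses the directions spanned by
   the walls through the second component and so factors through [cut_chart]. *)
Definition deform (x : V * D * R) : orbit_space A a K :=
  orbit_chart (contract A a K (level x.2 x.1.2) x.1.1, cut_push (2 * x.2 - 1) x.1.2).

(** The vector [contract] may jump with its arguments. By [contract_near] the jumps are undone by
    the group of the walls through the pushed point and the lattice, changes that [orbit_chart] does
    not see. *)
Lemma deform_continuous : continuous deform.
Proof.
move=> [[v0 p0] s0]; set h0 := contract A a K (level s0 p0) v0.
set q0 := cut_push (2 * s0 - 1) p0.
move=> O hO; have : nbhs (h0, q0) (orbit_chart @^-1` O).
  exact: (quotient_map_continuous (orbit_chart_quotient aC K)).
move=> [[B C] [/= Bh0 /nbhs_set_type[C' C'q0 CC']] BC].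
have [r r0 hr] := nbhs_ip_ball A Bh0.
have [t t0 ht] := contract_near aC K (level s0 p0) v0 r0.
pose pr (x : V * D * R) : D := x.1.2.
have cpr : continuous pr by exact: continuous_compose (@continuous_fst _ _) (@continuous_snd _ _).
have cval : continuous (fun x : V * D * R => set_val (pr x)).
  exact: continuous_compose cpr (@set_val_continuous R n D).
have n1 : nbhs (v0, p0, s0) [set x | ip (x.1.1 - v0) (x.1.1 - v0) < t].
  have cv : continuous (fun x : V * D * R => x.1.1).
    exact: continuous_compose (@continuous_fst _ _) (@continuous_fst _ _).
  exact: (cv (v0, p0, s0) _ (ip_ball_nbhs A v0 t0)).
have n2 : nbhs (v0, p0, s0) [set x | C' (set_val (cut_push (2 * x.2 - 1) (pr x)))].
  have c2 : continuous (fun x : V * D * R => set_val (cut_push (2 * x.2 - 1) (pr x))).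
    apply: push_continuous => //; apply: clamp_comp_continuous.
    apply: continuous_subr; last exact: cst_continuous.
    by apply: continuous_mul; [exact: cst_continuous|exact: continuous_snd].
  exact: (c2 (v0, p0, s0)).
have n3 : nbhs (v0, p0, s0) [set x | forall J, J \in levels K ->
    `|level_weight K (level x.2 (pr x)) J - level_weight K (level s0 p0) J| < t].
  apply: nbhs_seq => J.
  have cJ : continuous (fun x : V * D * R => level_weight K (level x.2 (pr x)) J).
    by apply: level_weight_continuous => //; exact: continuous_snd.
  exact: (@continuous_dist_nbhs _ _ _ (v0, p0, s0) _ cJ t0).
refine (filterS _ (filterI n1 (filterI n2 n3))).
move=> [[v p] s] [/= h1 [h2 h3]].
have [y hy yr] := ht _ (walls A K (set_val (cut_push (2 * s - 1) p))) v
  (@level_cut_push s p) h3 h1.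
rewrite /preimage /= /deform /= (orbit_chart_eqv hy).
by apply: (BC (y, _)); split=> /=; [exact: hr|exact: CC'].
Qed.

(** The roots of the active walls vanish at the pushed point, where [u] is still normal, so they are
    orthogonal to [u] and the contraction carries [u] along unchanged. The group part is respected
    because the walls through [p] have the lowest level. *)
Lemma deform_orbit x y s : orbit_chart x = orbit_chart y -> deform (x, s) = deform (y, s).
Proof.
case: x y => [v p] [v' p'] /(orbit_chart_inj aC d0 dP)[<- [u hu vv']] {p'}.
rewrite /deform /=; set q := cut_push _ p.
have hq : normal_span A P (set_val q) u by exact: cut_push_span.
rewrite -[v' in RHS](subrK u) (@contract_perp _ _ A a K _ (walls A K (set_val q)) _ u).
- rewrite orbit_chart_span //; apply: orbit_chart_eqv.
  apply: (contract_eqv aC (Z := walls A K (set_val p))) vv'.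
  + exact: level_cut_push.
  + exact: cut_push_walls.
  + by apply/fintype.subsetP => j; rewrite inE => /andP[].
  + by move=> j k jp _; exact: wall_level_walls jp.
- exact: level_cut_push.
- by move=> j; exact: (normal_span_walls aC d0 dP hq).
Qed.

(** A normal vector of the cut splits into one of [P], treated as in [deform_orbit], and a
    combination of wall roots, which is forgotten at time [0] because the walls through [p] then
    have level [0]. *)
Lemma deform_cut x y : cut_chart x = cut_chart y -> deform (x, 0) = deform (y, 0).
Proof.
case: x y => [v p] [v' p'] /chart_eq[<- [z hz Nz]] {p'}.
have Dp := cutP p; have [u [w [hu hw zE]]] := normal_span_cut_decomp aC Dp hz.
rewrite /deform /=; set q := cut_push _ p.
have hq : normal_span A P (set_val q) u by exact: cut_push_span.
have lq := @level_cut_push 0 p.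
have -> : v = v' + w + (v - v' - z) + u.
  by rewrite zE; apply/rowP => i; rewrite !mxE; ring.
rewrite (@contract_perp _ _ A a K _ (walls A K (set_val q)) _ u) //; last first.
  by move=> j; exact: (normal_span_walls aC d0 dP hq).
rewrite orbit_chart_span //; apply/esym; apply: orbit_chart_eqv.
apply: lattice_eqv_trans.
  apply: (contract_collapse aC _ lq _ _ _ hw).
  - by move=> k _; exact: wall_level_ge0.
  - by apply/fintype.subsetP => j; rewrite inE => /andP[].
  - by move=> j; exact: wall_level0.
(* What remains is a lattice vector, an equivalence for the empty set of walls. *)
apply: (contract_eqv aC (Z := finset.set0)) => //.
- exact: finset.sub0set.
- exact: finset.sub0set.
- by move=> j k; rewrite inE.
- exists id; first exact: reflection_group_id.
  by rewrite addrAC subrr add0r.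
Qed.

Lemma deform1 x : deform (x, 1) = orbit_chart x.
Proof.
case: x => v p; rewrite /deform /= cut_push_eq1; last by lra.
by rewrite contract_id // => j _; exact: wall_level1.
Qed.

Lemma orbit_cut x y : orbit_chart x = orbit_chart y -> cut_chart x = cut_chart y.
Proof.
case: x y => [v p] [v' p'] /(orbit_chart_inj aC d0 dP)[<- [u hu [w gw Nw]]] {p'}.
apply/chart_eq; split=> //; have Dp := cutP p.
exists (v - w v - u).
  apply: linear_hullB; last exact: (normal_span_cut aC d0 dP Dp hu).
  apply: (normal_span_wall aC Dp); rewrite -opprB; apply: spanJN.
  exact: parabolic_spanJ.
have -> : v - v' - (v - w v - u) = - (v' - u - w v).
  by apply/rowP => i; rewrite !mxE; ring.
by rewrite rpredN.
Qed.

(** Pushing keeps [p] on its faces of [P] and on its walls, so both parts of a normal vector remain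
    normal. *)
Lemma cut_push_cut t x y : cut_chart x = cut_chart y ->
  cut_chart (x.1, cut_push t x.2) = cut_chart (y.1, cut_push t y.2).
Proof.
case: x y => [v p] [v' p'] /chart_eq[<- [z hz Nz]] {p'} /=.
have Dp := cutP p; have [u [w [hu hw zE]]] := normal_span_cut_decomp aC Dp hz.
apply/chart_eq; split=> //; exists z => //; rewrite zE.
have Dq := cutP (cut_push t p); apply: linear_hullD.
  by apply: (normal_span_cut aC d0 dP Dq); exact: cut_push_span.
by apply: (normal_span_wall aC Dq); exact: spanJ_sub (cut_push_walls t p) hw.
Qed.

Lemma homotopy_of_continuous (X Y : topologicalType) (f g : X -> Y) (H : X * R -> Y) :
  continuous H -> (forall x, H (x, 0) = f x) -> (forall x, H (x, 1) = g x) ->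
  homotopic R f g.
Proof. by move=> cH H0 H1; exists H; split=> //; exact: continuous_subspaceT. Qed.

Lemma orbit_map_equivalence :
  exists Phi_K : orbit_space A a K -> toric A D,
    unique (@is_orbit_map R n A a K) Phi_K /\ homotopy_equivalence R Phi_K.
Proof.
have q1 := orbit_chart_quotient aC K; have q2 := @chart_quotient R n A D.
have [Phi cPhi PhiE] := quotient_map_factor q1 (quotient_map_continuous q2) orbit_cut.
exists Phi; split.
  have torusE := quotient_map_surj (torus_pi_quotient A).
  split=> [t p q pq|f fP].
    have [v <-] := torusE t; have -> : p = cut_incl q by apply: val_inj; rewrite -!set_valE.
    exact: (PhiE (v, q)).
  apply/funext => y; have [[v q] <-] := quotient_map_surj q1 y.
  by rewrite PhiE; apply/esym; exact: fP.
split=> //.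
have c0 : continuous (fun x : V * D => deform (x, 0)).
  apply: continuous_compose deform_continuous; apply: continuous_pair.
    by move=> x U hU; exact: hU.
  exact: cst_continuous.
have [g cg gE] := quotient_map_factor q2 c0 deform_cut.
exists g; split=> //.
- have [H cH HE] := quotient_map_factor_homotopy q1 deform_continuous deform_orbit.
  apply: (homotopy_of_continuous cH) => y; have [x <-] := quotient_map_surj q1 y.
    by rewrite HE /= PhiE gE.
  by rewrite HE deform1.
(* On the target it suffices to move [p]: at time [0] the contraction shifts [v] only along roots of
   walls through the pushed point, which are normal directions there. *)
- pose f (x : V * D * R) := cut_chart (x.1.1, cut_push x.2 x.1.2).
  have cf : continuous f.
    apply: (continuous_compose _ (quotient_map_continuous q2)); apply: continuous_pair.
      exact: continuous_compose (@continuous_fst _ _) (@continuous_fst _ _).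
    apply: (@continuous_compose _ _ _ (fun x : V * D * R => (x.1.2, x.2))
      (fun x : D * R => cut_push x.2 x.1)); last exact: cut_push_continuous.
    apply: continuous_pair; last exact: continuous_snd.
    exact: continuous_compose (@continuous_fst _ _) (@continuous_snd _ _).
  have [|H cH HE] := quotient_map_factor_homotopy q2 cf.
    by move=> x y s; exact: cut_push_cut.
  apply: (homotopy_of_continuous cH) => y; have [[v p] <-] := quotient_map_surj q2 y.
    rewrite HE /= gE /deform PhiE /f /=.
    (* At time [0] the push parameter in [deform] is [-1], which the clamp identifies with [0]. *)
    rewrite (@cut_push_le0 (2 * 0 - 1)); last by lra.
    apply/esym/chart_eq; split=> //.
    exists (contract A a K (level 0 p) v - v); last by rewrite subrr rpred0.
    apply: (normal_span_wall aC (cutP _)); apply: contract_spanJ => j jK lj.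
    rewrite -(@cut_push_le0 (2 * 0 - 1)); last by lra.
    exact: level_cut_push.
  by rewrite HE /f /= cut_push_eq1.
Qed.

End HomotopyEquivalence.

Theorem theorem1p2 (R : realType) (n : nat) (A : rootDatum R n)
    (a : 'rV[R]_n) (aC : chamber A a) (aQ : root_lattice A a)
    (K : {set 'I_n}) :
  exists Phi_K : orbit_space A a K -> toric A (cut_polytope A a K),
    unique (@is_orbit_map R n A a K) Phi_K /\ homotopy_equivalence R Phi_K.
Proof.
have [d d0 dP] := chamber_gap aC.
exact: (orbit_map_equivalence aC d0 dP K).
Qed.
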